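(* For $2 \leq p \leq q \leq \infty$ and $n \leq m$ one has \[ \mathrm{vb}_{n}(B_p^m,B_q^m) \lesssim \frac{\sqrt{\min\{ p, \log (\frac{2m}{n}) \}}}{\frac{1}{2}-\frac{1}{p}+\frac{1}{q}} \cdot n^{1/2-1/p+1/q}. \] The time to find the corresponding coloring (that is, given $\boldsymbol{v}_1,\dots,\boldsymbol{v}_n\in B_p^m$, to find $\boldsymbol{x}\in\{-1,1\}^n$ for which $\|\sum_{i=1}^n x_i\boldsymbol{v}_i\|_q \lesssim \frac{\sqrt{\min\{ p, \log (\frac{2m}{n}) \}}}{\frac{1}{2}-\frac{1}{p}+\frac{1}{q}} \cdot n^{1/2-1/p+1/q}$) is $O(\log n) \cdot T(m,n)$.
   Context: $m,n$ are positive integers; $B_p^m := \{ \boldsymbol{x} \in \mathbb{R}^m \mid \|\boldsymbol{x}\|_p \leq 1\}$; $1/\infty=0$ and $1/0=+\infty$ (so the bound is vacuous for $p=2,q=\infty$). $A\lesssim B$ means $A\le C\cdot B$ for a universal constant $C>0$. For symmetric convex bodies $P,Q\subseteq\mathbb{R}^m$, with $\|\boldsymbol{x}\|_Q=\min\{s\ge 0\mid \boldsymbol{x}\in sQ\}$, \[ \mathrm{vb}_{n}(P,Q) := \sup\Big\{ \min_{\boldsymbol{x} \in \{ -1,1\}^n} \Big\| \sum_{i=1}^n x_i\boldsymbol{v}_i \Big\|_Q \ \Big|\ \boldsymbol{v}_1,\ldots,\boldsymbol{v}_n \in P \Big\}. \] $T(m,n)$: for $\boldsymbol{A}\in\mathbb{R}^{m\times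 n}$ with rows $\boldsymbol{A}_1,\dots,\boldsymbol{A}_m$ and $\boldsymbol{x}_0\in[-1,1]^n$, $\mathcal{D}(\boldsymbol{A},\boldsymbol{x}_0)$ denotes the (Lovett–Meka) distribution on $[-1,1]^n$ with the following properties, where $C_1,C_2>0$ are fixed, small enough universal constants. (A) For all $\boldsymbol{x}\sim\mathcal{D}(\boldsymbol{A},\boldsymbol{x}_0)$, $|\{j\in[n]: x_j\in\{\pm1\}\}|\ge n/2$. (B) For all $\boldsymbol{x}\sim\mathcal{D}(\boldsymbol{A},\boldsymbol{x}_0)$, $\|\boldsymbol{A}(\boldsymbol{x}-\boldsymbol{x}_0)\|_\infty\le\Delta$, where $\Delta\ge0$ is any parameter satisfying $\sum_{i=1}^m\exp(-C_1\Delta^2/\|\boldsymbol{A}_i\|_2^2)\le C_2 n$. (C) $\mathbb{E}[\boldsymbol{x}]=\boldsymbol{x}_0$. (D) $\boldsymbol{x}-\boldsymbol{x}_0$ is $O(1)$-subgaussian; in particular $\|\langle\boldsymbol{A}_i,\boldsymbol{x}-\boldsymbol{x}_0\rangle\|_{\psi_2}\lesssim\|\boldsymbol{A}_i\|_2$ for all $i$, where $\|Y\|_{\psi_2}=\inf\{s>0:\mathbb{E}[\exp(Y^2/s^2)]\le2\}$. $T(m,n)$ is the best running time to generate a sample from this distribution; it is assumed to be non-decreasing in $m$ and $n$ with $T(m,n)\ge mn$, and it is known that $T(m,n)\le O(n^{1+\omega}+n^2m)$, where $\omega$ is the exponent of matrix multiplication. *)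

(* Defs.v *)
(* MathComp-Analysis; the reals are an arbitrary [R : realType]. *)
From HB Require Import structures.
From mathcomp Require Import all_boot all_order all_algebra.
From mathcomp Require Import all_classical all_reals all_analysis.

Set Implicit Arguments.
Unset Strict Implicit.
Unset Printing Implicit Defensive.

Import Order.TTheory GRing.Theory Num.Theory.
Import numFieldNormedType.Exports.

Local Open Scope classical_set_scope.
Local Open Scope ring_scope.

(* The exponent ranges over the extended reals; only 1 <= p <= +oo is meant. *)
Definition lp_norm (R : realType) (m : nat) (p : \bar R) (x : 'cV[R]_m) : R :=
  match p with
  | r%:E => (\sum_(i < m) `|x i 0| `^ r) `^ r^-1
  | _ => \big[Num.max/0]_(i < m) `|x i 0|
  end.

Definition lp_ball (R : realType) (m : nat) (p : \bar R) : set 'cV[R]_m :=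
  [set x | lp_norm p x <= 1].

Definition sign_vector (R : realType) (n : nat) (x : 'cV[R]_n) : Prop :=
  forall j, x j 0 = 1 \/ x j 0 = -1.

Definition signed_sum (R : realType) (m n : nat)
    (v : 'I_n -> 'cV[R]_m) (x : 'cV[R]_n) : 'cV[R]_m :=
  \sum_(j < n) x j 0 *: v j.

(* For a symmetric convex body Q the infimum is attained; it is +oo when
   no multiple of Q contains x. *)
Definition gauge (R : realType) (m : nat) (Q : set 'cV[R]_m) (x : 'cV[R]_m) :
    \bar R :=
  ereal_inf [set s%:E | s in
    [set s : R | 0 <= s /\ exists2 y, Q y & x = s *: y]].

(* The inner infimum is over the finite nonempty set {-1,1}^n, hence a minimum. *)
Definition vb (R : realType) (m n : nat) (P Q : set 'cV[R]_m) : \bar R :=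
  ereal_sup [set ereal_inf [set gauge Q (signed_sum v x) | x in @sign_vector R n]
            | v in [set v : 'I_n -> 'cV[R]_m | forall j, P (v j)]].

(* The inverse on \bar R satisfies +oo^-1 = 0 and 0^-1 = +oo. *)
Definition vb_exponent (R : realType) (p q : \bar R) : \bar R :=
  (2%:E^-1 - p^-1 + q^-1)%E.

Definition vb_rate (R : realType) (m n : nat) (p q : \bar R) : \bar R :=
  ((Num.sqrt (fine (Order.min p (ln (2 * m%:R / n%:R))%:E)))%:E
    * (vb_exponent p q)^-1
    * (n%:R `^ fine (vb_exponent p q))%:E)%E.

Definition good_coloring (R : realType) (C : R) (m n : nat) (p q : \bar R)
    (v : 'I_n -> 'cV[R]_m) (x : 'cV[R]_n) : Prop :=
  sign_vector x /\
  ((lp_norm q (signed_sum v x))%:E <= C%:E * vb_rate m n p q)%E.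

(* Borel probability measures on R^n; tuples carry the product sigma-algebra. *)
Definition law (R : realType) (n : nat) :=
  probability (n.-tuple (measurableTypeR R)) R.

Definition col_of_tuple (R : realType) (n : nat) (y : n.-tuple R) : 'cV[R]_n :=
  \col_j tnth y j.

Definition sampler (R : realType) :=
  forall m n : nat, 'M[R]_(m, n) -> 'cV[R]_n -> law R n.

Definition psi2_norm (R : realType) d (Omega : measurableType d)
    (P : probability Omega R) (Y : Omega -> R) : \bar R :=
  ereal_inf [set s%:E | s in
    [set s : R | 0 < s /\
      (\int[P]_w (expR (Y w ^+ 2 / s ^+ 2))%:E <= 2%:E)%E]].

(* exp(- C1 Delta^2 / |A_i|^2) is read as 0 for a zero row A_i, so the sum
   ranges over the nonzero rows. *)
Definition lm_width (R : realType) (C1 C2 : R) (m n : nat)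
    (A : 'M[R]_(m, n)) (Delta : R) : Prop :=
  0 <= Delta /\
  \sum_(i < m | row i A != 0)
    expR (- (C1 * Delta ^+ 2 / lp_norm 2%:E (row i A)^T ^+ 2)) <= C2 * n%:R.

Record lovett_meka (R : realType) (C1 C2 K : R) (m n : nat)
    (A : 'M[R]_(m, n)) (x0 : 'cV[R]_n) (mu : law R n) : Prop := LovettMeka {
  lm_cube : {ae mu, forall y, forall j, -1 <= tnth y j <= 1};
  lm_half : {ae mu, forall y,
    (n <= 2 * #|[set j : 'I_n | ((tnth y j == 1) || (tnth y j == -1))%R]%SET|)%N};
  lm_disc : forall Delta, lm_width C1 C2 A Delta ->
    {ae mu, forall y, lp_norm +oo%E (A *m (col_of_tuple y - x0)) <= Delta};
  lm_mean : forall j : 'I_n, ('E_mu[fun y => tnth y j] = (x0 j 0)%:E)%E;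
  lm_subgaussian : forall theta : 'cV[R]_n,
    (psi2_norm mu (fun y => (theta^T *m (col_of_tuple y - x0)) 0 0)%R
       <= (K * lp_norm 2%:E theta)%:E)%E }.

Definition lovett_meka_sampler (R : realType) (C1 C2 K : R) (D : sampler R) :=
  forall (m n : nat) (A : 'M[R]_(m, n)) (x0 : 'cV[R]_n),
    (0 < m)%N -> (0 < n)%N -> (forall j, -1 <= x0 j 0 <= 1) ->
    lovett_meka C1 C2 K A x0 (D m n A x0).

Definition sampling_time (T : nat -> nat -> nat) : Prop :=
  (forall m m' n n' : nat, (0 < m <= m')%N -> (0 < n <= n')%N ->
     (T m n <= T m' n')%N) /\
  (forall m n : nat, (0 < m)%N -> (0 < n)%N -> (m * n <= T m n)%N).

(* Algorithms are programs of a real RAM with integer variables, named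
   two-dimensional real arrays, unit-cost exact real arithmetic (including exp
   and ln, needed to evaluate q-norms) and one source of randomness, [Sample].
   A program is a finite syntactic object that does not mention [R]; its only
   constants are natural numbers. *)
Inductive nexp : Type :=
| NVar of nat
| NConst of nat
| NAdd of nexp & nexp
| NSub of nexp & nexp.

Inductive rexp : Type :=
| RCell of nat & nexp & nexp
| ROfNat of nexp
| RAdd of rexp & rexp
| RSub of rexp & rexp
| RMul of rexp & rexp
| RDiv of rexp & rexp
| RExp of rexp
| RLn of rexp.

Inductive bexp : Type :=
| NLe of nexp & nexp
| RLe of rexp & rexp
| BNot of bexp
| BAnd of bexp & bexp.

Inductive cmd : Type :=
| Skip
| NSet of nat & nexp
| RSet of nat & nexp & nexp & rexp
| Seq of cmd & cmd
| If of bexp & cmd & cmd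
| While of bexp & cmd
(* [Sample a b c k l]: draw from D(A, x0), where A is the upper left k x l
   block of array a and x0 consists of the first l entries of row 0 of
   array b, and store the outcome in the first l entries of row 0 of array c. *)
| Sample of nat & nat & nat & nexp & nexp.

Record state (R : realType) : Type := State {
  var : nat -> nat;
  arr : nat -> nat -> nat -> R }.

Definition set_var (R : realType) (s : state R) (x k : nat) : state R :=
  State (fun y => if y == x then k else var s y) (arr s).

Definition set_cell (R : realType) (s : state R) (a i j : nat) (r : R) :
    state R :=
  State (var s)
    (fun a' i' j' => if [&& a' == a, i' == i & j' == j] then r
                     else arr s a' i' j').

Definition set_row (R : realType) (s : state R) (a l : nat) (y : l.-tuple R) :
    state R :=
  State (var s)
    (fun a' i' j' => if [&& a' == a, i' == 0%N & (j' < l)%N]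
                     then nth 0 y j' else arr s a' i' j').

Fixpoint neval (R : realType) (s : state R) (e : nexp) : nat :=
  match e with
  | NVar x => var s x
  | NConst k => k
  | NAdd e1 e2 => (neval s e1 + neval s e2)%N
  | NSub e1 e2 => (neval s e1 - neval s e2)%N
  end.

Fixpoint reval (R : realType) (s : state R) (e : rexp) : R :=
  match e with
  | RCell a i j => arr s a (neval s i) (neval s j)
  | ROfNat k => (neval s k)%:R
  | RAdd e1 e2 => reval s e1 + reval s e2
  | RSub e1 e2 => reval s e1 - reval s e2
  | RMul e1 e2 => reval s e1 * reval s e2
  | RDiv e1 e2 => reval s e1 / reval s e2
  | RExp e1 => expR (reval s e1)
  | RLn e1 => ln (reval s e1)
  end.

Fixpoint beval (R : realType) (s : state R) (g : bexp) : bool :=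
  match g with
  | NLe e1 e2 => (neval s e1 <= neval s e2)%N
  | RLe e1 e2 => reval s e1 <= reval s e2
  | BNot g1 => ~~ beval s g1
  | BAnd g1 g2 => beval s g1 && beval s g2
  end.

(* What remains to be run, as a function of the remaining time and the state. *)
Definition continuation (R : realType) := nat -> state R -> \bar R.

Definition spend (R : realType) (k : nat) (f : continuation R) :
    continuation R :=
  fun b s => if (k <= b)%N then f (b - k)%N s else 0%E.

(* [run D T c f b s] is the expectation of f, evaluated at the time left and the
   state reached, when c is run from s with b units of time; runs that exceed
   the time b count for 0. Every elementary command and every test of a guard
   takes one unit, and [Sample] takes T k l units on top of that. Since each
   iteration of a loop takes at least one unit, b.+1 unfoldings are enough.
   Successive samples are drawn independently given the state. If D is not
   measurable in its arguments, the integral of a nonmeasurable function is a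
   lower integral, so that probabilities of success are never overestimated. *)
Fixpoint run (R : realType) (D : sampler R) (T : nat -> nat -> nat)
    (c : cmd) (f : continuation R) (b : nat) (s : state R) {struct c} :
    \bar R :=
  match c with
  | Skip => spend 1 f b s
  | NSet x e => spend 1 (fun b' s' => f b' (set_var s' x (neval s' e))) b s
  | RSet a i j e =>
      spend 1 (fun b' s' =>
        f b' (set_cell s' a (neval s' i) (neval s' j) (reval s' e))) b s
  | Seq c1 c2 => run D T c1 (run D T c2 f) b s
  | If g c1 c2 =>
      spend 1 (fun b' s' =>
        if beval s' g then run D T c1 f b' s' else run D T c2 f b' s') b s
  | While g c1 =>
      iter b.+1 (fun W : continuation R =>
        spend 1 (fun b' s' => if beval s' g then run D T c1 W b' s' else f b' s'))
        (fun _ _ => 0%E) b s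
  | Sample a x c' ek el =>
      let k := neval s ek in let l := neval s el in
      let A : 'M[R]_(k, l) := \matrix_(i, j) arr s a i j in
      let x0 : 'cV[R]_l := \col_j arr s x 0 j in
      spend (T k l).+1 (fun b' s' =>
        \int[D k l A x0]_y f b' (set_row s' c' y))%E b s
  end.

Definition success_probability (R : realType) (D : sampler R)
    (T : nat -> nat -> nat) (c : cmd) (s : state R) (Q : set (state R))
    (t : nat) : \bar R :=
  run D T c (fun _ s' => (\1_Q s')%:E) t s.

(* With tau the time at which c halts in a state of Q (tau = +oo if it never
   does), this is E[tau] = \sum_t P(tau > t). Finiteness implies that c almost
   surely halts in a state of Q. *)
Definition expected_time (R : realType) (D : sampler R)
    (T : nat -> nat -> nat) (c : cmd) (s : state R) (Q : set (state R)) :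
    \bar R :=
  (\sum_(0 <= t <oo) (1 - success_probability D T c s Q t))%E.

(* Input: m and n in variables 0 and 1, the vectors v_j as the columns of array
   0, and 1/p, 1/q in row 0 of array 1. *)
Definition input_state (R : realType) (m n : nat) (p q : \bar R)
    (v : 'I_n -> 'cV[R]_m) : state R :=
  State
    (fun x => if x == 0%N then m else if x == 1%N then n else 0%N)
    (fun a i j =>
       if a == 0%N then
         match insub i : option 'I_m, insub j : option 'I_n with
         | Some i', Some j' => v j' i' 0
         | _, _ => 0
         end
       else if (a == 1%N) && (i == 0%N) then
         if j == 0%N then fine p^-1 else if j == 1%N then fine q^-1 else 0
       else 0).

(* Output: the first n entries of row 0 of array 2. *)
Definition output (R : realType) (n : nat) (s : state R) : 'cV[R]_n :=
  \col_(j < n) arr s 2 0 j.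

(* Main.v *)
Require Import Defs.
From HB Require Import structures.
From mathcomp Require Import all_boot all_order all_algebra.
From mathcomp Require Import all_classical all_reals all_analysis.
From mathcomp Require Import measurable_realfun measurable_fun_approximation.
From mathcomp Require Import ring lra zify.

Set Implicit Arguments.
Unset Strict Implicit.
Unset Printing Implicit Defensive.

Import Order.TTheory GRing.Theory Num.Theory.
Import numFieldNormedType.Exports.

Local Open Scope classical_set_scope.
Local Open Scope ring_scope.

(* Write e = 1/2 - 1/p + 1/q. Suppose that l vectors are still active, let A be the
   matrix with these columns and r = min(p, max(2, log(2m/l))). Two applications of
   Hoelder's inequality give sum_i |A_i|_2^r <= l (exp(1) rho)^r with
   rho = l^(1/2-1/p), the factor exp(r) absorbing (m/l)^(1-r/p). Hence
   Delta = c sqrt(r) rho satisfies the Lovett-Meka width condition, and the r-th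
   moments of the subgaussian coordinates of A(x - x0) sum to at most l Delta^r.
   Interpolating between l_r and l_infinity, a partial coloring costs
   O(Delta l^(1/q)) = O(sqrt(r) l^e) in the q-norm. As l decreases geometrically these
   costs form a geometric series of ratio about 2^(-e/2), the other half of l^e paying
   for the growth of the logarithm; this gives the factor 1/e.

   For the existence of a coloring no sampler is available. There the partial coloring
   is half the difference of two far apart sign vectors with small r-norms whose images
   round to the same multiples of 2 Delta; they exist by the pigeonhole principle, the
   number of roundings being bounded by Kraft's inequality with weights
   exp(- |b_i| Delta^2 / |A_i|_2^2).

   The program repeats the Lovett-Meka rounds on the active columns and accepts when e
   times the q-norm is within the bound. By Markov's inequality an attempt succeeds with
   probability at least 1/2, so the expected time is at most twice that of an attempt. *)

(** * Elementary inequalities *)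

(** The sampler is not assumed measurable in its arguments, so after a random round the rest of the
    run is a possibly nonmeasurable function of the sample, and its integral is only a lower
    integral. Mean imbalances therefore cannot be added up over the rounds and fed to Markov's
    inequality at the end. Instead, lower bounds of the form max(beta, alpha - kappa (imbalance +
    potential)) are carried backwards through the program. They survive a round as soon as the
    increase of the imbalance has a measurable majorant of known mean, and at the end of an attempt
    such a linear function lies below the step function that separates acceptance from rejection.
    What is tracked is e times the norm, not the norm, so that the rounds need no separate treatment
    of e = 0. *)

Section Inequalities.
Context {R : realType}.
Implicit Types w z t g u a x y : R.

(** Bernoulli's inequality: with w = exp(l), average the tangent bounds for exp((1 - t) l) and exp(-
    t l) with weights t and 1 - t, then multiply by exp(t l). *)
Lemma powR_le1D w t : 0 <= w -> 0 <= t <= 1 -> w `^ t <= 1 + t * (w - 1).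
Proof.
move=> w0 /andP[t0 t1].
move: w0; rewrite le_eqVlt => /predU1P[<-|w0].
  by rewrite /powR eqxx; case: eqP => [->|_] /=; lra.
rewrite /powR gt_eqF// -[in leRHS](@lnK _ w)//.
set l := ln w.
have h1 := expR_ge1Dx ((1 - t) * l).
have h2 := expR_ge1Dx (- (t * l)).
have -> : expR l = expR (t * l) * expR ((1 - t) * l).
  by rewrite -expRD; congr expR; ring.
have e0 : expR (t * l) * expR (- (t * l)) = 1 by rewrite expRxMexpNx_1.
have p0 := expR_gt0 (t * l).
have : expR (t * l) * (t * (1 + (1 - t) * l) + (1 - t) * (1 - t * l)) <=
  expR (t * l) * (t * expR ((1 - t) * l) + (1 - t) * expR (- (t * l))).
  by rewrite ler_pM2l// lerD// ler_wpM2l//; lra.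
have -> : t * (1 + (1 - t) * l) + (1 - t) * (1 - t * l) = 1 by ring.
rewrite mulr1 => /le_trans; apply.
rewrite mulrDr (mulrCA _ (1 - t)) e0; lra.
Qed.

Lemma powR_ge1D z g : 0 <= z -> 1 <= g -> 1 + g * (z - 1) <= z `^ g.
Proof.
move=> z0 g1.
have := @powR_le1D (z `^ g) g^-1 (powR_ge0 _ _).
rewrite -powRrM mulfV ?powRr1//; last by apply/eqP; lra.
have g0 : 0 < g by lra.
rewrite invr_ge0 (ltW g0)/= invf_le1// => /(_ g1).
rewrite -(ler_pM2l g0) mulrDr mulrA mulfV ?gt_eqF//; lra.
Qed.

(** Used in two directions: it bounds moments by exponential moments, and it makes exp(- u) decay
    like u^(-a), which reduces exponential sums to sums of powers of row norms. *)
Lemma powR_le_expR u a : 0 <= u -> 0 < a -> u `^ a <= a `^ a * expR u.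
Proof.
move=> u0 a0; move: u0; rewrite le_eqVlt => /predU1P[<-|u0].
  by rewrite powR0 ?gt_eqF// mulr_ge0// ?powR_ge0// expR_ge0.
rewrite /powR !gt_eqF// -expRD ler_expR.
have := @le_ln1Dx R (u / a - 1).
have ua : 0 < u / a by rewrite divr_gt0.
have e : 1 + (u / a - 1) = u / a by ring.
rewrite e => h.
have {h} : ln (u / a) <= u / a - 1 by apply: h; lra.
rewrite ln_div ?posrE// -(ler_pM2l a0) mulrBr mulrBr (mulrC a (u / a)) divfK ?gt_eqF//.
lra.
Qed.

Lemma expR_le_quadratic x : x <= 1 -> expR x <= 1 + x + 2 * x ^+ 2.
Proof.
move=> x1.
have h := expR_ge1Dx (- (x / 2)).
have -> : expR x = (expR (- (x / 2)))^-1 ^+ 2.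
  by rewrite -expRN opprK -expRM_natl; congr expR; field.
set y := expR _ in h *.
have y0 : 0 < 1 - x / 2 by lra.
have y1 : 0 < y by rewrite expR_gt0.
have y2 : y^-1 <= (1 - x / 2)^-1 by rewrite lef_pV2 ?posrE//; lra.
have y3 : y^-1 ^+ 2 <= (1 - x / 2)^-1 ^+ 2.
  by rewrite ler_sqr ?nnegrE ?invr_ge0 ?(ltW y0) ?(ltW y1).
apply: (le_trans y3); rewrite exprVn -div1r ler_pdivrMr ?exprn_gt0//.
(* The factored form of (1 + x + 2 x^2)(1 - x/2)^2 - 1. *)
have : 0 <= x ^+ 2 * ((1 - x) * (5 / 4 - x / 2)).
  by rewrite mulr_ge0 ?sqr_ge0// mulr_ge0//; lra.
lra.
Qed.

Lemma cosh_le x : expR x + expR (- x) <= 2 * expR (2 * x ^+ 2).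
Proof.
have [x1|x1] := leP `|x| 1.
  move: x1; rewrite ler_norml => /andP[x1 x2].
  have h1 := expR_le_quadratic x2.
  have /expR_le_quadratic h2 : - x <= 1 by lra.
  have h3 := expR_ge1Dx (2 * x ^+ 2); nra.
have h : `|x| <= 2 * x ^+ 2.
  by rewrite -real_normK ?num_real//; set z := `|x| in x1 *; nra.
have : expR x <= expR (2 * x ^+ 2).
  by rewrite ler_expR (le_trans _ h)// ler_norm.
have : expR (- x) <= expR (2 * x ^+ 2).
  by rewrite ler_expR (le_trans _ h)// -normrN ler_norm.
lra.
Qed.

(** Hoelder's inequality by tangents: [powR_le1D] at |I| f_i touches at the value 1/|I|, and the
    linear bounds are summed. *)
Lemma sum_powR_le (I : finType) (f : I -> R) t :
  (0 < #|I|)%N -> (forall i, 0 <= f i) -> \sum_i f i <= 1 -> 0 <= t <= 1 ->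
  \sum_i f i `^ t <= #|I|%:R `^ (1 - t).
Proof.
move=> I0 f0 f1 t01; have m0 : (0 : R) < #|I|%:R by rewrite ltr0n.
have ft i : f i `^ t <= #|I|%:R `^ (- t) * (1 + t * (#|I|%:R * f i - 1)).
  have := @powR_le1D (#|I|%:R * f i) t.
  rewrite mulr_ge0// ?(ltW m0)// => /(_ isT t01).
  rewrite powRM ?(ltW m0)// -(@ler_pM2l _ (#|I|%:R `^ (- t))) ?powR_gt0//.
  by rewrite mulrA -powRD ?addNr ?powRr0 ?mul1r// (gt_eqF m0) implybT.
apply: (le_trans (ler_sum _ (fun i _ => ft i))).
rewrite -mulr_sumr big_split/= -mulr_sumr sumrB -mulr_sumr.
rewrite sumr_const mulrC => {ft}.
have -> : #|(fun=> true) : pred I| = #|I| by apply: eq_card.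
rewrite powRD ?(gt_eqF m0) ?implybT// powRr1 ?(ltW m0)//.
rewrite ler_wpM2r ?powR_ge0//.
set S := \sum_i f i in f1 *.
move: t01 => /andP[t0 t1]; set m : R := #|I|%:R in m0 *.
have : 0 <= t * (m * (1 - S)) by rewrite !mulr_ge0 ?(ltW m0)//; lra.
lra.
Qed.

(** The power mean inequality: each term is compared with the tangent of z^g at the mean S/|I|. *)
Lemma powR_sum_le (I : finType) (f : I -> R) g :
  (0 < #|I|)%N -> (forall i, 0 <= f i) -> 1 <= g ->
  (\sum_i f i) `^ g <= #|I|%:R `^ (g - 1) * \sum_i f i `^ g.
Proof.
move=> I0 f0 g1; have m0 : (0 : R) < #|I|%:R by rewrite ltr0n.
have : 0 <= \sum_i f i by apply: sumr_ge0.
rewrite le_eqVlt => /predU1P[<-|S0].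
  rewrite powR0; last by apply/eqP; lra.
  by rewrite mulr_ge0 ?powR_ge0// sumr_ge0// => i _; rewrite powR_ge0.
set S := \sum_i f i in S0 *; set m : R := #|I|%:R in m0 *.
have fg i : S `^ g * m `^ (- g) * (1 + g * (m * f i / S - 1)) <= f i `^ g.
  have := @powR_ge1D (m * f i / S) g.
  rewrite !mulr_ge0 ?invr_ge0 ?(ltW S0) ?(ltW m0)// => /(_ isT g1).
  rewrite -(@ler_pM2l _ (S `^ g * m `^ (- g))) ?mulr_gt0 ?powR_gt0//.
  move=> /le_trans; apply; rewrite -!powR_inv1 ?(ltW S0)// !powRM ?mulr_ge0 ?powR_ge0 ?(ltW m0)//.
  rewrite -powRrM mulN1r.
  rewrite [leLHS](_ : _ = (S `^ g * S `^ (- g)) * (m `^ (- g) * m `^ g) * f i `^ g); last by ring.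
  by rewrite -!powRD ?addNr ?subrr ?powRr0 ?mul1r// ?(gt_eqF m0) ?(gt_eqF S0) implybT.
have := ler_sum (index_enum I) (fun i (_ : true) => fg i).
have -> : \sum_i S `^ g * m `^ (- g) * (1 + g * (m * f i / S - 1)) =
    S `^ g * m `^ (- g) * m.
  transitivity (\sum_i (S `^ g * m `^ (- g) * g * m / S * f i +
      S `^ g * m `^ (- g) * (1 - g))); first by apply: eq_bigr => i _; ring.
  rewrite big_split/= -mulr_sumr -/S sumr_const.
  have -> : #|(fun=> true) : pred I| = #|I| by apply: eq_card.
  by rewrite divfK ?gt_eqF// -mulr_natr -/m; ring.
rewrite -(@ler_pM2l _ (m `^ (g - 1))) ?powR_gt0// => /(le_trans _); apply.
have -> : m `^ (g - 1) * (S `^ g * m `^ (- g) * m) = S `^ g * (m `^ (g - 1) * m `^ (- g) * m `^ 1).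
  by rewrite (powRr1 (ltW m0)); ring.
by rewrite -!powRD ?(gt_eqF m0) ?implybT// [X in m `^ X](_ : _ = 0) ?powRr0 ?mulr1//; ring.
Qed.

End Inequalities.

(** * Norms *)

Section LpNorm.
Context {R : realType} {m : nat}.
Implicit Types (p q : \bar R) (r c : R) (x y : 'cV[R]_m).

Lemma lp_norm_ge0 q x : 0 <= lp_norm q x.
Proof.
rewrite /lp_norm; case: q => [r||]; rewrite ?powR_ge0//.
all: by apply: (big_ind (fun z => 0 <= z)) => // a b a0 b0; rewrite le_max a0.
Qed.

Lemma lp_norm_le_fin r x c : 0 < r -> 0 <= c ->
  (lp_norm r%:E x <= c) = (\sum_(i < m) `|x i 0| `^ r <= c `^ r).
Proof.
move=> r0 c0; rewrite /lp_norm.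
set S := \sum_(i < m) _.
have S0 : 0 <= S by apply: sumr_ge0 => i _; rewrite powR_ge0.
apply/idP/idP => h.
  have -> : S = (S `^ r^-1) `^ r by rewrite -powRrM mulVf ?powRr1// gt_eqF.
  by rewrite ge0_ler_powR ?nnegrE ?powR_ge0 ?(ltW r0).
have -> : c = (c `^ r) `^ r^-1 by rewrite -powRrM mulfV ?powRr1// gt_eqF.
by rewrite ge0_ler_powR ?nnegrE ?powR_ge0// invr_ge0 (ltW r0).
Qed.

Lemma lp_norm_le_y x c : 0 <= c ->
  (lp_norm +oo%E x <= c) <-> (forall i, `|x i 0| <= c).
Proof.
move=> c0; rewrite /lp_norm; split=> [h i|h].
  by apply: le_trans h; rewrite (bigD1 i)//= le_max lexx.
by apply: (big_ind (fun z => z <= c)) => // a b ac bc; rewrite ge_max ac.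
Qed.

Lemma lp_norm0 q : (0%:E < q)%E -> @lp_norm R m q 0 = 0.
Proof.
move=> q0; apply/le_anti; rewrite lp_norm_ge0 andbT.
case: q q0 => [r||]//; last first.
  by move=> _; apply/lp_norm_le_y => // i; rewrite mxE normr0.
rewrite lte_fin => r0; rewrite lp_norm_le_fin// big1 ?powR_ge0// => i _.
by rewrite mxE normr0 powR0// gt_eqF.
Qed.

Lemma lp_normZ_le q a x : (0%:E < q)%E -> lp_norm q (a *: x) <= `|a| * lp_norm q x.
Proof.
case: q => [r||]// q0; last first.
  apply/lp_norm_le_y; first by rewrite mulr_ge0 ?lp_norm_ge0.
  move=> i; rewrite mxE normrM ler_wpM2l//.
  by move: i; apply/lp_norm_le_y; rewrite ?lp_norm_ge0.
rewrite lte_fin in q0.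
rewrite lp_norm_le_fin ?mulr_ge0 ?lp_norm_ge0// powRM ?lp_norm_ge0//.
rewrite [X in _ <= X](_ : _ = \sum_(i < m) `|a| `^ r * `|x i 0| `^ r).
  by apply: ler_sum => i _; rewrite mxE normrM powRM.
rewrite -mulr_sumr; congr (_ * _).
rewrite -powRrM mulVf ?gt_eqF// powRr1//.
by apply: sumr_ge0 => i _; rewrite powR_ge0.
Qed.

(** The point of the ball is x/c, so the bound c must be positive even when x = 0. *)
Lemma gauge_le q x c : (0%:E < q)%E -> 0 < c -> lp_norm q x <= c ->
  (gauge (lp_ball q) x <= c%:E)%E.
Proof.
move=> q0 c0 h; apply: ereal_inf_lbound; exists c => //; split; first exact: ltW.
exists (c^-1 *: x); last by rewrite scalerA mulfV ?gt_eqF// scale1r.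
rewrite /lp_ball/=; apply: (le_trans (lp_normZ_le _ _ q0)).
by rewrite gtr0_norm ?invr_gt0// ler_pdivrMl// mulr1.
Qed.

(** Convexity of z^r with weights s and t, by the tangent at u = (a + b)/(s + t). With s and t close
    to the two norms it yields Minkowski's inequality. *)
Let convex_powR_pair r (a b s t : R) : 1 <= r -> 0 < s -> 0 < t -> 0 <= a -> 0 <= b ->
  (a + b) `^ r <= (s + t) `^ (r - 1) * (s * (a / s) `^ r + t * (b / t) `^ r).
Proof.
move=> r1 s0 t0 a0 b0.
have [->|ab0] := eqVneq (a + b) 0.
  rewrite powR0; last by apply/eqP; lra.
  by rewrite mulr_ge0 ?powR_ge0// addr_ge0// mulr_ge0 ?powR_ge0// ltW.
have {}ab0 : 0 < a + b by rewrite lt0r ab0 addr_ge0.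
have st0 : 0 < s + t by rewrite addr_gt0.
pose u := (a + b) / (s + t).
have u0 : 0 < u by rewrite divr_gt0.
have H z : 0 <= z -> u `^ r * (1 + r * (z / u - 1)) <= z `^ r.
  move=> z0; have := @powR_ge1D _ (z / u) r.
  rewrite mulr_ge0 ?invr_ge0 ?(ltW u0)// => /(_ isT r1).
  rewrite -(@ler_pM2l _ (u `^ r)) ?powR_gt0// => /le_trans; apply.
  rewrite -powRM ?(ltW u0) ?mulr_ge0 ?invr_ge0 ?(ltW u0)//.
  by rewrite mulrCA mulfV ?mulr1// gt_eqF.
have -> : (a + b) `^ r = (s + t) `^ (r - 1) * ((s + t) * u `^ r).
  rewrite mulrA (mulrC _ (s + t)) mulr_powRB1 ?(ltW st0)//; last by lra.
  by rewrite -powRM ?(ltW st0) ?(ltW u0)// /u mulrC divfK ?gt_eqF.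
rewrite ler_wpM2l ?powR_ge0//.
have ha : 0 <= a / s by rewrite divr_ge0// ltW.
have hb : 0 <= b / t by rewrite divr_ge0// ltW.
have h2 := H _ ha; have h1 := H _ hb.
rewrite -(ler_pM2l t0) in h1; rewrite -(ler_pM2l s0) in h2.
apply: (le_trans _ (lerD h2 h1)).
rewrite le_eqVlt; apply/orP; left; apply/eqP.
have E : s * (a / s / u) + t * (b / t / u) = s + t.
  rewrite /u; field; lra.
transitivity (u `^ r * (s + t + r * ((s * (a / s / u) + t * (b / t / u)) - (s + t)))).
  by rewrite E subrr mulr0 addr0 mulrC.
ring.
Qed.

Lemma lp_norm_triangle q x y : (1%:E <= q)%E ->
  lp_norm q (x + y) <= lp_norm q x + lp_norm q y.
Proof.
case: q => [r||]// q1; last first.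
  apply/lp_norm_le_y; first by rewrite addr_ge0 ?lp_norm_ge0.
  move=> i; rewrite mxE (le_trans (ler_normD _ _))// lerD//.
    by move: i; apply/lp_norm_le_y; rewrite ?lp_norm_ge0.
  by move: i; apply/lp_norm_le_y; rewrite ?lp_norm_ge0.
rewrite lee_fin in q1; have r0 : 0 < r by lra.
apply/ler_addgt0Pr => e e0.
have Hx c : 0 <= c -> lp_norm r%:E x <= c -> \sum_(i < m) `|x i 0| `^ r <= c `^ r.
  by move=> c0; rewrite lp_norm_le_fin.
have Hy c : 0 <= c -> lp_norm r%:E y <= c -> \sum_(i < m) `|y i 0| `^ r <= c `^ r.
  by move=> c0; rewrite lp_norm_le_fin.
have Hxy c : 0 <= c -> \sum_(i < m) `|(x + y) i 0| `^ r <= c `^ r -> lp_norm r%:E (x + y) <= c.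
  by move=> c0; rewrite lp_norm_le_fin.
have Nx := lp_norm_ge0 r%:E x; have Ny := lp_norm_ge0 r%:E y.
move: (lp_norm r%:E x) (lp_norm r%:E y) (lp_norm r%:E (x + y)) Hx Hy Hxy Nx Ny.
move=> a b c Hx Hy Hxy a0 b0.
(* The slack e/2 keeps s and t positive even when a norm vanishes. *)
have [s sE] : exists s, s = a + e / 2 by eexists.
have [t tE] : exists t, t = b + e / 2 by eexists.
have s0 : 0 < s by lra.
have t0 : 0 < t by lra.
have -> : a + b + e = s + t by lra.
have hx := Hx s (ltW s0) ltac:(lra).
have hy := Hy t (ltW t0) ltac:(lra).
have st0 : 0 < s + t by rewrite addr_gt0.
apply: Hxy; first exact: ltW.
apply: (@le_trans _ _ (\sum_(i < m)
   (s + t) `^ (r - 1) * (s * (`|x i 0| / s) `^ r + t * (`|y i 0| / t) `^ r))).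
  apply: ler_sum => i _; apply: (le_trans _ (convex_powR_pair q1 s0 t0 (normr_ge0 _) (normr_ge0 _))).
  by rewrite ge0_ler_powR ?nnegrE ?addr_ge0 ?(ltW r0)// mxE ler_normD.
rewrite -mulr_sumr -[leRHS](mulr_powRB1 (ltW st0) r0) mulrC ler_wpM2r ?powR_ge0//.
have aux (z : 'cV[R]_m) d : 0 < d -> \sum_(i < m) `|z i 0| `^ r <= d `^ r ->
    \sum_(i < m) d * (`|z i 0| / d) `^ r <= d.
  move=> d0 h; rewrite -mulr_sumr -[leRHS]mulr1 ler_pM2l//.
  under eq_bigr do rewrite powRM ?invr_ge0 ?(ltW d0)//.
  rewrite -mulr_suml -powR_inv1 ?(ltW d0)// -powRrM mulN1r powRN.
  by rewrite ler_pdivrMr ?powR_gt0// mul1r.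
by rewrite big_split/= lerD// aux.
Qed.

(** For finite q = s, the sum of the |x_i|^s is at most Delta^(s-r) times that of the |x_i|^r. W is
    random in the Lovett-Meka rounds; bounding W^(1/q) by 1 + W makes the estimate linear in W, so
    that its mean suffices. *)
Lemma lp_norm_interpolation q x r (Delta l W : R) : (r%:E <= q)%E -> 1 <= r ->
  0 <= Delta -> 0 < l -> 0 <= W -> (forall i, `|x i 0| <= Delta) ->
  \sum_(i < m) `|x i 0| `^ r <= Delta `^ r * (l * W) ->
  lp_norm q x <= Delta * l `^ (fine q^-1%E) * (1 + W).
Proof.
move=> rq r1 D0 l0 W0 xD xr.
have B0 : 0 <= Delta * l `^ fine q^-1%E * (1 + W).
  by rewrite !mulr_ge0 ?powR_ge0 ?addr_ge0.
case: q rq B0 => [s||]// rs B0; last first.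
  apply/lp_norm_le_y => // i; rewrite (le_trans (xD i))//.
  by rewrite invey/= powRr0 mulr1 ler_peMr// lerDl.
rewrite lee_fin in rs.
have s0 : 0 < s by lra.
rewrite lp_norm_le_fin//.
move: D0; rewrite le_eqVlt => /predU1P[D0|D0].
  rewrite -D0 in xD *; rewrite !mul0r powR0 ?gt_eqF// big1// => i _.
  by have := xD i; rewrite normr_le0 => /eqP->; rewrite normr0 powR0 ?gt_eqF.
apply: (@le_trans _ _ (Delta `^ (s - r) * \sum_(i < m) `|x i 0| `^ r)).
  rewrite mulr_sumr; apply: ler_sum => i _.
  have [->|xi0] := eqVneq `|x i 0| 0.
    by rewrite !powR0 ?mulr0//; apply/eqP; lra.
  rewrite -[in leLHS](subrK r s) (@powRD _ _ (s - r) r) ?xi0 ?implybT// ler_wpM2r ?powR_ge0//.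
  by rewrite ge0_ler_powR ?nnegrE ?(ltW D0)//; lra.
apply: (@le_trans _ _ (Delta `^ (s - r) * (Delta `^ r * (l * W)))).
  by rewrite ler_wpM2l ?powR_ge0.
rewrite mulrA -powRD ?subrK ?(gt_eqF D0) ?implybT//.
rewrite !powRM ?mulr_ge0 ?powR_ge0 ?addr_ge0 ?(ltW D0)//.
rewrite inver gt_eqF//= -powRrM mulVf ?gt_eqF// powRr1 ?(ltW l0)// -mulrA.
rewrite !ler_wpM2l ?powR_ge0 ?(ltW l0)//.
apply: (@le_trans _ _ (1 + W)); first by rewrite lerDr.
by rewrite le1r_powR ?lerDl//; lra.
Qed.

End LpNorm.

(** * Moments and potential *)

Section Moments.
Context {R : realType}.
Implicit Types (p q : \bar R) (m n l : nat).

Definition log_ratio m l : R := ln (2 * m%:R / l%:R).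

(* The moment used when l vectors are active; it is finite even for p = +oo. *)
Definition moment p m l : R :=
  fine (Order.min p (Num.max 2 (log_ratio m l))%:E).

Lemma fine_inv_bounds p : (2%:E <= p)%E -> 0 <= fine p^-1%E <= 2^-1.
Proof.
case: p => [s||]//; last by rewrite invey/=; lra.
rewrite lee_fin => s2; rewrite inver gt_eqF/=; last by lra.
by rewrite invr_ge0 lef_pV2 ?posrE; lra.
Qed.

Lemma fine_inv_le p q : (2%:E <= p)%E -> (p <= q)%E -> fine q^-1%E <= fine p^-1%E.
Proof.
move=> p2 pq; have q2 := le_trans p2 pq.
case: p p2 pq => [s||]//; last by case: q q2.
rewrite lee_fin => s2; case: q q2 => [t||]//.
  rewrite !lee_fin => t2 st; rewrite !inver !gt_eqF/=; [|lra..].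
  by rewrite lef_pV2 ?posrE; lra.
by move=> _ _; rewrite invey inver gt_eqF/= ?invr_ge0; lra.
Qed.

Lemma vb_exponentE p q : (2%:E <= p)%E -> (p <= q)%E ->
  vb_exponent p q = (2^-1 - fine p^-1%E + fine q^-1%E)%:E.
Proof.
move=> p2 pq; have q2 := le_trans p2 pq; rewrite /vb_exponent.
have fin (x : \bar R) : (2%:E <= x)%E -> x^-1%E = (fine x^-1%E)%:E.
  case: x => [s||]//.
  by rewrite lee_fin => s2; rewrite inver gt_eqF//; lra.
by rewrite (fin _ p2) (fin _ q2) inver gt_eqF// ?ltr0n// -EFinN -!EFinD.
Qed.

Section Level.
Variables (p : \bar R) (m : nat).
Hypothesis p2 : (2%:E <= p)%E.

Lemma moment_spec l :
  (moment p m l = Num.max 2 (log_ratio m l) /\ ((moment p m l)%:E <= p)%E) \/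
  ((moment p m l)%:E = p /\ moment p m l <= Num.max 2 (log_ratio m l)).
Proof.
rewrite /moment; case: p p2 => [s||]// _; last first.
  by left; rewrite minye leey.
rewrite -EFin_min/=; have [h|h] := leP s (Num.max 2 (log_ratio m l)).
  by right.
by left; split=> //; rewrite lee_fin ltW.
Qed.

Lemma moment_ge2 l : 2 <= moment p m l.
Proof.
have [[-> _]|[e _]] := moment_spec l; first by rewrite le_max lexx.
by rewrite -lee_fin e.
Qed.

Lemma moment_le l : ((moment p m l)%:E <= p)%E.
Proof. by have [[_ ->]//|[-> _]] := moment_spec l. Qed.

Lemma moment_le_max l : moment p m l <= Num.max 2 (log_ratio m l).
Proof. by have [[-> _]//|[_ ->]] := moment_spec l. Qed.

Lemma moment_inv_le1 (r : R) : 2 <= r -> (r%:E <= p)%E -> r * fine p^-1%E <= 1.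
Proof.
move=> r2; case: p p2 => [s||]//; last by rewrite invey/= mulr0.
rewrite !lee_fin => s2 rs; rewrite inver gt_eqF/=; last by lra.
by rewrite ler_pdivrMr ?mul1r//; lra.
Qed.

(** If r = p, the exponent is 0; otherwise r >= log(2m/l) and the exponent is at most 1. *)
Lemma moment_ratio l : (0 < l <= m)%N ->
  (m%:R / l%:R) `^ (1 - moment p m l * fine p^-1%E) <= expR (moment p m l).
Proof.
move=> /andP[l0 lm]; have l0' : (0 : R) < l%:R by rewrite ltr0n.
have m0' : (0 : R) < m%:R by rewrite ltr0n (leq_trans l0).
have ml1 : (1 : R) <= m%:R / l%:R by rewrite ler_pdivlMr// mul1r ler_nat.
have r2 := moment_ge2 l; have [pi0 _] := andP (fine_inv_bounds p2).
have [[e _]|[e _]] := moment_spec l; last first.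
  have -> : fine p^-1%E = (moment p m l)^-1.
    by rewrite -[in LHS]e inver gt_eqF//; lra.
  rewrite mulfV ?subrr ?powRr0; last by apply/eqP; lra.
  by have := expR_ge1Dx (moment p m l); lra.
apply: (@le_trans _ _ (m%:R / l%:R)).
  by rewrite ler1_powR// gerBl mulr_ge0//; lra.
apply: (@le_trans _ _ (expR (log_ratio m l))).
  rewrite /log_ratio lnK ?posrE ?divr_gt0 ?mulr_gt0// -mulrA.
  by set z := _ / _ in ml1 *; lra.
by rewrite ler_expR e le_max lexx orbT.
Qed.

Lemma log_ratio_ge l : (0 < l <= m)%N -> 2^-1 <= log_ratio m l.
Proof.
move=> /andP[l0 lm]; have l0' : (0 : R) < l%:R by rewrite ltr0n.
have m0' : (0 : R) < m%:R by rewrite ltr0n (leq_trans l0).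
have ml1 : (1 : R) <= m%:R / l%:R by rewrite ler_pdivlMr// mul1r ler_nat.
rewrite -ler_expR /log_ratio lnK ?posrE ?divr_gt0 ?mulr_gt0//.
apply: (@le_trans _ _ 2); last by rewrite -mulrA; set z := _ / _ in ml1 *; lra.
have h := expR_ge1Dx (- 2^-1 : R).
rewrite -[leLHS]invrK -expRN -[leRHS]invrK lef_pV2 ?posrE ?invr_gt0 ?expR_gt0//.
lra.
Qed.

(** As log(2m/l) >= 1/2, replacing it by its maximum with 2 costs a factor of at most 4. *)
Lemma moment_le_rate l : (0 < l <= m)%N ->
  0 < fine (Order.min p (log_ratio m l)%:E) /\
  moment p m l <= 4 * fine (Order.min p (log_ratio m l)%:E).
Proof.
move=> lm; have L := log_ratio_ge lm.
have h : Num.max 2 (log_ratio m l) <= 4 * log_ratio m l.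
  by rewrite ge_max; apply/andP; split; lra.
have := moment_le_max l; have := moment_le l.
move: (moment p m l) => r rp r1.
case: p p2 rp => [s||]//.
  rewrite !lee_fin => s2 rp; rewrite -EFin_min/=.
  by case: (leP s (log_ratio m l)) => _; split; lra.
by move=> _ _; rewrite minye/=; split; lra.
Qed.

(* For p <= 4 both moments are between 2 and 4; otherwise e >= 1/4 and the growth of
   the logarithm is absorbed by the power. *)
Lemma moment_mono l n (e : R) : (0 < l <= n)%N -> (n <= m)%N ->
  2^-1 - fine p^-1%E <= e -> 0 <= e ->
  Num.sqrt (moment p m l) <=
    2 * Num.sqrt (moment p m n) * (n%:R / l%:R) `^ (e / 2).
Proof.
move=> /andP[l0 lln] nm pe e0.
have l0' : (0 : R) < l%:R by rewrite ltr0n.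
have n0' : (0 : R) < n%:R by rewrite ltr0n (leq_trans l0).
have m0' : (0 : R) < m%:R by rewrite ltr0n (leq_trans l0)// (leq_trans lln).
set t : R := n%:R / l%:R.
have t1 : 1 <= t by rewrite ler_pdivlMr// mul1r ler_nat.
have t0 : 0 < t by lra.
have rn := moment_ge2 n; have rl := moment_ge2 l.
have H : moment p m l <= 4 * moment p m n * t `^ e.
  have te1 : 1 <= t `^ e by rewrite -(@powRr0 _ t) ler_powR.
  have [pi4|pi4] := leP 4^-1 (fine p^-1%E).
    have r4 : moment p m l <= 4.
      have := moment_inv_le1 rl (moment_le l).
      move: (moment p m l) rl => r r2; set i := fine _ in pi4 * => ri.
      nra.
    apply: (le_trans r4); rewrite -[leLHS]mulr1 -mulrA ler_pM2l//.
    by rewrite -[leLHS]mulr1 ler_pM//; lra.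
  have Ll : log_ratio m l = log_ratio m n + ln t.
    rewrite /log_ratio -lnM ?posrE ?divr_gt0 ?mulr_gt0// /t.
    by congr exp.ln; field; rewrite !gt_eqF.
  have lt0 : 0 <= ln t by rewrite ln_ge0.
  have h1 : moment p m l <= moment p m n + ln t.
    have [[e1 h1]|[e1 h1]] := moment_spec n; last first.
      have : ((moment p m l)%:E <= (moment p m n)%:E)%E by rewrite e1 moment_le.
      by rewrite lee_fin; lra.
    have := moment_le_max l; rewrite Ll e1 => h2; apply: (le_trans h2).
    have g1 : 2 <= Num.max 2 (log_ratio m n) by rewrite le_max lexx.
    have g2 : log_ratio m n <= Num.max 2 (log_ratio m n) by rewrite le_max lexx orbT.
    by rewrite ge_max; apply/andP; split; lra.
  have h2 : e * ln t <= t `^ e - 1.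
    rewrite -ln_powR; have := @le_ln1Dx R (t `^ e - 1).
    by rewrite (_ : 1 + (t `^ e - 1) = t `^ e); [apply; lra|ring].
  have h3 : 1 + ln t <= 4 * t `^ e by nra.
  apply: (@le_trans _ _ (moment p m n * (1 + ln t))); first by nra.
  rewrite (mulrC 4) -mulrA ler_pM2l; lra.
rewrite -[leRHS]ger0_norm ?mulr_ge0 ?powR_ge0 ?sqrtr_ge0//.
rewrite -sqrtr_sqr ler_wsqrtr//; apply: (le_trans H).
rewrite !exprMn sqr_sqrtr; last by lra.
rewrite -(powR_mulrn 2 (powR_ge0 _ _)) -powRrM divfK//.
by rewrite ler_wpM2r ?powR_ge0//; lra.
Qed.

End Level.

(** Since (15/16)^(e/2) <= 1 - e/32, losing a sixteenth of the vectors frees at least e c X l^(e/2);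
    this is the origin of 32. *)
Lemma potential_step (e c X : R) (l l' : nat) : 0 <= e <= 1 -> 0 <= c * X ->
  16 * l'%:R <= 15 * l%:R :> R ->
  e * (c * X * l%:R `^ (e / 2)) + 32 * c * X * l'%:R `^ (e / 2) <=
    32 * c * X * l%:R `^ (e / 2).
Proof.
move=> e01 cX ll.
have h1 : l'%:R `^ (e / 2) <= (1 - e / 32) * l%:R `^ (e / 2).
  apply: (@le_trans _ _ ((15 / 16 * l%:R) `^ (e / 2))).
    by rewrite ge0_ler_powR ?nnegrE ?mulr_ge0//; lra.
  rewrite powRM ?divr_ge0//.
  rewrite ler_wpM2r ?powR_ge0//.
  have := @powR_le1D R (15 / 16) (e / 2).
  have -> : 0 <= 15 / 16 :> R by lra.
  have -> : 0 <= e / 2 <= 1 by lra.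
  by move=> /(_ isT isT); lra.
have := ler_wpM2l cX h1; lra.
Qed.

End Moments.

(** * Row norms of a matrix whose columns lie in the l_p ball *)

Section RowSums.
Context {R : realType}.
Implicit Types (p q : \bar R) (m : nat).

Lemma lp_ball_sum_powR p m (v : 'cV[R]_m) r : (2%:E <= p)%E -> 2 <= r ->
  (r%:E <= p)%E -> (0 < m)%N -> lp_ball p v ->
  \sum_(i < m) `|v i 0| `^ r <= m%:R `^ (1 - r * fine p^-1%E).
Proof.
move=> p2 r2 rp m0; rewrite /lp_ball/=.
case: p p2 rp => [s||]//.
  rewrite !lee_fin => s2 rs; rewrite lp_norm_le_fin//; last lra.
  rewrite powR1 => h; rewrite inver gt_eqF/=; last lra.
  have rt : 0 <= r / s <= 1.
    by rewrite divr_ge0/=; [rewrite ler_pdivrMr; lra|lra|lra].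
  have := @sum_powR_le R 'I_m (fun i => `|v i 0| `^ s) (r / s).
  rewrite card_ord => /(_ m0 (fun i => powR_ge0 _ _) h rt).
  apply: le_trans; rewrite le_eqVlt; apply/orP; left; apply/eqP.
  apply: eq_bigr => i _; rewrite -powRrM mulrCA mulfV ?mulr1//.
  by apply/eqP; lra.
move=> _ _ /lp_norm_le_y h; rewrite invey/= mulr0 subr0 powRr1//.
apply: (@le_trans _ _ (\sum_(i < m) 1)).
  apply: ler_sum => i _; have -> : 1 = 1 `^ r :> R by rewrite powR1.
  by rewrite ge0_ler_powR ?nnegrE// ?h//; lra.
by rewrite sumr_const card_ord.
Qed.

(* Hoelder's inequality in each row gives |A_i|_2^r <= l^(r/2-1) |A_i|_r^r, and the
   r-th powers of the entries are summed column by column. *)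
Lemma sum_row_norms p m (J : finType) (a : 'I_m -> J -> R) :
  (2%:E <= p)%E -> (0 < #|J| <= m)%N ->
  (forall j, lp_ball p (\col_i a i j)) ->
  \sum_(i < m) (\sum_j a i j ^+ 2) `^ (moment p m #|J| / 2) <=
    #|J|%:R * (expR 2 * (#|J|%:R `^ (2^-1 - fine p^-1%E)) ^+ 2)
      `^ (moment p m #|J| / 2).
Proof.
move=> p2 lm aP; have /andP[l0 lm'] := lm.
have r2 := moment_ge2 m p2 #|J|; have rp := moment_le m p2 #|J|.
have ratio := moment_ratio p2 lm.
set r := moment p m #|J| in r2 rp ratio *.
set l : R := #|J|%:R in ratio *.
have l0' : 0 < l by rewrite ltr0n.
have m0 : (0 < m)%N by rewrite (leq_trans l0).
have m0' : (0 : R) < m%:R by rewrite ltr0n.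
have g1 : 1 <= r / 2 by lra.
set b := fine p^-1%E in ratio *.
have row i : (\sum_j a i j ^+ 2) `^ (r / 2) <=
    l `^ (r / 2 - 1) * \sum_j `|a i j| `^ r.
  apply: le_trans (powR_sum_le l0 (fun j => sqr_ge0 (a i j)) g1) _.
  rewrite ler_wpM2l ?powR_ge0//; apply: ler_sum => j _.
  by rewrite -real_normK ?num_real// -powR_mulrn// -powRrM mulrCA mulfV// mulr1.
apply: (@le_trans _ _ (l `^ (r / 2 - 1) * (l * m%:R `^ (1 - r * b)))).
  apply: (@le_trans _ _ (\sum_(i < m) l `^ (r / 2 - 1) * \sum_j `|a i j| `^ r)).
    by apply: ler_sum => i _.
  rewrite -mulr_sumr ler_wpM2l ?powR_ge0// exchange_big/=.
  apply: (@le_trans _ _ (\sum_(j : J) m%:R `^ (1 - r * b))).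
    apply: ler_sum => j _; apply: le_trans (lp_ball_sum_powR p2 r2 rp m0 (aP j)).
    by apply: ler_sum => i _; rewrite mxE.
  rewrite sumr_const -[leLHS]mulr_natl.
  have -> : #|(fun=> true) : pred J| = #|J| by apply: eq_card.
  by rewrite lexx.
(* Splitting off l^(1-rb) leaves the power of m/l that [moment_ratio] bounds by exp(r), that is, by
   [expR 2] to the power r/2. *)
have -> : m%:R `^ (1 - r * b) = l `^ (1 - r * b) * (m%:R / l) `^ (1 - r * b).
  rewrite -powRM ?divr_ge0 ?(ltW l0') ?(ltW m0')//.
  by rewrite [l * _]mulrC divfK ?gt_eqF.
have -> : (expR 2 * (l `^ (2^-1 - b)) ^+ 2) `^ (r / 2) = expR r * l `^ (r / 2 - r * b).
  rewrite powRM ?expR_ge0 ?sqr_ge0// -expRM -powR_mulrn ?powR_ge0// -!powRrM.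
  by congr (expR _ * _ `^ _); field.
have -> : l `^ (r / 2 - 1) * (l * (l `^ (1 - r * b) * (m%:R / l) `^ (1 - r * b))) =
    l * (l `^ (r / 2 - r * b) * (m%:R / l) `^ (1 - r * b)).
  have -> : l `^ (r / 2 - r * b) = l `^ (r / 2 - 1) * l `^ (1 - r * b).
    by rewrite -powRD ?(gt_eqF l0') ?implybT//; congr (_ `^ _); ring.
  ring.
by rewrite ler_pM2l// mulrC ler_wpM2r ?powR_ge0.
Qed.

End RowSums.

(** * Partial colorings by the pigeonhole principle *)

Section Rademacher.
Context {R : realType} {J : finType}.
Implicit Types (x : {ffun J -> bool}) (u : J -> R).

Definition signed (u : J -> R) (x : {ffun J -> bool}) : R :=
  \sum_j (-1) ^+ (x j) * u j.

Lemma card_signs : #|{ffun J -> bool}| = (2 ^ #|J|)%N.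
Proof. by rewrite card_ffun card_bool. Qed.

Lemma rademacher_mgf u (t : R) :
  \sum_x expR (t * signed u x) <= 2 ^+ #|J| * expR (2 * t ^+ 2 * \sum_j u j ^+ 2).
Proof.
have -> : \sum_x expR (t * signed u x) =
    \sum_(x : {ffun J -> bool}) \prod_j (fun j (b : bool) => expR (t * ((-1) ^+ b * u j))) j (x j).
  by apply: eq_bigr => x _; rewrite mulr_sumr expR_sum.
rewrite -(bigA_distr_bigA (fun j (b : bool) => expR (t * ((-1) ^+ b * u j)))) /=.
have -> : 2 ^+ #|J| * expR (2 * t ^+ 2 * \sum_j u j ^+ 2) =
    \prod_(j : J) (2 * expR (2 * (t * u j) ^+ 2)).
  rewrite big_split/= prodr_const; congr (_ ^+ _ * _).
  rewrite mulr_sumr expR_sum; apply: eq_bigr => j _; congr expR; ring.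
apply: ler_prod => j _; apply/andP; split.
  by apply: sumr_ge0 => b _; rewrite expR_ge0.
rewrite big_bool/= expr0 expr1 mul1r mulN1r mulrN addrC.
exact: cosh_le.
Qed.

(** Khintchine's inequality, from |t z|^r <= r^r (exp(t z) + exp(- t z)) and the moment generating
    function. *)
Lemma rademacher_moment u (r : R) : 0 < r ->
  \sum_x `|signed u x| `^ r <=
    2 ^+ #|J| * (2 * (expR 4 * r * \sum_j u j ^+ 2) `^ (r / 2)).
Proof.
move=> r0.
have : 0 <= \sum_j u j ^+ 2 by apply: sumr_ge0 => j _; rewrite sqr_ge0.
rewrite le_eqVlt => /predU1P[/esym S0|S0].
  rewrite big1 => [|x _]; first by rewrite !mulr_ge0 ?powR_ge0 ?exprn_ge0.
  rewrite /signed big1 ?normr0 ?powR0 ?gt_eqF// => j _.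
  have /eqP := S0; rewrite psumr_eq0 => [|i _]; last by rewrite sqr_ge0.
  by move=> /allP/(_ j (mem_index_enum _)); rewrite sqrf_eq0 => /eqP ->; rewrite mulr0.
set S := \sum_j u j ^+ 2 in S0 *.
(* This choice makes the exponent 2 t^2 S of the generating function equal to 2 r. *)
pose t := Num.sqrt (r / S).
have rS0 : 0 < r / S by rewrite divr_gt0.
have t0 : 0 < t by rewrite sqrtr_gt0.
have t2 : t ^+ 2 = r / S by rewrite sqr_sqrtr// ltW.
have pt x : t `^ r * `|signed u x| `^ r <=
    r `^ r * (expR (t * signed u x) + expR (- t * signed u x)).
  rewrite -powRM ?(ltW t0)//; apply: le_trans (powR_le_expR _ r0) _.
    by rewrite mulr_ge0 ?(ltW t0).
  rewrite ler_wpM2l ?powR_ge0//; case: (ger0P (signed u x)) => _.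
    by rewrite lerDl expR_ge0.
  by rewrite mulrN mulNr lerDr expR_ge0.
have tr : t `^ r = (r / S) `^ (r / 2).
  by rewrite -t2 -powR_mulrn ?(ltW t0)// -powRrM; congr (_ `^ _); field.
rewrite -(@ler_pM2l _ (t `^ r)) ?powR_gt0//.
apply: (@le_trans _ _ (\sum_x
    r `^ r * (expR (t * signed u x) + expR (- t * signed u x)))).
  by rewrite mulr_sumr; apply: ler_sum => x _.
rewrite -mulr_sumr big_split/=.
apply: (@le_trans _ _ (r `^ r * (2 ^+ #|J| * expR (2 * r) + 2 ^+ #|J| * expR (2 * r)))).
  rewrite ler_wpM2l ?powR_ge0// lerD//.
    apply: le_trans (rademacher_mgf _ _) _; rewrite t2 -/S -mulrA divfK ?gt_eqF//.
  apply: le_trans (rademacher_mgf _ _) _; rewrite sqrrN t2 -/S -mulrA divfK ?gt_eqF//.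
have E : (r / S) `^ (r / 2) * (expR 4 * r * S) `^ (r / 2) = expR (2 * r) * r `^ r.
  rewrite -[in LHS]powRM ?(ltW rS0) ?mulr_ge0 ?expR_ge0 ?(ltW r0) ?(ltW S0)//.
  have -> : r / S * (expR 4 * r * S) = expR 4 * r ^+ 2.
    by field; rewrite gt_eqF.
  rewrite powRM ?expR_ge0 ?sqr_ge0// -expRM -powR_mulrn ?(ltW r0)// -powRrM.
  by congr (expR _ * _ `^ _); field.
rewrite tr [leRHS](_ : _ = 2 ^+ #|J| * 2 *
  ((r / S) `^ (r / 2) * (expR 4 * r * S) `^ (r / 2))); last by ring.
rewrite E le_eqVlt; apply/orP; left; apply/eqP; ring.
Qed.

Definition hamming (x y : {ffun J -> bool}) : nat := #|[set j | x j != y j]%SET|.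

(** Bounds the size of Hamming balls: a point at distance at most d from x contributes at least
    exp(- c d) if c >= 0. *)
Lemma sum_expR_hamming x (c : R) :
  \sum_y expR (- c * (hamming x y)%:R) = (1 + expR (- c)) ^+ #|J|.
Proof.
have -> : \sum_y expR (- c * (hamming x y)%:R) =
    \sum_(y : {ffun J -> bool}) \prod_j
      (fun j (b : bool) => expR (- c * (x j != b)%:R)) j (y j).
  apply: eq_bigr => y _; rewrite -expR_sum -mulr_sumr; congr (expR (_ * _)).
  rewrite /hamming -sum1_card natr_sum [LHS]big_mkcond/=.
  by apply: eq_bigr => j _; rewrite inE; case: (x j != y j).
rewrite -(bigA_distr_bigA (fun j (b : bool) => expR (- c * (x j != b)%:R))) /=.
rewrite (eq_bigr (fun=> 1 + expR (- c))); last first.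
  move=> j _; rewrite big_bool/=.
  by case: (x j) => /=; rewrite mulr0 mulr1 expR0// addrC.
by rewrite prodr_const.
Qed.

(* Were all classes of diameter at most l/16, each would have at most
   e^(l/8) (1 + e^-2)^l elements, and G at most (3/2)^l. *)
Lemma far_pair (B : finType) (b : {ffun J -> bool} -> B)
    (G : {set {ffun J -> bool}}) :
  (0 < #|J|)%N -> 3 / 4 * 2 ^+ #|J| <= #|G|%:R :> R ->
  #|b @: G|%:R <= expR (#|J|%:R / 16) :> R ->
  exists x y, [/\ x \in G, y \in G, b x = b y & (#|J| < 16 * hamming x y)%N].
Proof.
move=> l0 G34 BG.
apply: contrapT => far.
have cls c : c \in b @: G ->
    (\sum_(y in G | b y == c) 1 : R) <=
      expR (#|J|%:R / 8) * (1 + expR (- 2)) ^+ #|J|.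
  move=> /imsetP[x xG ->]; rewrite -(sum_expR_hamming x) mulr_sumr big_mkcond/=.
  apply: ler_sum => y _; rewrite -expRD; case: ifP => [/andP[yG /eqP byx]|_]; last first.
    by rewrite expR_ge0.
  have : (16 * hamming x y <= #|J|)%N.
    by rewrite leqNgt; apply/negP => h; apply: far; exists x, y.
  rewrite -(ler_nat R) natrM => h.
  by rewrite -[leLHS]expR0 ler_expR; lra.
have : (#|G|%:R : R) <= \sum_(c in b @: G) expR (#|J|%:R / 8) * (1 + expR (- 2)) ^+ #|J|.
  rewrite -sum1_card natr_sum (partition_big b (mem (b @: G)))/=; last first.
    by move=> x xG; apply: imset_f.
  exact: ler_sum.
rewrite sumr_const -[leRHS]mulr_natl.
have e0 : 0 <= expR (#|J|%:R / 8) * (1 + expR (- 2)) ^+ #|J| :> R.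
  by rewrite mulr_ge0 ?expR_ge0 ?exprn_ge0// addr_ge0 ?expR_ge0.
move=> /le_trans/(_ (ler_wpM2r e0 BG)); rewrite mulrA -expRD.
have -> : #|J|%:R / 16 + #|J|%:R / 8 = #|J|%:R * (3 / 16) :> R by field.
rewrite expRM_natl -exprMn => /(le_trans G34).
have b1 : expR (3 / 16) <= 16 / 13 :> R.
  have := expR_ge1Dx (- (3 / 16) : R) => h.
  have -> : 16 / 13 = (13 / 16 : R)^-1 by field.
  rewrite -[leLHS]invrK -expRN lef_pV2 ?posrE ?expR_gt0//; lra.
have b2 : expR (- 2) <= 16 / 81 :> R.
  have := expR_ge1Dx (2^-1 : R) => h.
  have -> : 16 / 81 = ((3 / 2 : R) ^+ 4)^-1 by field.
  rewrite expRN lef_pV2 ?posrE ?exprn_gt0 ?expR_gt0//.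
  have -> : (2 : R) = 4%:R * 2^-1 by field.
  rewrite expRM_natl.
  by rewrite lerXn2r ?nnegrE ?expR_ge0//; lra.
have b3 : expR (3 / 16) * (1 + expR (- 2)) < 3 / 2 :> R.
  have := expR_ge0 (- 2 : R); have := expR_ge0 (3 / 16 : R); nra.
apply/negP; rewrite -ltNge.
(* Classes times class size is less than (3/2)^l = (3/4)^l 2^l, and (3/4)^l <= 3/4 because l > 0. *)
apply: (@lt_le_trans _ _ ((3 / 2) ^+ #|J|)).
  have b0 : 0 <= expR (3 / 16) * (1 + expR (- 2)) :> R.
    by rewrite mulr_ge0 ?expR_ge0// addr_ge0 ?expR_ge0.
  by rewrite (ltrXn2r _ b0 b3) -lt0n.
have -> : (3 / 2 : R) = 3 / 4 * 2 by field.
rewrite exprMn ler_wpM2r ?exprn_ge0//.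
by rewrite -[leRHS]expr1 ler_wiXn2l//; lra.
Qed.

End Rademacher.

(** * Counting encodings: Kraft's inequality and geometric weights *)

Section Kraft.
Context {R : realType}.

(** Summed over all b, the products expand into the product of the sums of weights, while every b in
    B contributes at least exp(- K). The excess eta of a sum over 1 is paid in the exponent. *)
Lemma kraft (I : finType) (M : nat) (w : I -> 'I_M -> R) (eta : I -> R) (K : R)
    (B : {set {ffun I -> 'I_M}}) :
  (forall i c, 0 <= w i c) -> (forall i, \sum_c w i c <= 1 + eta i) ->
  (forall b, b \in B -> expR (- K) <= \prod_i w i (b i)) ->
  #|B|%:R <= expR (K + \sum_i eta i).
Proof.
move=> w0 w1 BK.
have h : #|B|%:R * expR (- K) <= \prod_i (1 + eta i).
  apply: (@le_trans _ _ (\sum_(b in B) \prod_i w i (b i))).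
    by rewrite mulr_natl -sumr_const; apply: ler_sum.
  apply: (@le_trans _ _ (\sum_(b : {ffun I -> 'I_M}) \prod_i w i (b i))).
    rewrite big_mkcond/=; apply: ler_sum => b _; case: ifP => // _.
    by apply: prodr_ge0.
  rewrite -(bigA_distr_bigA w).
  by apply: ler_prod => i _; rewrite w1 andbT; apply: sumr_ge0.
rewrite expRD -ler_pdivrMl ?expR_gt0// -expRN mulrC; apply: (le_trans h).
rewrite expR_sum; apply: ler_prod => i _; rewrite expR_ge1Dx andbT.
by apply: le_trans (w1 i); apply: sumr_ge0.
Qed.

(** With truncated subtraction, [c - N + (N - c)] is |c - N|; the range is symmetric about N, which
    gives a central term and two geometric tails. *)
Lemma sum_geometric_dist (t : R) (N : nat) : 0 < t ->
  \sum_(c < N.*2.+1) expR (- t * (c - N + (N - c))%:R) <= 1 + 2 / (expR t - 1).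
Proof.
move=> t0; have et : 1 < expR t by rewrite expR_gt1.
have tail : \sum_(0 <= k < N) expR (- t * k.+1%:R) <= (expR t - 1)^-1.
  rewrite -div1r ler_pdivlMr ?subr_gt0//.
  suff -> : (\sum_(0 <= k < N) expR (- t * k.+1%:R)) * (expR t - 1) =
      1 - expR (- t * N%:R) by rewrite gerBl expR_ge0.
  elim: N => [|n IH]; first by rewrite big_nil mul0r mulr0 expR0 subrr.
  rewrite big_nat_recr//= mulrDl IH mulrBr mulr1 -expRD.
  have -> : - t * n.+1%:R + t = - t * n%:R by rewrite -natr1; ring.
  by rewrite addrA subrK.
rewrite -(big_mkord xpredT (fun c => expR (- t * (c - N + (N - c))%:R))).
have NN : (N <= N.*2.+1)%N by rewrite -addnn leqW ?leq_addr.
rewrite (big_cat_nat (leq0n N) NN)/=.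
have -> : \sum_(N <= k < N.*2.+1) expR (- t * (k - N + (N - k))%:R) =
    \sum_(0 <= k < N.+1) expR (- t * (k + N - N + (N - (k + N)))%:R).
  rewrite -{1}(add0n N) big_addn.
  by have -> : (N.*2.+1 - N = N.+1)%N by rewrite -addnn; lia.
rewrite big_nat_rev/= add0n.
rewrite [X in _ + X]big_nat_recl//=.
have -> : expR (- t * (0 + N - N + (N - (0 + N)))%:R) = 1.
  by rewrite add0n subnn mulr0 expR0.
rewrite [X in X + _](_ : _ = \sum_(0 <= k < N) expR (- t * k.+1%:R)); last first.
  by apply: eq_big_nat => k /andP[_ kN]; congr (expR (_ * _%:R)); lia.
rewrite [X in _ + (1 + X)](_ : _ = \sum_(0 <= k < N) expR (- t * k.+1%:R)); last first.
  by apply: eq_big_nat => k /andP[_ kN]; congr (expR (_ * _%:R)); lia.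
move: tail; set s := \sum_(_ <= _ < _) _; lra.
Qed.

(** In the application 1/t is proportional to a squared row norm, so the tail becomes a power whose
    sum over the rows is under control. For t >= 1 the power comes from the decay of exp(- t/2); for
    t < 1 the base 2g/t exceeds 1 anyway. *)
Lemma geometric_tail_le (t g : R) : 0 < t -> 1 <= g ->
  2 / (expR t - 1) <= 4 * (2 * g / t) `^ g.
Proof.
move=> t0 g1.
have e0 : 0 < expR (t / 2) by rewrite expR_gt0.
have e1 : expR t = expR (t / 2) * expR (t / 2).
  by rewrite -expRD; congr expR; field.
have h1 := expR_ge1Dx (t / 2).
have h2 : t / 2 * expR (t / 2) <= expR t - 1 by rewrite e1; nra.
apply: (@le_trans _ _ (2 / (t / 2 * expR (t / 2)))).
  by rewrite ler_pM2l// lef_pV2 ?posrE//; nra.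
have -> : 2 / (t / 2 * expR (t / 2)) = 4 * (t^-1 * (expR (t / 2))^-1).
  by field; rewrite !gt_eqF.
rewrite ler_pM2l//.
have ee : (expR (t / 2))^-1 <= 1 by rewrite invf_le1//; lra.
have ei0 : 0 <= (expR (t / 2))^-1 by rewrite invr_ge0 ltW.
have [t1|t1] := leP 1 t.
  have := @powR_le_expR R (t / 2) g ltac:(lra) ltac:(lra) => h3.
  have h4 : (expR (t / 2))^-1 <= (2 * g / t) `^ g.
    have -> : 2 * g / t = g / (t / 2) by field; lra.
    rewrite powRM ?invr_ge0//; [|lra|lra].
    have -> : (t / 2)^-1 `^ g = ((t / 2) `^ g)^-1.
      by rewrite -powR_inv1 -?powRrM ?mulN1r ?powRN//; lra.
    rewrite -div1r ler_pdivrMr// mulrAC.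
    rewrite ler_pdivlMr ?mul1r// powR_gt0; lra.
  apply: le_trans h4; rewrite ger_pMl ?invr_gt0// invf_le1; lra.
apply: (@le_trans _ _ t^-1); first by rewrite ger_pMr// invr_gt0.
apply: (@le_trans _ _ (2 * g / t)).
  by rewrite ler_peMl ?invr_ge0; lra.
rewrite le1r_powR// ler_pdivlMr//; lra.
Qed.

End Kraft.

(** * Rounding and the cost of a sign vector *)

Section PartialColoring.
Context {R : realType}.

(* The nearest integer to u/2, shifted by N so as to be a natural number. *)
Definition shifted_round (N : nat) (u : R) : nat := Num.truncn (u / 2 + 2^-1 + N%:R).

Section Round.
Variables (N : nat).

Lemma shifted_roundP u : `|u| <= N%:R ->
  (shifted_round N u)%:R <= u / 2 + 2^-1 + N%:R < (shifted_round N u)%:R + 1.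
Proof.
move=> uN; have := ler0n R N; move: uN; rewrite ler_norml => /andP[u1 u2] N0.
rewrite natr1; apply: truncn_itv; lra.
Qed.

Lemma shifted_round_lt u : `|u| <= N%:R -> (shifted_round N u < N.*2.+1)%N.
Proof.
move=> uN; have := ler0n R N => N0.
rewrite -(ltr_nat R) -natr1 -muln2 natrM.
have /andP[h _] := shifted_roundP uN; apply: (le_lt_trans h).
by move: uN; rewrite ler_norml => /andP[u1 u2]; lra.
Qed.

(** A rounding other than N requires |u| >= 1, where |u| is dominated by any power s >= 1; the
    encoding can thus be charged to a high moment. *)
Lemma shifted_round_dist u (s : R) : `|u| <= N%:R -> 1 <= s ->
  (shifted_round N u - N + (N - shifted_round N u))%:R <= `|u| `^ s.
Proof.
move=> uN s1; have /andP := shifted_roundP uN.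
have [||->] := ltngtP (shifted_round N u) N; last by rewrite subnn powR_ge0.
- set c := shifted_round N u => cN [h1 h2].
  have -> : (c - N = 0)%N by apply/eqP; rewrite subn_eq0 ltnW.
  rewrite add0n natrB; last exact: ltnW.
  have c1 : c%:R + 1 <= N%:R :> R by rewrite natr1 ler_nat.
  apply: (@le_trans _ _ `|u|); last by rewrite le1r_powR//; have := ler_norm (- u); rewrite normrN; lra.
  by have := ler_norm (- u); rewrite normrN; lra.
- set c := shifted_round N u => cN [h1 h2].
  have -> : (N - c = 0)%N by apply/eqP; rewrite subn_eq0 ltnW.
  rewrite addn0 natrB; last exact: ltnW.
  have c1 : N%:R + 1 <= c%:R :> R by rewrite natr1 ler_nat.
  have := ler_norm u => hu.
  by apply: (@le_trans _ _ `|u|); [lra|rewrite le1r_powR//; lra].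
Qed.

Lemma shifted_round_close u u' : `|u| <= N%:R -> `|u'| <= N%:R ->
  shifted_round N u = shifted_round N u' -> `|u - u'| <= 2.
Proof.
move=> /shifted_roundP h /shifted_roundP h' e; rewrite e in h.
by move: h h' => /andP[? ?] /andP[? ?]; rewrite ler_norml; apply/andP; split; lra.
Qed.

Lemma shifted_round0 : shifted_round N 0 = N.
Proof.
apply: truncn_def; rewrite -[N.+1%:R]natr1; apply/andP; split; lra.
Qed.

End Round.

Definition row_sq m (J : finType) (a : 'I_m -> J -> R) i := \sum_j a i j ^+ 2.

Lemma row_sq_ge0 m (J : finType) (a : 'I_m -> J -> R) i : 0 <= row_sq a i.
Proof. by apply: sumr_ge0 => j _; rewrite sqr_ge0. Qed.

(** The square of Delta, for rows of typical squared norm h. In [sum_cost], exp(9) cancels the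
    factors exp(4) and exp(5) of the moment bounds, and 64^2 brings the mean cost below |J|/128. *)
Definition width_sq (r h : R) := 64 * 64 * expR 9 * r * h.

Definition scaled_row m (J : finType) (a : 'I_m -> J -> R) (r h : R) i x :=
  signed (a i) x / Num.sqrt (width_sq r h).

(* The second term bounds the cost of encoding the rounding of the row. *)
Definition cost m (J : finType) (a : 'I_m -> J -> R) (r h : R) x :=
  \sum_(i < m) (`|scaled_row a r h i x| `^ r +
    width_sq r h / row_sq a i * `|scaled_row a r h i x| `^ (r + 2)).

Lemma width_sq_gt0 (r h : R) : 2 <= r -> 0 < h -> 0 < width_sq r h.
Proof.
move=> r2 h0; have r0 : 0 < r by lra.
by rewrite /width_sq !mulr_gt0 ?expR_gt0.
Qed.

(** As A is at most the constant of [width_sq], the power r/2 >= 1 only decreases their ratio, which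
    may therefore be taken linearly. *)
Lemma sum_scaled m (J : finType) (a : 'I_m -> J -> R) (r h A : R) :
  2 <= r -> 0 < h ->
  \sum_(i < m) row_sq a i `^ (r / 2) <= #|J|%:R * h `^ (r / 2) ->
  0 < A <= 64 * 64 * expR 9 ->
  \sum_(i < m) (A * r * row_sq a i / width_sq r h) `^ (r / 2) <= #|J|%:R * (A / (64 * 64 * expR 9)).
Proof.
move=> r2 h0 sumS /andP[A0 A1].
set c : R := 64 * 64 * expR 9 in A1 *.
have c0 : 0 < c by rewrite /c mulr_gt0// expR_gt0.
have t0 : 0 < A / c by rewrite divr_gt0.
have -> : \sum_(i < m) (A * r * row_sq a i / width_sq r h) `^ (r / 2) =
    (A / c) `^ (r / 2) * h^-1 `^ (r / 2) * \sum_(i < m) row_sq a i `^ (r / 2).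
  rewrite mulr_sumr; apply: eq_bigr => i _.
  rewrite -!powRM ?mulr_ge0 ?invr_ge0 ?row_sq_ge0 ?(ltW t0) ?(ltW h0) ?(ltW A0) ?(ltW c0)//.
  congr (_ `^ _); rewrite /width_sq -/c; field.
  by rewrite !gt_eqF//; lra.
apply: (@le_trans _ _ ((A / c) `^ (r / 2) * h^-1 `^ (r / 2) * (#|J|%:R * h `^ (r / 2)))).
  by rewrite ler_wpM2l// mulr_ge0 ?powR_ge0.
have -> : (A / c) `^ (r / 2) * h^-1 `^ (r / 2) * (#|J|%:R * h `^ (r / 2)) =
    #|J|%:R * ((A / c) `^ (r / 2) * (h^-1 `^ (r / 2) * h `^ (r / 2))) by ring.
rewrite -(powRM _ (ltW _) (ltW h0)) ?invr_gt0// mulVf ?gt_eqF// powR1 mulr1.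
rewrite ler_wpM2l// ge1r_powR//; last lra.
by rewrite t0/= ler_pdivrMr ?mul1r.
Qed.

Lemma moment_scaled_row m (J : finType) (a : 'I_m -> J -> R) (r h : R) i (s : R) :
  2 <= r -> 0 < h -> 0 < s ->
  \sum_x `|scaled_row a r h i x| `^ s <= 2 ^+ #|J| * (2 * (expR 4 * s * (row_sq a i / width_sq r h)) `^ (s / 2)).
Proof.
move=> r2 h0 s0; have := rademacher_moment (fun j => a i j / Num.sqrt (width_sq r h)) s0.
have -> : \sum_j (a i j / Num.sqrt (width_sq r h)) ^+ 2 = row_sq a i / width_sq r h.
  rewrite mulr_suml; apply: eq_bigr => j _.
  by rewrite exprMn exprVn sqr_sqrtr// ltW// width_sq_gt0.
apply: le_trans; apply: ler_sum => x _.
rewrite [X in `|X|](_ : _ = signed (fun j => a i j / Num.sqrt (width_sq r h)) x)//.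
by rewrite /scaled_row /signed mulr_suml; apply: eq_bigr => j _; rewrite mulrA.
Qed.

(** The bound for the moment of order r + 2 has one factor [row_sq a i / width_sq r h] more than
    that of order r, and this cancels the weight in the second term of [cost]. *)
Lemma sum_cost m (J : finType) (a : 'I_m -> J -> R) (r h : R) :
  2 <= r -> 0 < h ->
  \sum_(i < m) row_sq a i `^ (r / 2) <= #|J|%:R * h `^ (r / 2) ->
  \sum_x cost a r h x <= 2 ^+ #|J| * (#|J|%:R / 128).
Proof.
move=> r2 h0 sumS.
have e1 (x : R) : 0 <= x -> 1 <= expR x.
  by move=> x0; have := expR_ge1Dx x; lra.
rewrite exchange_big/=.
apply: (@le_trans _ _ (\sum_(i < m) 2 ^+ #|J| *
    (10 * expR 4 * (2 * expR 5 * r * row_sq a i / width_sq r h) `^ (r / 2)))).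
  apply: ler_sum => i _; rewrite big_split/= -mulr_sumr.
  have SD : 0 <= row_sq a i / width_sq r h by rewrite divr_ge0 ?row_sq_ge0// ltW// width_sq_gt0.
  set P := (2 * expR 5 * r * row_sq a i / width_sq r h) `^ (r / 2).
  have P0 : 0 <= P by apply: powR_ge0.
  have h1 : \sum_x `|scaled_row a r h i x| `^ r <= 2 ^+ #|J| * (2 * P).
    apply: le_trans (moment_scaled_row a _ r2 h0 _) _; first lra.
    rewrite ler_pM2l ?exprn_gt0// ler_pM2l//.
    rewrite ge0_ler_powR ?nnegrE ?mulr_ge0 ?expR_ge0 ?invr_ge0 ?row_sq_ge0 ?(ltW (width_sq_gt0 r2 h0))//; try lra.
    rewrite -[leRHS]mulrA ler_wpM2r// ler_wpM2r//; first lra.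
    have : expR 4 <= expR 5 :> R by rewrite ler_expR; lra.
    by have := expR_ge0 (5 : R); lra.
  have h2 : width_sq r h / row_sq a i * \sum_x `|scaled_row a r h i x| `^ (r + 2) <= 2 ^+ #|J| * (8 * expR 4 * P).
    (* Division by zero gives 0, so the second term vanishes for a zero row. *)
    have [->|Si] := eqVneq (row_sq a i) 0.
      by rewrite invr0 mulr0 mul0r !mulr_ge0 ?expR_ge0 ?exprn_ge0.
    have {}Si : 0 < row_sq a i by rewrite lt0r Si row_sq_ge0.
    have t0 : 0 < width_sq r h / row_sq a i by rewrite divr_gt0// width_sq_gt0.
    apply: le_trans (ler_wpM2l (ltW t0) (moment_scaled_row a _ r2 h0 _)) _; first lra.
    have -> : (r + 2) / 2 = r / 2 + 1 by field.
    have q0 : 0 < expR 4 * (r + 2) * (row_sq a i / width_sq r h).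
      by rewrite !mulr_gt0 ?expR_gt0 ?invr_gt0 ?width_sq_gt0//; lra.
    rewrite powRD ?(gt_eqF q0) ?implybT// powRr1 ?(ltW q0)//.
    rewrite mulrCA ler_pM2l ?exprn_gt0//.
    have -> : width_sq r h / row_sq a i * (2 * ((expR 4 * (r + 2) * (row_sq a i / width_sq r h)) `^ (r / 2) *
        (expR 4 * (r + 2) * (row_sq a i / width_sq r h)))) =
        2 * expR 4 * ((r + 2) * (expR 4 * (r + 2) * (row_sq a i / width_sq r h)) `^ (r / 2)).
      by field; rewrite !gt_eqF// width_sq_gt0.
    have -> : 8 * expR 4 * P = 2 * expR 4 * (4 * P) by ring.
    rewrite ler_pM2l ?mulr_gt0 ?expR_gt0//.
    (* The stray factor r + 2 is absorbed into the power r/2, where exp(4) becomes exp(5). *)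
    have r4 : r + 2 <= 4 * expR (r / 2) by have := expR_ge1Dx (r / 2); lra.
    apply: (@le_trans _ _ (4 * expR (r / 2) * (expR 4 * (r + 2) * (row_sq a i / width_sq r h)) `^ (r / 2))).
      by rewrite ler_wpM2r ?powR_ge0.
    rewrite -mulrA ler_pM2l// (_ : expR (r / 2) = expR 1 `^ (r / 2)); last by rewrite -expRM mul1r.
    rewrite -powRM ?expR_ge0 ?(ltW q0)//.
    rewrite ge0_ler_powR ?nnegrE ?mulr_ge0 ?expR_ge0 ?invr_ge0 ?row_sq_ge0 ?(ltW (width_sq_gt0 r2 h0))//; try lra.
    have -> : expR 5 = expR 1 * expR 4 :> R by rewrite -expRD; congr expR; lra.
    rewrite !mulrA -!(mulrA _ (row_sq a i)) ler_wpM2r//.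
    have : 0 <= expR 1 * expR 4 :> R by rewrite mulr_ge0 ?expR_ge0.
    rewrite -(mulrA 2); move: (expR 1 * expR 4) => z z0; nra.
  have e4 : 0 <= (2 * expR 4 - 2) * P.
    by rewrite mulr_ge0//; have := e1 4; lra.
  apply: (le_trans (lerD h1 h2)); rewrite -mulrDr ler_pM2l ?exprn_gt0//; lra.
rewrite -mulr_sumr ler_pM2l ?exprn_gt0// -mulr_sumr.
have e9 : expR 9 = expR 4 * expR 5 :> R by rewrite -expRD; congr expR; lra.
have e4 := e1 4; have e5 := expR_gt0 (5 : R).
apply: (@le_trans _ _ (10 * expR 4 * (#|J|%:R * (2 * expR 5 / (64 * 64 * expR 9))))).
  rewrite ler_pM2l ?mulr_gt0 ?expR_gt0//; apply: sum_scaled => //.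
  by rewrite mulr_gt0//= e9; nra.
have -> : 10 * expR 4 * (#|J|%:R * (2 * expR 5 / (64 * 64 * expR 9))) =
    #|J|%:R * (20 / (64 * 64)) :> R.
  by rewrite e9; field; rewrite !gt_eqF ?expR_gt0.
by rewrite ler_wpM2l//; lra.
Qed.

End PartialColoring.

Section PartialColoringTheorem.
Context {R : realType}.

Lemma cost_ge0 m (J : finType) (a : 'I_m -> J -> R) (r h : R) x :
  2 <= r -> 0 < h -> 0 <= cost a r h x.
Proof.
move=> r2 h0; apply: sumr_ge0 => i _; rewrite addr_ge0 ?powR_ge0//.
by rewrite mulr_ge0 ?powR_ge0// divr_ge0 ?row_sq_ge0// ltW// width_sq_gt0.
Qed.

(* Kraft's inequality bounds the number of rounded images of the cheap sign vectors. *)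
Lemma few_classes m (J : finType) (a : 'I_m -> J -> R) (r h : R) (N : nat) :
  2 <= r -> 0 < h ->
  \sum_(i < m) row_sq a i `^ (r / 2) <= #|J|%:R * h `^ (r / 2) ->
  (forall i x, `|scaled_row a r h i x| <= N%:R) ->
  #|(fun x => [ffun i => inord (shifted_round N (scaled_row a r h i x))]
       : {ffun 'I_m -> 'I_N.*2.+1}) @:
     [set x | cost a r h x <= #|J|%:R / 32]%SET|%:R <= expR (#|J|%:R / 16) :> R.
Proof.
move=> r2 h0 sumS uN.
have W0 := width_sq_gt0 r2 h0.
pose t i := width_sq r h / row_sq a i.
(* For a zero row [t i] is 0 by convention and all geometric weights would be 1; its image is always
   0, so the whole weight goes to the rounding N of 0. *)
pose w (i : 'I_m) (c : 'I_N.*2.+1) : R :=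
  if row_sq a i == 0 then (c == N :> nat)%:R
  else expR (- t i * (c - N + (N - c))%:R).
(* The tail 4 (2g/t)^g of [geometric_tail_le] for g = r/2; the explicit factor 1 is the A of
   [sum_scaled]. *)
pose eta i : R := 4 * (1 * r * row_sq a i / width_sq r h) `^ (r / 2).
have l0 : 0 <= #|J|%:R :> R by [].
have r0 : 0 < r by lra.
have eta_sum : \sum_i eta i <= #|J|%:R / 32.
  rewrite -mulr_sumr.
  have e1 : 1 <= expR 9 :> R by have := expR_ge1Dx (9 : R); lra.
  apply: (@le_trans _ _ (4 * (#|J|%:R * (1 / (64 * 64 * expR 9))))).
    by rewrite ler_pM2l//; apply: sum_scaled => //; lra.
  have : (64 * 64 * expR 9)^-1 <= (64 * 64)^-1 :> R.
    by rewrite lef_pV2 ?posrE; lra.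
  set y := (64 * 64 * expR 9)^-1; move: #|J|%:R l0 => l l0 hy.
  have := ler_wpM2l l0 hy; rewrite mul1r; lra.
apply: le_trans (_ : expR (#|J|%:R / 32 + \sum_i eta i) <= _); last first.
  by rewrite ler_expR; lra.
apply: (@kraft _ _ _ w).
- by move=> i c; rewrite /w; case: ifP => // _; rewrite ?ler0n ?expR_ge0.
- move=> i; rewrite /w /eta; have [s0|s0] := eqVneq (row_sq a i) 0.
    rewrite s0 mulr0 mul0r powR0 ?mulr0 ?addr0; last by apply/eqP; lra.
    have NM : (N < N.*2.+1)%N by rewrite -addnn ltnS leq_addr.
    rewrite (bigD1 (Ordinal NM))//= eqxx big1 ?addr0// => c.
    by rewrite -val_eqE/= => /negbTE ->.
  have {}s0 : 0 < row_sq a i by rewrite lt0r s0 row_sq_ge0.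
  have t0 : 0 < t i by rewrite divr_gt0.
  apply: le_trans (sum_geometric_dist N t0) _; rewrite lerD2l.
  apply: le_trans (@geometric_tail_le _ _ (r / 2) t0 _) _; first lra.
  rewrite le_eqVlt; apply/orP; left; apply/eqP; congr (_ * _ `^ _).
  by rewrite /t; field; rewrite !gt_eqF.
- move=> b /imsetP[x]; rewrite inE => costx ->.
  apply: (@le_trans _ _ (expR (- cost a r h x))); first by rewrite ler_expR lerN2.
  rewrite /cost -sumrN expR_sum; apply: ler_prod => i _.
  rewrite expR_ge0/= ffunE /w inordK ?shifted_round_lt//.
  have u0 : 0 <= `|scaled_row a r h i x| `^ r by apply: powR_ge0.
  case: ifPn => [/eqP s0|s0].
    have -> : scaled_row a r h i x = 0.
      rewrite /scaled_row /signed big1 ?mul0r// => j _.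
      have /eqP := s0; rewrite psumr_eq0 => [|k _]; last by rewrite sqr_ge0.
      by move=> /allP/(_ j (mem_index_enum _)); rewrite sqrf_eq0 => /eqP ->; rewrite mulr0.
    rewrite shifted_round0 eqxx -[leRHS]expR0 ler_expR normr0 !powR0 ?mulr0 ?addr0 ?oppr0//.
      by apply/eqP; lra.
    by apply/eqP; lra.
  have {}s0 : 0 < row_sq a i by rewrite lt0r s0 row_sq_ge0.
  have t0 : 0 < t i by rewrite divr_gt0.
  rewrite ler_expR mulNr lerN2 -/(t i).
  have := @shifted_round_dist _ N _ (r + 2) (uN i x) ltac:(lra) => hd.
  have := ler_wpM2l (ltW t0) hd; lra.
Qed.

(** Markov's inequality: the mean cost is at most |J|/128, a quarter of the threshold. *)
Lemma many_cheap m (J : finType) (a : 'I_m -> J -> R) (r h : R) :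
  2 <= r -> 0 < h -> (0 < #|J|)%N ->
  \sum_(i < m) row_sq a i `^ (r / 2) <= #|J|%:R * h `^ (r / 2) ->
  3 / 4 * 2 ^+ #|J| <= #|[set x | cost a r h x <= #|J|%:R / 32]%SET|%:R :> R.
Proof.
move=> r2 h0 J0 sumS; set G := [set x | _]%SET.
have l0 : 0 < #|J|%:R :> R by rewrite ltr0n.
have h1 : #|~: G|%:R * (#|J|%:R / 32) <= 2 ^+ #|J| * (#|J|%:R / 128) :> R.
  apply: (le_trans _ (sum_cost r2 h0 sumS)).
  apply: (@le_trans _ _ (\sum_(x in ~: G) cost a r h x)).
    rewrite mulr_natl -sumr_const; apply: ler_sum => x.
    by rewrite !inE -ltNge => /ltW.
  rewrite [leLHS]big_mkcond/=; apply: ler_sum => x _; case: ifP => // _.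
  exact: cost_ge0.
have h2 : (#|G| + #|~: G| = 2 ^ #|J|)%N by rewrite cardsC card_signs.
have {}h2 : #|G|%:R + #|~: G|%:R = 2 ^+ #|J| :> R by rewrite -natrD h2 natrX.
have h3 : 0 <= #|~: G|%:R :> R by [].
move: (#|~: G|%:R : R) (#|G|%:R : R) (2 ^+ #|J| : R) h1 h2 h3 => y z e h1 h2 h3.
have : (4 * y - e) * (#|J|%:R / 128) <= 0 by lra.
by rewrite pmulr_lle0 ?divr_gt0//; lra.
Qed.

Lemma partial_coloring m (J : finType) (a : 'I_m -> J -> R) (r h : R) :
  2 <= r -> 0 < h -> (0 < #|J|)%N ->
  \sum_(i < m) row_sq a i `^ (r / 2) <= #|J|%:R * h `^ (r / 2) ->
  exists chi : J -> R,
    [/\ forall j, [\/ chi j = 0, chi j = 1 | chi j = -1],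
     (#|J| < 16 * #|[set j | chi j != 0%R]%SET|)%N,
     forall i, `|\sum_j chi j * a i j| <= Num.sqrt (width_sq r h) &
     \sum_(i < m) `|\sum_j chi j * a i j| `^ r <=
       Num.sqrt (width_sq r h) `^ r * #|J|%:R].
Proof.
move=> r2 h0 J0 sumS.
have W0 := width_sq_gt0 r2 h0.
set D := Num.sqrt _.
have D0 : 0 < D by rewrite sqrtr_gt0.
(* A crude common bound, which makes the range of the roundings finite. *)
pose Bd := \sum_x \sum_(i < m) `|scaled_row a r h i x|.
pose N := (Num.truncn Bd).+1.
have uN i x : `|scaled_row a r h i x| <= N%:R.
  apply: (@le_trans _ _ Bd); last by rewrite ltW// truncnS_gt.
  rewrite /Bd (bigD1 x)//= (bigD1 i)//= -addrA lerDl.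
  by rewrite addr_ge0 ?sumr_ge0// => y _; rewrite sumr_ge0.
have [x [y [xG yG bxy far]]] := far_pair J0 (many_cheap r2 h0 J0 sumS)
  (few_classes r2 h0 sumS uN).
have close i : `|scaled_row a r h i x - scaled_row a r h i y| <= 2.
  apply: (shifted_round_close (uN i x) (uN i y)).
  have /(congr1 (fun f : {ffun 'I_m -> 'I_N.*2.+1} => val (f i))) := bxy.
  by rewrite !ffunE /= !inordK ?shifted_round_lt.
pose chi j : R := ((-1) ^+ x j - (-1) ^+ y j) / 2.
have Y i : \sum_j chi j * a i j =
    D * ((scaled_row a r h i x - scaled_row a r h i y) / 2).
  have -> : D * ((scaled_row a r h i x - scaled_row a r h i y) / 2) =
      (signed (a i) x - signed (a i) y) / 2.
    by rewrite /scaled_row -/D; field; rewrite gt_eqF.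
  rewrite /signed -sumrB mulr_suml.
  by apply: eq_bigr => j _; rewrite /chi -mulrBl mulrAC.
exists chi; split.
- move=> j; rewrite /chi; case: (x j); case: (y j); rewrite ?expr0 ?expr1.
  + by apply: Or31; lra.
  + by apply: Or33; lra.
  + by apply: Or32; lra.
  + by apply: Or31; lra.
- apply: (leq_trans far); rewrite leq_pmul2l//; apply: subset_leq_card; apply/fintype.subsetP => j.
  rewrite !inE /chi; apply: contra => /eqP.
  by case: (x j); case: (y j) => //; rewrite ?expr0 ?expr1; lra.
- move=> i; rewrite Y normrM gtr0_norm// ger_pMr//.
  rewrite normrM [`|2^-1|]gtr0_norm//; have := close i; lra.
have cheap z : z \in [set x | cost a r h x <= #|J|%:R / 32]%SET ->
    \sum_(i < m) `|scaled_row a r h i z| `^ r <= #|J|%:R / 32.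
  rewrite inE; apply: le_trans; apply: ler_sum => i _; rewrite lerDl.
  by rewrite mulr_ge0 ?powR_ge0// divr_ge0 ?row_sq_ge0// ltW.
apply: (@le_trans _ _ (\sum_(i < m) D `^ r *
    (`|scaled_row a r h i x| `^ r + `|scaled_row a r h i y| `^ r))).
  apply: ler_sum => i _; rewrite Y normrM (gtr0_norm D0) powRM ?(ltW D0)//.
  rewrite ler_wpM2l ?powR_ge0//.
  move: (scaled_row a r h i x) (scaled_row a r h i y) => u v.
  (* Half the difference is at most the larger of |u| and |v| in absolute value. *)
  have [uv|uv] := leP `|u| `|v|.
    apply: (@le_trans _ _ (`|v| `^ r)); last by rewrite lerDr powR_ge0.
    rewrite ge0_ler_powR ?nnegrE//; first lra.
    rewrite normrM [`|2^-1|]gtr0_norm//; have := ler_normB u v; lra.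
  apply: (@le_trans _ _ (`|u| `^ r)); last by rewrite lerDl powR_ge0.
  rewrite ge0_ler_powR ?nnegrE//; first lra.
  rewrite normrM [`|2^-1|]gtr0_norm//; have := ler_normB u v; lra.
rewrite -mulr_sumr ler_wpM2l ?powR_ge0// big_split/=.
have := lerD (cheap x xG) (cheap y yG) => /le_trans; apply.
have : 0 <= #|J|%:R :> R by []; lra.
Qed.

End PartialColoringTheorem.

(** * From partial to full colorings: the bound on [vb] *)

Section Existence.
Context {R : realType}.
Implicit Types (p q : \bar R) (m n : nat).

Definition rate_exponent p q : R := 2^-1 - fine p^-1%E + fine q^-1%E.

Lemma rate_exponent_bounds p q : (2%:E <= p)%E -> (p <= q)%E ->
  2^-1 - fine p^-1%E <= rate_exponent p q /\ 0 <= rate_exponent p q <= 1.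
Proof.
move=> p2 pq; have /andP[p0 p1] := fine_inv_bounds p2.
have /andP[q0 q1] := fine_inv_bounds (le_trans p2 pq).
have := fine_inv_le p2 pq; rewrite /rate_exponent => qp.
by split; [|apply/andP; split]; lra.
Qed.

(** Only one of the two factors n^(e/2) of n^e; the other one appears as l^(e/2) in the terms of the
    geometric series. *)
Definition top_scale p q m n : R :=
  Num.sqrt (moment p m n) * n%:R `^ (rate_exponent p q / 2).

Lemma top_scale_ge0 p q m n : 0 <= top_scale p q m n.
Proof. by rewrite mulr_ge0 ?sqrtr_ge0 ?powR_ge0. Qed.

(** One factor l^(e/2) of l^e pays for the growth of the moment ([moment_mono]), the other one
    remains. *)
Lemma stage_le p q m n l : (2%:E <= p)%E -> (p <= q)%E -> (0 < l <= n)%N -> (n <= m)%N ->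
  Num.sqrt (moment p m l) * l%:R `^ rate_exponent p q <=
    2 * top_scale p q m n * l%:R `^ (rate_exponent p q / 2).
Proof.
move=> p2 pq ln nm; have [e1 /andP[e0 _]] := rate_exponent_bounds p2 pq.
have /andP[l0 ln'] := ln.
have := moment_mono p2 ln nm e1 e0.
move: e1 e0; rewrite /top_scale; move: (rate_exponent p q) => e _ e0 h.
have l0' : 0 < l%:R :> R by rewrite ltr0n.
have n0' : 0 < n%:R :> R by rewrite ltr0n (leq_trans l0).
apply: le_trans (ler_wpM2r (powR_ge0 _ _) h) _.
rewrite le_eqVlt; apply/orP; left; apply/eqP.
have -> : l%:R `^ e = l%:R `^ (e / 2) * l%:R `^ (e / 2) :> R.
  by rewrite -powRD ?(gt_eqF l0') ?implybT//; congr (_ `^ _); field.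
have -> : n%:R `^ (e / 2) = (n%:R / l%:R) `^ (e / 2) * l%:R `^ (e / 2) :> R.
  by rewrite -powRM ?divr_ge0// divfK ?gt_eqF.
ring.
Qed.

(* The exponent is multiplied out so as to cover p = 2, q = +oo, where it is 0 and
   the rate is +oo. *)
Lemma vb_rate_bound p q m n (C N : R) : (2%:E <= p)%E -> (p <= q)%E ->
  (0 < n <= m)%N -> 0 < C ->
  rate_exponent p q * N <=
    C * Num.sqrt (fine (Order.min p (log_ratio m n)%:E)) * n%:R `^ rate_exponent p q ->
  (N%:E <= C%:E * vb_rate m n p q)%E.
Proof.
move=> p2 pq nm C0; have [_ /andP[e0 _]] := rate_exponent_bounds p2 pq.
have [min0 _] := moment_le_rate p2 nm.
rewrite /vb_rate vb_exponentE// -/(rate_exponent p q) /=.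
rewrite -/(log_ratio m n).
move: min0 e0; set e := rate_exponent p q; set mu := fine _ => mu0 e0 h.
have s0 : 0 < Num.sqrt mu by rewrite sqrtr_gt0.
move: e0; rewrite le_eqVlt => /predU1P[e0|e0].
  rewrite -e0 inver eqxx powRr0 mule1 gt0_muley ?lte_fin// gt0_muley ?lte_fin//.
  by rewrite leey.
rewrite inver gt_eqF// -!EFinM lee_fin.
rewrite -(@ler_pM2l _ e)//; apply: (le_trans h).
rewrite le_eqVlt; apply/orP; left; apply/eqP.
by field; rewrite gt_eqF.
Qed.

Lemma top_scale_le_rate p q m n : (2%:E <= p)%E -> (0 < n <= m)%N ->
  top_scale p q m n * n%:R `^ (rate_exponent p q / 2) <=
    2 * Num.sqrt (fine (Order.min p (log_ratio m n)%:E)) * n%:R `^ rate_exponent p q.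
Proof.
move=> p2 nm; have [min0 hr] := moment_le_rate p2 nm.
have /andP[n0 _] := nm.
have n0' : 0 < n%:R :> R by rewrite ltr0n.
rewrite /top_scale -[leLHS]mulrA -powRD ?(gt_eqF n0') ?implybT//.
have -> : rate_exponent p q / 2 + rate_exponent p q / 2 = rate_exponent p q by field.
rewrite ler_wpM2r ?powR_ge0//.
have -> : 2 * Num.sqrt (fine (Order.min p (log_ratio m n)%:E)) =
    Num.sqrt (4 * fine (Order.min p (log_ratio m n)%:E)).
  rewrite sqrtrM//; congr (_ * _).
  by rewrite (_ : 4 = 2 ^+ 2) ?sqrtr_sqr ?ger0_norm//; ring.
exact: ler_wsqrtr.
Qed.

(** 64 and exp(9) come from [width_sq], exp(2) from [sum_row_norms]; the remaining 2 is 1 + W with W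
    = 1 in [lp_norm_interpolation]. *)
Definition coloring_const : R := 128 * Num.sqrt (expR 11).

Lemma partial_coloring_norm p q m (J : finType) (v : J -> 'cV[R]_m) :
  (2%:E <= p)%E -> (p <= q)%E -> (0 < #|J| <= m)%N -> (forall j, lp_ball p (v j)) ->
  exists chi : J -> R,
    [/\ forall j, [\/ chi j = 0, chi j = 1 | chi j = -1],
     (#|J| < 16 * #|[set j | chi j != 0%R]%SET|)%N &
     lp_norm q (\sum_j chi j *: v j) <=
       coloring_const * (Num.sqrt (moment p m #|J|) * #|J|%:R `^ rate_exponent p q)].
Proof.
move=> p2 pq lm vP; have /andP[l0 _] := lm.
have l0' : 0 < #|J|%:R :> R by rewrite ltr0n.
pose a i j := v j i 0.
have aP j : lp_ball p (\col_i a i j).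
  by have -> : \col_i a i j = v j by apply/matrixP => i k; rewrite mxE (ord1 k).
have hS := sum_row_norms p2 lm aP.
have r2 := moment_ge2 m p2 #|J|.
have h0 : 0 < expR 2 * (#|J|%:R `^ (2^-1 - fine p^-1%E)) ^+ 2 :> R.
  by rewrite mulr_gt0 ?expR_gt0 ?exprn_gt0 ?powR_gt0.
have [chi [chi1 chi2 chi3 chi4]] := partial_coloring r2 h0 l0 hS.
exists chi; split => //.
have chiE i : (\sum_j chi j *: v j) i 0 = \sum_j chi j * a i j.
  by rewrite summxE; apply: eq_bigr => j _; rewrite mxE.
have D0 := sqrtr_ge0 (width_sq (moment p m #|J|)
  (expR 2 * (#|J|%:R `^ (2^-1 - fine p^-1%E)) ^+ 2)).
have rq : ((moment p m #|J|)%:E <= q)%E by apply: le_trans pq; apply: moment_le.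
have := @lp_norm_interpolation _ _ q (\sum_j chi j *: v j) _ _ _ 1 rq _ D0 l0'.
move=> /(_ _ _ _ _)/le_trans; apply => //; first lra.
- by move=> i; rewrite chiE.
- rewrite mulr1; apply: le_trans chi4.
  by apply: ler_sum => i _; rewrite chiE.
rewrite /width_sq.
have -> : 64 * 64 * expR 9 * moment p m #|J| *
    (expR 2 * (#|J|%:R `^ (2^-1 - fine p^-1%E)) ^+ 2) =
    (64 * #|J|%:R `^ (2^-1 - fine p^-1%E)) ^+ 2 * (expR 11 * moment p m #|J|).
  have -> : expR 11 = expR 9 * expR 2 :> R by rewrite -expRD; congr expR; lra.
  ring.
rewrite sqrtrM ?sqr_ge0// sqrtr_sqr ger0_norm ?mulr_ge0 ?powR_ge0//.
rewrite sqrtrM ?expR_ge0// /coloring_const /rate_exponent.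
rewrite (@powRD _ _ _ (fine q^-1%E)) ?(gt_eqF l0') ?implybT//.
rewrite le_eqVlt; apply/orP; left; apply/eqP; ring.
Qed.

(** The recursion passes to the subtype of uncolored vectors, hence the arbitrary finite type. n,
    and with it [top_scale], stays that of the outermost call, so that the bounds of the stages add
    up by [potential_step]. *)
Lemma full_coloring p q m n : (2%:E <= p)%E -> (p <= q)%E -> (n <= m)%N ->
  forall (J : finType) (v : J -> 'cV[R]_m), (#|J| <= n)%N ->
  (forall j, lp_ball p (v j)) ->
  exists x : J -> R, (forall j, x j = 1 \/ x j = -1) /\
    rate_exponent p q * lp_norm q (\sum_j x j *: v j) <=
      32 * (2 * coloring_const) * top_scale p q m n * #|J|%:R `^ (rate_exponent p q / 2).
Proof.
move=> p2 pq nm.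
have [_ /andP[e0 e1]] := rate_exponent_bounds p2 pq.
have X0 := top_scale_ge0 p q m n.
have c0 : 0 <= coloring_const by rewrite /coloring_const mulr_ge0 ?sqrtr_ge0.
have q0 : (0%:E < q)%E by apply: lt_le_trans (le_trans p2 pq); rewrite lte_fin.
have q1 : (1%:E <= q)%E by apply: le_trans (le_trans p2 pq); rewrite lee_fin; lra.
move=> J; have [k] := ubnP #|J|; elim: k J => // k IH J; rewrite ltnS => Jk v Jn vP.
have [J0|J0] := posnP #|J|.
  exists (fun=> 1); split; first by left.
  rewrite big1 => [|j _]; last by have := card0_eq J0 j; rewrite inE.
  by rewrite lp_norm0// mulr0 !mulr_ge0 ?powR_ge0.
have Jm : (0 < #|J| <= m)%N by rewrite J0 (leq_trans Jn).
have [chi [chi1 chi2 chi3]] := partial_coloring_norm p2 pq Jm vP.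
pose Z := [set j | chi j == 0]%SET.
have ZJ : (16 * #|Z| <= 15 * #|J|)%N.
  have : (#|Z| + #|[set j | chi j != 0%R]%SET| = #|J|)%N.
    by rewrite -(cardsC Z); congr (_ + #|pred_of_set _|)%N; apply/setP => j; rewrite !inE.
  move: chi2; move: #|Z| #|_| #|_| => z s t; clear; lia.
have cZ : #|{: {j in Z}}| = #|Z|.
  by rewrite card_sig; apply: eq_card => j; rewrite inE.
have ZJ' : (#|Z| < #|J|)%N by clear -ZJ J0; lia.
have Zk : (#|{: {j in Z}}| < k)%N by rewrite cZ (leq_trans ZJ').
have Zn : (#|{: {j in Z}}| <= n)%N by rewrite cZ (leq_trans (ltnW ZJ')).
have [x' [x'1 x'2]] := IH _ Zk (fun j : {j in Z} => v (val j)) Zn (fun j => vP (val j)).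
pose x j := if insub j is Some j' then x' j' else chi j.
exists x; split.
  move=> j; rewrite /x; case: insubP => [j' _ _|]; first exact: x'1.
  by rewrite inE; case: (chi1 j) => ->; [rewrite eqxx|left|right].
have -> : \sum_j x j *: v j = \sum_j chi j *: v j + \sum_(j : {j in Z}) x' j *: v (val j).
  rewrite (bigID (mem Z))/= [in RHS](bigID (mem Z))/= [X in _ = X + _ + _]big1 ?add0r.
    rewrite addrC; congr (_ + _).
      by apply: eq_bigr => j jZ; rewrite /x insubN.
    rewrite big_sub; apply: eq_bigr => j _; rewrite /x.
    by rewrite valK.
  by move=> j; rewrite inE => /eqP ->; rewrite scale0r.
apply: le_trans (ler_wpM2l e0 (lp_norm_triangle _ _ q1)) _.
rewrite mulrDr.
have ln : (0 < #|J| <= n)%N by rewrite J0.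
have h1 := le_trans chi3 (ler_wpM2l c0 (stage_le p2 pq ln nm)).
have h2 := ler_wpM2l e0 h1.
apply: le_trans (lerD h2 x'2) _.
rewrite cZ.
have := @potential_step R (rate_exponent p q) (2 * coloring_const) (top_scale p q m n) #|J| #|Z|.
rewrite e0 e1 mulr_ge0 ?mulr_ge0// => /(_ isT isT).
have -> : 16 * #|Z|%:R <= 15 * #|J|%:R :> R by rewrite -!natrM ler_nat.
move=> /(_ isT); apply: le_trans.
rewrite lerD2r le_eqVlt; apply/orP; left; apply/eqP; ring.
Qed.

Lemma vb_upper_bound : exists C : R, 0 < C /\
  forall (m n : nat) (p q : \bar R),
    (0 < n)%N -> (n <= m)%N -> (2%:E <= p)%E -> (p <= q)%E ->
    (vb n (@lp_ball R m p) (@lp_ball R m q) <= C%:E * vb_rate m n p q)%E.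
Proof.
have c0 : 0 < coloring_const by rewrite /coloring_const mulr_gt0// sqrtr_gt0 expR_gt0.
exists (32 * (2 * coloring_const) * 2); split; first by rewrite !mulr_gt0.
move=> m n p q n0 nm p2 pq; apply: ge_ereal_sup => _ [v vP <-].
have nm' : (0 < n <= m)%N by rewrite n0.
have [|x [x1 x2]] := @full_coloring p q m n p2 pq nm 'I_n v _ vP; first by rewrite card_ord.
have q0 : (0%:E < q)%E by apply: lt_le_trans (le_trans p2 pq); rewrite lte_fin.
apply: (@le_trans _ _ (gauge (lp_ball q) (signed_sum v (\col_j x j)))).
  by apply: ereal_inf_lbound; exists (\col_j x j) => // j; rewrite mxE.
have ss : signed_sum v (\col_j x j) = \sum_j x j *: v j.
  by apply: eq_bigr => j _; rewrite mxE.
rewrite ss; set N := lp_norm q _ in x2.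
have hN N' : rate_exponent p q * N' <=
    32 * (2 * coloring_const) * top_scale p q m n * n%:R `^ (rate_exponent p q / 2) ->
    (N'%:E <= (32 * (2 * coloring_const) * 2)%:E * vb_rate m n p q)%E.
  move=> h; apply: vb_rate_bound => //; first by rewrite !mulr_gt0.
  have cc0 : 0 <= 32 * (2 * coloring_const) :> R by rewrite !mulr_ge0// ltW.
  apply: (le_trans h); have := ler_wpM2l cc0 (top_scale_le_rate q p2 nm').
  by rewrite !mulrA.
have [e1 /andP[e0 _]] := rate_exponent_bounds p2 pq.
have n0' : 0 < n%:R :> R by rewrite ltr0n.
have K0 : 0 < 32 * (2 * coloring_const) * top_scale p q m n * n%:R `^ (rate_exponent p q / 2).
  rewrite !mulr_gt0 ?powR_gt0// sqrtr_gt0; have := moment_ge2 m p2 n; lra.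
rewrite card_ord in x2; have N0 : 0 <= N by apply: lp_norm_ge0.
(* [gauge_le] wants a positive bound on the norm. For e = 0 the inequality required by [hN] holds
   for any number, so [N + 1] will do; otherwise the bound from [x2], divided by e, is positive. *)
move: e0; rewrite le_eqVlt => /predU1P[e0|e0].
  apply: le_trans (hN (N + 1) _); last by rewrite -{1}e0 mul0r ltW.
  by apply: gauge_le => //; [lra|rewrite lerDl].
apply: le_trans (hN (_ / rate_exponent p q) _); last first.
  by rewrite mulrCA mulfV ?gt_eqF// mulr1.
by apply: gauge_le => //; [rewrite divr_gt0|rewrite ler_pdivlMr// mulrC].
Qed.

End Existence.

(** * Semantics of programs *)

(* Unlike [ge0_le_integral], no measurability is assumed. *)
Lemma ge0_integral_mono d (Y : measurableType d) (R : realType)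
    (mu : {measure set Y -> \bar R}) (f g : Y -> \bar R) :
  (forall y, 0 <= f y)%E -> (forall y, f y <= g y)%E ->
  (\int[mu]_y f y <= \int[mu]_y g y)%E.
Proof.
move=> f0 fg; have g0 y : (0 <= g y)%E by apply: le_trans (fg y).
rewrite !ge0_integralTE//; apply: ereal_sup_le => _ [h hf <-]; exists h => //.
by move=> y; apply: le_trans (fg y).
Qed.

Section Semantics.
Context {R : realType} (D : sampler R) (T : nat -> nat -> nat).
Implicit Types (c : cmd) (f g : continuation R) (b k : nat) (s : state R).

(** Agreement is asked only up to budget b because finite unfoldings of a loop agree only for
    budgets below the number of unfoldings. *)
Lemma run_local c f g b s :
  (forall b' s', (b' <= b)%N -> f b' s' = g b' s') ->
  run D T c f b s = run D T c g b s.
Proof.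
have spend_local (k : nat) (f' g' : continuation R) b0 s0 : (0 < k)%N ->
    (forall b' s', (b' < b0)%N -> f' b' s' = g' b' s') ->
    spend k f' b0 s0 = spend k g' b0 s0.
  by rewrite /spend => k0 h; case: ifP => // kb; apply: h; lia.
elim: c f g b s => [|x e|a i j e|c1 IH1 c2 IH2|e c1 IH1 c2 IH2|e c IH|a x c ek el] f g b s fg /=.
- by apply: spend_local => // *; apply: fg; lia.
- by apply: spend_local => // *; apply: fg; lia.
- by apply: spend_local => // *; apply: fg; lia.
- by apply: IH1 => b' s' bb; apply: IH2 => *; apply: fg; lia.
- apply: spend_local => // b' s' bb; case: ifP => _.
    by apply: IH1 => *; apply: fg; lia.
  by apply: IH2 => *; apply: fg; lia.
- pose W (h : continuation R) := fun V : continuation R =>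
    spend 1 (fun b' s' => if beval s' e then run D T c V b' s' else h b' s').
  suff H N : forall b s, (forall b' s', (b' <= b)%N -> f b' s' = g b' s') ->
      iter N (W f) (fun _ _ => 0%E) b s = iter N (W g) (fun _ _ => 0%E) b s.
    exact: (H b.+1).
  elim: N => [//|N IHN] {}b {}s {}fg /=.
  apply: spend_local => // b' s' bb; case: ifP => _; last by apply: fg; lia.
  by apply: IH => b'' s'' bb'; apply: IHN => *; apply: fg; lia.
- by apply: spend_local => // b' s' bb; apply: eq_integral => y _; apply: fg; lia.
Qed.

Lemma run_while e c f b s :
  run D T (While e c) f b.+1 s =
    if beval s e then run D T c (run D T (While e c) f) b s else f b s.
Proof.
pose W N := iter N (fun V : continuation R =>
  spend 1 (fun b' s' => if beval s' e then run D T c V b' s' else f b' s'))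
  (fun _ _ => 0%E).
(* Each unfolding spends a unit, so all approximations with more unfoldings than the budget
   coincide. *)
have WW b0 : forall N N' s0, (b0 < N)%N -> (b0 < N')%N -> W N b0 s0 = W N' b0 s0.
  have [k] := ubnP b0; elim: k b0 => // k IH b0; rewrite ltnS => b0k.
  case=> // N [//|N'] s0 bN bN' /=; rewrite /spend; case: ifP => // b1.
  case: ifP => // _; apply: run_local => b' s' bb.
  by apply: IH; lia.
rewrite -[LHS]/(W b.+2 b.+1 s) /= /spend /= subn1 /=.
case: ifP => // _; apply: run_local => b' s' bb.
by apply: (WW b' b.+1 b'.+1); lia.
Qed.

Lemma run_while_true (g : bexp) c f b s : beval s g ->
  run D T (While g c) f b.+1 s = run D T c (run D T (While g c) f) b s.
Proof. by rewrite run_while => ->. Qed.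

Lemma run_while_false (g : bexp) c f b s : ~~ beval s g ->
  run D T (While g c) f b.+1 s = f b s.
Proof. by rewrite run_while => /negbTE ->. Qed.

Lemma run_sample a x a' ek el f b s :
  (T (neval s ek) (neval s el) < b)%N ->
  run D T (Sample a x a' ek el) f b s =
    (\int[D (\matrix_(i < neval s ek, j < neval s el) arr s a i j)
        (\col_(j < neval s el) arr s x 0 j)]_y
      f (b - (T (neval s ek) (neval s el)).+1)%N (set_row s a' y))%E.
Proof. by move=> h; rewrite /= /spend h. Qed.

Lemma run_ge0 c f b s : (forall b' s', (0 <= f b' s')%E) -> (0 <= run D T c f b s)%E.
Proof.
have spend_ge0 (k : nat) (f' : continuation R) b0 s0 :
    (forall b' s', (0 <= f' b' s')%E) -> (0 <= spend k f' b0 s0)%E.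
  by rewrite /spend => h; case: ifP.
elim: c f b s => [|x e|a i j e|c1 IH1 c2 IH2|e c1 IH1 c2 IH2|e c IH|a x c ek el] f b s f0 /=.
- exact: spend_ge0.
- exact: spend_ge0.
- exact: spend_ge0.
- by apply: IH1 => *; apply: IH2.
- by apply: spend_ge0 => b' s'; case: ifP => _; [apply: IH1|apply: IH2].
- suff H N : forall b s, (0 <= iter N (fun V : continuation R =>
      spend 1 (fun b' s' => if beval s' e then run D T c V b' s' else f b' s'))
      (fun _ _ => 0%E) b s)%E by exact: (H b.+1).
  elim: N => [//|N IHN] {}b {}s /=.
  by apply: spend_ge0 => b' s'; case: ifP => // _; apply: IH.
- by apply: spend_ge0 => b' s'; apply: integral_ge0.
Qed.

Lemma run_le1 c f b s : (forall b' s', (0 <= f b' s' <= 1)%E) -> (run D T c f b s <= 1)%E.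
Proof.
have spend_le1 (k : nat) (f' : continuation R) b0 s0 :
    (forall b' s', (f' b' s' <= 1)%E) -> (spend k f' b0 s0 <= 1)%E.
  by rewrite /spend => h; case: ifP.
have ge0 f' : (forall b' s', (0 <= f' b' s' <= 1)%E) -> forall b' s', (0 <= f' b' s')%E.
  by move=> h b' s'; have /andP[] := h b' s'.
have le1 f' : (forall b' s', (0 <= f' b' s' <= 1)%E) -> forall b' s', (f' b' s' <= 1)%E.
  by move=> h b' s'; have /andP[] := h b' s'.
elim: c f b s => [|x e|a i j e|c1 IH1 c2 IH2|e c1 IH1 c2 IH2|e c IH|a x c ek el] f b s f0 /=.
- by apply: spend_le1 => *; apply: le1.
- by apply: spend_le1 => *; apply: le1.
- by apply: spend_le1 => *; apply: le1.
- by apply: IH1 => b' s'; rewrite IH2// run_ge0//; exact: ge0.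
- by apply: spend_le1 => b' s'; case: ifP => _; [apply: IH1|apply: IH2].
- have H N : forall b' s', (0 <= iter N (fun V : continuation R =>
      spend 1 (fun b' s' => if beval s' e then run D T c V b' s' else f b' s'))
      (fun _ _ => 0%E) b' s' <= 1)%E.
    elim: N => [|N IHN] b' s' /=; first by rewrite lexx lee01.
    rewrite spend_le1 => [|b'' s'']; last by case: ifP => _; [apply: IH|apply: le1].
    rewrite andbT /spend; case: ifP => // _; case: ifP => _; last exact: ge0.
    by apply: run_ge0; exact: ge0.
  by have /andP[] := H b.+1 b s.
- apply: spend_le1 => b' s'.
  apply: le_trans (@ge0_integral_mono _ _ _ _ _ (cst 1%E) _ _) _.
  + by move=> y; exact: ge0.
  + by move=> y; exact: le1.
  + by rewrite integral_cst// mul1e probability_le1.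
Qed.

End Semantics.

(* [For x N c] runs c for x = 0, ..., N - 1. *)
Definition For (x : nat) (N : nexp) (c : cmd) : cmd :=
  Seq (NSet x (NConst 0))
    (While (NLe (NAdd (NVar x) (NConst 1)) N)
       (Seq c (NSet x (NAdd (NVar x) (NConst 1))))).

(** * Deterministic runs with time bounds *)

Section Triples.
Context {R : realType} (D : sampler R) (T : nat -> nat -> nat).
Implicit Types (c : cmd) (Q : state R -> Prop) (s : state R) (k : nat).

(* c runs deterministically from s, in time at most k, to a state in Q. *)
Definition terminates c s k Q :=
  exists s' k', [/\ (k' <= k)%N, Q s' &
    forall f b, run D T c f (k' + b)%N s = f b s'].

Let run_spend1 f b s : spend 1 f (1 + b)%N s = f b s :> \bar R.
Proof. by rewrite /spend add1n /= subn1. Qed.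

Lemma terminates_skip s k Q : (0 < k)%N -> Q s -> terminates Skip s k Q.
Proof. by move=> k0 Qs; exists s, 1%N; split => // f b; rewrite [LHS]run_spend1. Qed.

Lemma terminates_nset x e s Q :
  Q (set_var s x (neval s e)) -> terminates (NSet x e) s 1 Q.
Proof. by move=> Qs; eexists _, 1%N; split; [|exact: Qs|] => // f b; rewrite [LHS]run_spend1. Qed.

Lemma terminates_rset a i j e s Q :
  Q (set_cell s a (neval s i) (neval s j) (reval s e)) ->
  terminates (RSet a i j e) s 1 Q.
Proof. by move=> Qs; eexists _, 1%N; split; [|exact: Qs|] => // f b; rewrite [LHS]run_spend1. Qed.

Lemma terminates_seq c1 c2 s k1 k2 Q1 Q2 : terminates c1 s k1 Q1 ->
  (forall s', Q1 s' -> terminates c2 s' k2 Q2) -> terminates (Seq c1 c2) s (k1 + k2) Q2.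
Proof.
move=> [s1 [l1 [lk1 Qs1 h1]]] /(_ _ Qs1)[s2 [l2 [lk2 Qs2 h2]]].
exists s2, (l1 + l2)%N; split => //; first exact: leq_add.
by move=> f b; rewrite /= -addnA h1 h2.
Qed.

Lemma terminates_if g c1 c2 s k Q :
  (beval s g -> terminates c1 s k Q) -> (~~ beval s g -> terminates c2 s k Q) ->
  terminates (If g c1 c2) s k.+1 Q.
Proof.
move=> h1 h2.
have [gs|gs] := boolP (beval s g).
  have [s' [l [lk Qs' h]]] := h1 gs; exists s', l.+1; split => // f b.
  by rewrite -[l.+1]add1n -addnA [LHS]/= run_spend1 gs h.
have [s' [l [lk Qs' h]]] := h2 gs; exists s', l.+1; split => // f b.
by rewrite -[l.+1]add1n -addnA [LHS]/= run_spend1 (negbTE gs) h.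
Qed.

(** An iteration pays K for the body and 2 for guard and increment; the last 2 units are the
    initialization and the failing guard. The invariant is imposed after the increment, on the state
    that the next guard sees. *)
Lemma terminates_for x N c s K Nv (I : nat -> state R -> Prop) Q :
  I 0%N (set_var s x 0) ->
  (forall i s', I i s' -> neval s' N = Nv) ->
  (forall i s', (i < Nv)%N -> var s' x = i -> I i s' ->
     terminates c s' K (fun s'' => var s'' x = i /\ I i.+1 (set_var s'' x i.+1))) ->
  (forall s', I Nv s' -> Q s') ->
  terminates (For x N c) s (Nv * (K + 2) + 2) Q.
Proof.
move=> I0 IN Istep IQ.
have loop n : forall i s', (Nv - i <= n)%N -> (i <= Nv)%N -> var s' x = i -> I i s' ->
    terminates (While (NLe (NAdd (NVar x) (NConst 1)) N)
       (Seq c (NSet x (NAdd (NVar x) (NConst 1))))) s' ((Nv - i) * (K + 2) + 1) Q.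
  elim: n => [|n IH] i s' ni iN xi Is.
    have {ni} iE : i = Nv by lia.
    exists s', 1%N; split => //; first by lia.
      by apply: IQ; rewrite -iE.
    move=> f b; rewrite add1n run_while /= xi (IN _ _ Is) iE addn1 ltnn.
    by [].
  have [iE|iN'] := eqVneq i Nv.
    exists s', 1%N; split => //; first by lia.
      by apply: IQ; rewrite -iE.
    move=> f b; rewrite add1n run_while /= xi (IN _ _ Is) iE addn1 ltnn.
    by [].
  have {}iN : (i < Nv)%N by rewrite ltn_neqAle iN'.
  have [s1 [k1 [kK [x1 I1] h1]]] := Istep i s' iN xi Is.
  have ni' : (Nv - i.+1 <= n)%N by lia.
  have x2 : var (set_var s1 x i.+1) x = i.+1 by rewrite /= eqxx.
  have [s2 [k2 [k2K Q2 h2]]] := IH i.+1 _ ni' iN x2 I1.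
  exists s2, (1 + (k1 + (1 + k2)))%N; split => //.
    have -> : (Nv - i = (Nv - i.+1).+1)%N by lia.
    rewrite mulSn; lia.
  move=> f b; rewrite -addnA add1n run_while.
  have -> : beval s' (NLe (NAdd (NVar x) (NConst 1)) N).
    by rewrite /= xi (IN _ _ Is) addn1.
  rewrite -addnA [LHS]/= h1 -addnA run_spend1 /= x1 addn1.
  exact: h2.
have [s2 [k2 [k2K Q2 h2]]] := loop Nv 0%N (set_var s x 0) (leq_subr _ _) (leq0n _)
  ltac:(by rewrite /= eqxx) I0.
exists s2, (1 + k2)%N; split => //; first by rewrite subn0 in k2K; lia.
by move=> f b; rewrite -addnA; exact: (etrans (run_spend1 _ _ _) (h2 f b)).
Qed.

End Triples.

(** * The program *)

(* Variables 0 to 6 hold m, n, the acceptance flag, the loop indices i and j, the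
   rank k of column j among the active ones, and the number of active columns.
   Arrays 2 to 5 hold the current coloring, the active columns, their current
   colors and the sample; array 6 is scratch space. *)
Definition color : rexp := RCell 2 (NConst 0) (NVar 4).

(** Constants are natural numbers, so -1 is written 0 - 1; strict inequalities are negations of
    [RLe]. *)
Definition color_active : bexp :=
  BAnd (BNot (RLe (ROfNat (NConst 1)) color))
       (BNot (RLe color (RSub (ROfNat (NConst 0)) (ROfNat (NConst 1))))).

Definition incr (x : nat) : cmd := NSet x (NAdd (NVar x) (NConst 1)).

Definition init_prog : cmd :=
  Seq (For 4 (NVar 1) (RSet 2 (NConst 0) (NVar 4) (ROfNat (NConst 0))))
      (NSet 6 (NVar 1)).

Definition gather_prog : cmd :=
  Seq (NSet 5 (NConst 0))
    (For 4 (NVar 1) (If color_active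
      (Seq (For 3 (NVar 0) (RSet 3 (NVar 3) (NVar 5) (RCell 0 (NVar 3) (NVar 4))))
        (Seq (RSet 4 (NConst 0) (NVar 5) color) (incr 5)))
      Skip)).

(** [color_active] is tested twice: the old color tells whether the column was sampled, the new one
    whether it still counts in variable 6. *)
Definition scatter_prog : cmd :=
  Seq (NSet 5 (NConst 0)) (Seq (NSet 6 (NConst 0))
    (For 4 (NVar 1) (If color_active
      (Seq (RSet 2 (NConst 0) (NVar 4) (RCell 5 (NConst 0) (NVar 5)))
        (Seq (incr 5) (If color_active (incr 6) Skip)))
      Skip))).

Definition round_prog : cmd :=
  Seq gather_prog (Seq (Sample 3 4 5 (NVar 0) (NVar 5)) scatter_prog).

Definition scratch (t : nat) : rexp := RCell 6 (NConst 0) (NConst t).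
Definition set_scratch (t : nat) (e : rexp) : cmd := RSet 6 (NConst 0) (NConst t) e.
Definition inv_exponent (t : nat) : rexp := RCell 1 (NConst 0) (NConst t).
Definition rnat (k : nat) : rexp := ROfNat (NConst k).

(* Array cell 4 receives |w_i| for the current row i. The test is on the sum of the
   (eps |w_i| / bound)^q for q < +oo; for q = +oo each row over the bound adds 2. *)
Definition test_term_prog : cmd :=
  Seq (set_scratch 4 (rnat 0))
  (Seq (For 4 (NVar 1)
     (set_scratch 4 (RAdd (scratch 4) (RMul color (RCell 0 (NVar 3) (NVar 4))))))
  (Seq (If (RLe (scratch 4) (rnat 0)) (set_scratch 4 (RSub (rnat 0) (scratch 4))) Skip)
  (If (RLe (inv_exponent 1) (rnat 0))
     (If (RLe (RMul (scratch 4) (scratch 1)) (scratch 2)) Skip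
        (set_scratch 3 (RAdd (scratch 3) (rnat 2))))
     (If (RLe (scratch 4) (rnat 0)) Skip
        (set_scratch 3 (RAdd (scratch 3)
           (RExp (RDiv (RLn (RDiv (RMul (scratch 4) (scratch 1)) (scratch 2)))
                       (inv_exponent 1))))))))).

(** Scratch cells 0 to 3 hold min(p, log(2m/n)), e, the bound and the running sum. The minimum is
    decided by comparing log(2m/n)/p with 1, which is also right for p = +oo, where 1/p is 0. *)
Definition test_prog (c : nat) : cmd :=
  Seq (set_scratch 0 (RLn (RDiv (RMul (rnat 2) (ROfNat (NVar 0))) (ROfNat (NVar 1)))))
  (Seq (If (RLe (RMul (inv_exponent 0) (scratch 0)) (rnat 1)) Skip
          (set_scratch 0 (RDiv (rnat 1) (inv_exponent 0))))
  (Seq (set_scratch 1 (RAdd (RSub (RDiv (rnat 1) (rnat 2)) (inv_exponent 0)) (inv_exponent 1)))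
  (Seq (set_scratch 2 (RMul (RMul (rnat c) (RExp (RDiv (RLn (scratch 0)) (rnat 2))))
          (RExp (RMul (scratch 1) (RLn (ROfNat (NVar 1)))))))
  (Seq (set_scratch 3 (rnat 0))
  (Seq (For 3 (NVar 0) test_term_prog)
  (If (RLe (scratch 3) (rnat 1)) (NSet 2 (NConst 1)) Skip)))))).

Definition rounds_prog : cmd := While (NLe (NConst 1) (NVar 6)) round_prog.

Definition balance_prog (c : nat) : cmd :=
  While (NLe (NVar 2) (NConst 0)) (Seq init_prog (Seq rounds_prog (test_prog c))).

(** For j in P, the position of j in the compacted arrays. *)
Fixpoint rank (P : pred nat) (j : nat) : nat :=
  if j is j'.+1 then (rank P j' + P j')%N else 0%N.

Lemma rank_mono P i j : (i <= j)%N -> (rank P i <= rank P j)%N.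
Proof.
elim: j => [|j IH]; first by rewrite leqn0 => /eqP ->.
rewrite leq_eqVlt => /predU1P[-> //|ij].
by apply: leq_trans (IH _) _; rewrite ?leq_addr.
Qed.

Lemma rank_lt (P : pred nat) i j : (i < j)%N -> P i -> (rank P i < rank P j)%N.
Proof.
move=> ij Pi; apply: leq_trans (rank_mono P ij).
by rewrite /= Pi addn1.
Qed.

Lemma rank_neq (P : pred nat) i j : (i < j)%N -> P i -> (rank P i == rank P j) = false.
Proof. by move=> ij Pi; rewrite ltn_eqF// rank_lt. Qed.

Lemma rank_all (P : pred nat) n : (forall j, P j) -> rank P n = n.
Proof. by move=> PT; elim: n => //= n ->; rewrite PT addn1. Qed.

(** Turns sums over the compacted arrays into sums over the active columns. *)
Lemma big_rank (V : zmodType) (P : pred nat) n (F : nat -> V) :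
  \sum_(0 <= t < rank P n) F t = \sum_(0 <= j < n | P j) F (rank P j).
Proof.
elim: n => [|n IH]; first by rewrite !big_nil.
rewrite /= [RHS]big_mkcond big_nat_recr//= -big_mkcond/= -IH.
case: (P n); last by rewrite addn0 addr0.
by rewrite addn1 big_nat_recr.
Qed.

Lemma rank_surj (P : pred nat) n t : (t < rank P n)%N ->
  exists2 j, (j < n)%N && P j & rank P j = t.
Proof.
elim: n => //= n IH; case Pn: (P n); last first.
  by rewrite addn0 => /IH[j /andP[jn Pj] <-]; exists j => //; rewrite ltnS ltnW// Pj.
rewrite addn1 ltnS leq_eqVlt => /predU1P[->|/IH[j /andP[jn Pj] <-]].
  by exists n => //; rewrite ltnSn.
by exists j => //; rewrite ltnS ltnW// Pj.
Qed.

(** * Correctness of initialization, gathering and scattering *)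

Section Specifications.
Context {R : realType} (D : sampler R) (T : nat -> nat -> nat).
Variables (m n : nat) (A : nat -> nat -> R) (e : nat -> R).
Implicit Types (s : state R) (x y : nat -> R) (k : nat).

Definition active (z : R) : bool := ~~ (1 <= z) && ~~ (z <= -1).

(** What an attempt preserves until it is accepted: the input and the unset flag. *)
Record frame s : Prop := Frame {
  frame_m : var s 0 = m;
  frame_n : var s 1 = n;
  frame_flag : var s 2 = 0%N;
  frame_input : forall i j, arr s 0 i j = A i j;
  frame_exponents : forall j, arr s 1 0 j = e j }.

Definition colored x s := forall j, (j < n)%N -> arr s 2 0 j = x j.

Lemma frame_set_var s z k : (2 < z)%N -> frame s -> frame (set_var s z k).
Proof.
move=> z2 [h0 h1 h2 h3 h4]; split => //=.
- by case: z z2.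
- by case: z z2 => [|[]].
- by case: z z2 => [|[|[]]].
Qed.

Lemma frame_set_cell s a i j r : (1 < a)%N -> frame s -> frame (set_cell s a i j r).
Proof.
move=> a1 [h0 h1 h2 h3 h4]; split => //=.
- by move=> i' j'; rewrite -h3; case: a a1.
- by move=> j'; rewrite -h4; case: a a1 => [|[]].
Qed.

Lemma frame_set_row s a l (y : l.-tuple R) : (1 < a)%N -> frame s -> frame (set_row s a y).
Proof.
move=> a1 [h0 h1 h2 h3 h4]; split => //=.
- by move=> i' j'; rewrite -h3; case: a a1.
- by move=> j'; rewrite -h4; case: a a1 => [|[]].
Qed.

Lemma beval_active s x j : colored x s -> (j < n)%N -> var s 4 = j ->
  beval s color_active = active (x j).
Proof. by move=> sx jn s4; rewrite /= s4 sx// /active sub0r. Qed.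

Lemma init_spec s : frame s ->
  terminates D T init_prog s (n * 3 + 3)
    (fun s' => [/\ frame s', colored (fun=> 0) s' & var s' 6 = n]).
Proof.
move=> fs.
have -> : (n * 3 + 3 = n * (1 + 2) + 2 + 1)%N by lia.
apply: (@terminates_seq _ _ _ _ _ _ _ _
  (fun s' => frame s' /\ forall j, (j < n)%N -> arr s' 2 0 j = 0)); last first.
  move=> s' [fs' xs']; apply: terminates_nset; split => //=.
    exact: frame_set_var.
  exact: frame_n.
apply: (@terminates_for _ _ _ _ _ _ _ _ n
  (fun i s' => frame s' /\ forall j, (j < i)%N -> arr s' 2 0 j = 0)) => //.
- by split => //; exact: frame_set_var.
- by move=> i s' [fs' _] /=; exact: frame_n.
- move=> i s' iN s4 [fs' xs']; apply: terminates_rset => /=; split => //; split.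
    by apply: frame_set_var => //; apply: frame_set_cell.
  move=> j; rewrite ltnS leq_eqVlt s4 /= => /predU1P[->|ji].
    by rewrite eqxx.
  by case: eqP => // _; exact: xs'.
Qed.

Definition gathered x s := forall j, (j < n)%N -> active (x j) ->
  arr s 4 0 (rank (active \o x) j) = x j /\
  forall i, (i < m)%N -> arr s 3 i (rank (active \o x) j) = A i j.

Definition gathered_upto x j0 s := [/\ frame s, colored x s,
  var s 5 = rank (active \o x) j0 &
  forall j, (j < j0)%N -> active (x j) ->
  arr s 4 0 (rank (active \o x) j) = x j /\
  forall i, (i < m)%N -> arr s 3 i (rank (active \o x) j) = A i j].

Lemma gather_spec s x : frame s -> colored x s ->
  terminates D T gather_prog s (1 + (n * (m * 3 + 7) + 2))
    (fun s' => [/\ frame s', colored x s', var s' 5 = rank (active \o x) n &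
       gathered x s']).
Proof.
move=> fs xs; set P := active \o x.
apply: (@terminates_seq _ _ _ _ _ _ _ _ (gathered_upto x 0)).
  by apply: terminates_nset; split => //=; exact: frame_set_var.
move=> {fs xs}s [fs xs s5 _].
have -> : (m * 3 + 7 = (m * (1 + 2) + 2 + (1 + 1)).+1 + 2)%N by lia.
apply: (@terminates_for _ _ _ _ _ _ _ _ n (gathered_upto x)) => //.
- by split => //; exact: frame_set_var.
- by move=> i s' [fs' _ _ _] /=; exact: frame_n.
move=> j {fs xs s5}s jn s4 [fs xs s5 gs].
apply: terminates_if; rewrite (beval_active xs jn s4) => Pj; last first.
  apply: terminates_skip; first by rewrite !addnS.
  split => //; split => //=.
  - exact: frame_set_var.
  - by rewrite /P /= (negbTE Pj) addn0.
  - move=> j'; rewrite ltnS leq_eqVlt => /predU1P[->|]; first by rewrite (negbTE Pj).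
    exact: gs.
apply: (@terminates_seq _ _ _ _ _ _ _ _ (fun s' => [/\ gathered_upto x j s', var s' 4 = j
    & forall i, (i < m)%N -> arr s' 3 i (rank P j) = A i j])).
  apply: (@terminates_for _ _ _ _ _ _ _ _ m (fun i s' => [/\ gathered_upto x j s', var s' 4 = j
    & forall i', (i' < i)%N -> arr s' 3 i' (rank P j) = A i' j])) => //.
  - split => //; split => //=; exact: frame_set_var.
  - by move=> i s' [[fs' _ _ _] _ _] /=; exact: frame_m.
  - move=> i {fs xs s5 gs s4}s im s3 [[fs xs s5 gs] s4 gi].
    apply: terminates_rset => /=; split => //; split => //.
      split => //=.
        by apply: frame_set_var => //; exact: frame_set_cell.
      (* Earlier active columns have smaller ranks, so their cells are not overwritten. *)
      move=> j' j'j Pj'; have [g1 g2] := gs j' j'j Pj'; split => // i' i'm.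
      by rewrite s5 rank_neq// andbF g2.
    move=> i'; rewrite s3 s5 s4 (frame_input fs) ltnS leq_eqVlt eqxx andbT.
    by move=> /predU1P[->|i'i]; rewrite ?eqxx// (ltn_eqF i'i) gi.
move=> {fs xs s5 gs s4}s [[fs xs s5 gs] s4 gj].
apply: (@terminates_seq _ _ _ _ _ _ _ _ (fun s' => [/\ gathered_upto x j s', var s' 4 = j,
  arr s' 4 0 (rank P j) = x j
    & forall i, (i < m)%N -> arr s' 3 i (rank P j) = A i j])).
  apply: terminates_rset => /=; split => //=; last first.
    by rewrite s5 s4 xs// !eqxx.
  split => //=; first exact: frame_set_cell.
  move=> j' j'j Pj'; have [g1 g2] := gs j' j'j Pj'; split => //.
  by rewrite s5 rank_neq.
move=> {fs xs s5 gs s4 gj}s [[fs xs s5 gs] s4 g1 g2].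
apply: terminates_nset => /=; split => //; split => //=.
- by do 2 apply: frame_set_var => //.
- by rewrite s5 /P /= Pj.
- move=> j'; rewrite ltnS leq_eqVlt => /predU1P[->//|]; exact: gs.
Qed.

Definition merged x y j : R :=
  if active (x j) then y (rank (active \o x) j) else x j.

Lemma scatter_spec s x y : frame s -> colored x s ->
  (forall t, (t < rank (active \o x) n)%N -> arr s 5 0 t = y t) ->
  terminates D T scatter_prog s (2 + (n * 7 + 2))
    (fun s' => [/\ frame s', colored (merged x y) s' &
      var s' 6 = rank (active \o merged x y) n]).
Proof.
move=> fs xs ys; set P := active \o x; set P' := active \o merged x y.
(* A column whose color is already fixed is never reactivated. *)
have P'P j : P' j -> P j.
  by rewrite /P' /P /= /merged; case: ifP => // ->.
have -> : (2 + (n * 7 + 2) = 1 + (1 + (n * (5 + 2) + 2)))%N by lia.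
apply: (@terminates_seq _ _ _ _ _ _ _ _ (fun s' => [/\ frame s', colored x s',
  var s' 5 = 0%N & forall t, (t < rank P n)%N -> arr s' 5 0 t = y t])).
  by apply: terminates_nset; split => //=; exact: frame_set_var.
move=> {fs xs ys}s [fs xs s5 ys].
apply: (@terminates_seq _ _ _ _ _ _ _ _ (fun s' => [/\ frame s', colored x s',
  var s' 5 = 0%N, var s' 6 = 0%N & forall t, (t < rank P n)%N -> arr s' 5 0 t = y t])).
  by apply: terminates_nset; split => //=; exact: frame_set_var.
move=> {fs xs s5 ys}s [fs xs s5 s6 ys].
pose I j s' := [/\ frame s',
  forall j', (j' < n)%N -> arr s' 2 0 j' = if (j' < j)%N then merged x y j' else x j',
  var s' 5 = rank P j, var s' 6 = rank P' j &
  forall t, (t < rank P n)%N -> arr s' 5 0 t = y t].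
apply: (@terminates_for _ _ _ _ _ _ _ 5 n I) => //.
- by split => //=; exact: frame_set_var.
- by move=> i s' [fs' _ _ _ _] /=; exact: frame_n.
- move=> j {fs xs s5 s6 ys}s jn s4 [fs xs s5 s6 ys].
  have xj : beval s color_active = P j.
    by rewrite /= s4 xs// ltnn /P /= /active sub0r.
  apply: (@terminates_if _ _ _ _ _ _ _ 4); rewrite xj => Pj; last first.
    apply: terminates_skip => //.
    have P'j : ~~ P' j by apply: contra Pj; exact: P'P.
    split => //; split => //=.
    + exact: frame_set_var.
    + move=> j' j'n; rewrite xs// ltnS [(j' <= j)%N]leq_eqVlt.
      have [->|//] := eqVneq j' j; rewrite ltnn /= /merged.
      by move: Pj; rewrite /P /= => /negbTE ->.
    + by rewrite (negbTE Pj) addn0.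
    + by rewrite (negbTE P'j) addn0.
  apply: (@terminates_seq _ _ _ _ _ _ 1 3 (fun s' => [/\ frame s', var s' 4 = j,
    (forall j', (j' < n)%N -> arr s' 2 0 j' = if (j' < j.+1)%N then merged x y j' else x j'),
    var s' 5 = rank P j /\ var s' 6 = rank P' j &
    forall t, (t < rank P n)%N -> arr s' 5 0 t = y t])).
    apply: terminates_rset; split => //=; first exact: frame_set_cell.
    move=> j' j'n; rewrite s4 s5 ltnS [(j' <= j)%N]leq_eqVlt xs//.
    have [->|//] := eqVneq j' j.
    by rewrite /= ys ?rank_lt// /merged; move: Pj; rewrite /P /= => ->.
  move=> {fs xs s5 s6 ys s4 xj}s [fs s4 xs [s5 s6] ys].
  apply: (@terminates_seq _ _ _ _ _ _ 1 2 (fun s' => [/\ frame s', var s' 4 = j,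
    (forall j', (j' < n)%N -> arr s' 2 0 j' = if (j' < j.+1)%N then merged x y j' else x j'),
    var s' 5 = rank P j.+1 /\ var s' 6 = rank P' j &
    forall t, (t < rank P n)%N -> arr s' 5 0 t = y t])).
    apply: terminates_nset; split => //=; first exact: frame_set_var.
    by rewrite s5 Pj.
  move=> {fs xs s5 s6 ys s4}s [fs s4 xs [s5 s6] ys].
  have xj : beval s color_active = P' j.
    by rewrite /= s4 xs// ltnSn /P' /= /active sub0r.
  apply: (@terminates_if _ _ _ _ _ _ _ 1); rewrite xj => P'j.
    apply: terminates_nset => /=; split => //; split => //=.
      by do 2 apply: frame_set_var => //.
    by rewrite s6 P'j.
  apply: terminates_skip => //; split => //; split => //=.
    exact: frame_set_var.
  by rewrite (negbTE P'j) addn0.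
- move=> s' [fs' xs' _ s6' _]; split => // j jn.
  by rewrite xs'// jn.
Qed.

End Specifications.

Section Acceptance.
Context {R : realType}.

Section Spec.
Variables (D : sampler R) (T : nat -> nat -> nat).
Variables (m n : nat) (A : nat -> nat -> R) (e : nat -> R) (c : nat) (x : nat -> R).

Definition row_sum i : R := \sum_(0 <= j < n) x j * A i j.

(** This and the next definitions copy the expressions of the program, so that [test_spec] holds by
    evaluation; their meaning is established in [acceptedP]. *)
Definition test_min : R :=
  if e 0%N * ln (2 * m%:R / n%:R) <= 1 then ln (2 * m%:R / n%:R) else 1 / e 0%N.

Definition test_exponent : R := 1 / 2 - e 0%N + e 1%N.

Definition test_bound : R :=
  c%:R * expR (ln test_min / 2) * expR (test_exponent * ln n%:R).

Definition test_term i : R :=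
  if e 1%N <= 0 then
    if `|row_sum i| * test_exponent <= test_bound then 0 else 2
  else if `|row_sum i| <= 0 then 0
  else expR (ln (`|row_sum i| * test_exponent / test_bound) / e 1%N).

Definition accepted : bool := \sum_(0 <= i < m) test_term i <= 1.

Let testing i s := [/\ frame m n A e s, colored n x s, arr s 6 0 1 = test_exponent,
  arr s 6 0 2 = test_bound & arr s 6 0 3 = \sum_(0 <= i' < i) test_term i'].

Let test_term_spec i s : (i < m)%N -> var s 3 = i -> testing i s ->
  terminates D T test_term_prog s (1 + (n * (1 + 2) + 2 + (2 + 3)))
    (fun s' => var s' 3 = i /\ testing i.+1 (set_var s' 3 i.+1)).
Proof.
move=> im s3 [fs xs h1 h2 h3].
apply: (@terminates_seq _ _ _ _ _ _ _ _ (fun s' =>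
  [/\ testing i s', var s' 3 = i & arr s' 6 0 4 = 0])).
  by apply: terminates_rset => /=; split => //; split => //; exact: frame_set_cell.
move=> {fs xs h1 h2 h3 s3}s [[fs xs h1 h2 h3] s3 s4].
apply: (@terminates_seq _ _ _ _ _ _ _ _ (fun s' =>
  [/\ testing i s', var s' 3 = i & arr s' 6 0 4 = row_sum i])).
  apply: (@terminates_for _ _ _ _ _ _ _ _ n (fun j s' =>
    [/\ testing i s', var s' 3 = i & arr s' 6 0 4 = \sum_(0 <= j' < j) x j' * A i j'])) => //.
  - split => //=; last by rewrite big_nil.
    by split => //=; exact: frame_set_var.
  - by move=> j s' [[fs' _ _ _ _] _ _]; exact: (frame_n fs').
  - move=> j {fs xs h1 h2 h3 s3 s4}s jn sj [[fs xs h1 h2 h3] s3 s4].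
    apply: terminates_rset => /=; split => //; split => //=.
      by split => //=; apply: frame_set_var => //; exact: frame_set_cell.
    by rewrite big_nat_recr//= s4 s3 sj xs// (frame_input fs).
move=> {fs xs h1 h2 h3 s3 s4}s [[fs xs h1 h2 h3] s3 s4].
apply: (@terminates_seq _ _ _ _ _ _ _ _ (fun s' =>
  [/\ testing i s', var s' 3 = i & arr s' 6 0 4 = `|row_sum i|])).
  apply: terminates_if => /=; rewrite s4 => si.
    apply: terminates_rset => /=; split => //; first by split => //=; exact: frame_set_cell.
    by rewrite s4 ler0_norm// sub0r.
  by apply: terminates_skip => //; split => //; rewrite s4 gtr0_norm// ltNge.
move=> {fs xs h1 h2 h3 s3 s4}s [[fs xs h1 h2 h3] s3 s4].
have add_term z : z = test_term i -> testing i.+1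
    (set_var (set_cell s 6 0 3 (arr s 6 0 3 + z)) 3 i.+1).
  move=> ->; split => //=.
    by apply: frame_set_var => //; exact: frame_set_cell.
  by rewrite big_nat_recr//= h3.
have add0_term : 0 = test_term i -> testing i.+1 (set_var s 3 i.+1).
  move=> t0; split => //=; first exact: frame_set_var.
  by rewrite big_nat_recr//= -t0 addr0.
apply: terminates_if => /=; rewrite (frame_exponents fs) => e1.
  apply: terminates_if => /=; rewrite s4 h1 h2 => le.
    apply: terminates_skip => //; split => //; apply: add0_term.
    by rewrite /test_term e1 le.
  apply: terminates_rset; split => //; apply: add_term.
  by rewrite /test_term e1 (negbTE le).
apply: terminates_if => /=; rewrite s4 => le.
  apply: terminates_skip => //; split => //; apply: add0_term.
  by rewrite /test_term (negbTE e1) le.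
apply: terminates_rset; split => //; apply: add_term => /=.
by rewrite s4 h1 h2 (frame_exponents fs) /test_term (negbTE e1) (negbTE le).
Qed.

Lemma test_spec s : frame m n A e s -> colored n x s ->
  terminates D T (test_prog c) s (m * (n * 3 + 10) + 10)
    (fun s' => colored n x s' /\ if accepted then var s' 2 = 1%N else frame m n A e s').
Proof.
move=> fs xs.
have -> : (m * (n * 3 + 10) + 10 = 1 + (2 + (1 + (1 + (1 +
  (m * ((1 + (n * (1 + 2) + 2 + (2 + 3))) + 2) + 2 + 2))))))%N.
  have -> : (1 + (n * (1 + 2) + 2 + (2 + 3)) + 2 = n * 3 + 10)%N by lia.
  lia.
apply: (@terminates_seq _ _ _ _ _ _ _ _ (fun s' =>
  [/\ frame m n A e s', colored n x s' & arr s' 6 0 0 = ln (2 * m%:R / n%:R)])).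
  apply: terminates_rset => /=; rewrite (frame_m fs) (frame_n fs).
  by split => //; exact: frame_set_cell.
move=> {fs xs}s [fs xs h0].
apply: (@terminates_seq _ _ _ _ _ _ _ _ (fun s' =>
  [/\ frame m n A e s', colored n x s' & arr s' 6 0 0 = test_min])).
  apply: terminates_if => /=; rewrite h0 (frame_exponents fs) => le.
    by apply: terminates_skip => //; split => //; rewrite h0 /test_min le.
  apply: terminates_rset => /=; split => //; first exact: frame_set_cell.
  by rewrite (frame_exponents fs) /test_min (negbTE le).
move=> {fs xs h0}s [fs xs h0].
apply: (@terminates_seq _ _ _ _ _ _ _ _ (fun s' =>
  [/\ frame m n A e s', colored n x s', arr s' 6 0 0 = test_min &
      arr s' 6 0 1 = test_exponent])).
  apply: terminates_rset => /=; split => //; first exact: frame_set_cell.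
  by rewrite !(frame_exponents fs).
move=> {fs xs h0}s [fs xs h0 h1].
apply: (@terminates_seq _ _ _ _ _ _ _ _ (fun s' =>
  [/\ frame m n A e s', colored n x s', arr s' 6 0 1 = test_exponent &
      arr s' 6 0 2 = test_bound])).
  apply: terminates_rset => /=; split => //; first exact: frame_set_cell.
  by rewrite h0 h1 (frame_n fs).
move=> {fs xs h0 h1}s [fs xs h1 h2].
apply: (@terminates_seq _ _ _ _ _ _ _ _ (testing 0)).
  apply: terminates_rset => /=; split => //=; first exact: frame_set_cell.
  by rewrite big_nil.
move=> {fs xs h1 h2}s hs.
apply: (@terminates_seq _ _ _ _ _ _ _ _ (testing m)).
  apply: (@terminates_for _ _ _ _ _ _ _ _ m testing) => //.
  - by move: hs => [fs xs h1 h2 h3]; split => //=; exact: frame_set_var.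
  - by move=> i s' [fs' _ _ _ _]; exact: (frame_m fs').
move=> {hs}s [fs xs h1 h2 h3].
apply: terminates_if => /=; rewrite h3 -/accepted => acc.
  by apply: terminates_nset => /=; rewrite acc; split.
by apply: terminates_skip => //; rewrite (negbTE acc).
Qed.

End Spec.

(** The bound is positive, so the exponentials of logarithms are genuine powers. For q < +oo one has
    e >= 1/q > 0; e = 0 occurs only for q = +oo, where the test needs no logarithm of an entry. *)
Lemma acceptedP m n A e c x (p q : \bar R) : (2%:E <= p)%E -> (p <= q)%E ->
  (0 < n <= m)%N -> (0 < c)%N -> e 0%N = fine p^-1%E -> e 1%N = fine q^-1%E ->
  accepted m n A e c x =
    (rate_exponent p q * lp_norm q (\col_(i < m) row_sum n A x i) <=
     c%:R * Num.sqrt (fine (Order.min p (log_ratio m n)%:E)) * n%:R `^ rate_exponent p q).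
Proof.
move=> p2 pq nm c0 e0 e1; have q2 := le_trans p2 pq.
have [min0 _] := moment_le_rate p2 nm.
have /andP[n0 _] := nm; have n0' : 0 < n%:R :> R by rewrite ltr0n.
have [rp /andP[r0 _]] := rate_exponent_bounds p2 pq.
have /andP[pi0 pi1] := fine_inv_bounds p2.
have texp : test_exponent e = rate_exponent p q.
  by rewrite /test_exponent e0 e1 /rate_exponent; lra.
have tmin : test_min m n e = fine (Order.min p (log_ratio m n)%:E).
  rewrite /test_min e0 -/(log_ratio m n).
  case: p p2 pi0 pi1 {pq min0 e0 texp rp r0} => [s||]//; last first.
    have -> : fine (+oo^-1)%E = 0 :> R by rewrite invey.
    by rewrite minye mul0r ler01.
  rewrite lee_fin => s2 _ _; rewrite inver gt_eqF/=; last by lra.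
  rewrite mulrC ler_pdivrMr ?mul1r; last by lra.
  rewrite -EFin_min/= invrK.
  by case: (leP (log_ratio m n) s).
have tb : test_bound m n e c =
    c%:R * Num.sqrt (fine (Order.min p (log_ratio m n)%:E)) * n%:R `^ rate_exponent p q.
  rewrite /test_bound texp tmin; congr (_ * _ * _); last first.
    by rewrite /powR gt_eqF.
  by rewrite -powR12_sqrt ?(ltW min0)// /powR gt_eqF// mulrC.
rewrite -tb.
have tb0 : 0 < test_bound m n e c by rewrite /test_bound !mulr_gt0 ?expR_gt0 ?ltr0n.
rewrite /accepted big_mkord /test_term texp.
move: tb0; move: (test_bound _ _ _ _) => B B0.
have {}rp : fine q^-1%E <= rate_exponent p q by rewrite /rate_exponent; lra.
move: (rate_exponent p q) r0 rp => r r0 rp.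
set W := \col_i _.
have WE (i : 'I_m) : row_sum n A x i = W i 0 by rewrite mxE.
under eq_bigr do rewrite WE; rewrite e1.
move: W {WE} => W.
case: q q2 {pq texp tb e1} rp => [s||]//; last first.
  have -> : fine (+oo^-1)%E = 0 :> R by rewrite invey.
  rewrite lexx => _ _; apply/idP/idP => h.
    have hi i : `|W i 0| * r <= B.
      case: (leP (`|W i 0| * r) B) => // Bi; exfalso; move: h.
      rewrite leNgt (bigD1 i)//= leNgt Bi/= => /negP; apply.
      (* A single row over the bound contributes 2, more than the threshold 1. *)
      apply: (@lt_le_trans _ _ 2); first by rewrite ltr1n.
      by rewrite lerDl sumr_ge0// => k _; case: ifP.
    move: r0; rewrite le_eqVlt => /predU1P[<-|r0]; first by rewrite mul0r ltW.
    rewrite mulrC -ler_pdivlMr//; apply/lp_norm_le_y; first by rewrite divr_ge0// ltW.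
    by move=> i; rewrite ler_pdivlMr.
  rewrite big1 ?ler01// => i _; case: leP => //; rewrite ltNge => /negP[].
  apply: le_trans h; rewrite mulrC ler_wpM2l//.
  by move: i; apply/lp_norm_le_y; rewrite ?lp_norm_ge0.
rewrite lee_fin => s2; have s0 : 0 < s by lra.
rewrite inver gt_eqF//= => sr.
have {}r0 : 0 < r by rewrite (lt_le_trans _ sr)// invr_gt0.
have -> : (s^-1 <= 0) = false by rewrite leNgt invr_gt0 s0.
rewrite invrK.
have -> : \sum_(i < m) (if `|W i 0| <= 0 then 0
    else expR (ln (`|W i 0| * r / B) * s)) = (r / B) `^ s * \sum_(i < m) `|W i 0| `^ s.
  rewrite mulr_sumr; apply: eq_bigr => i _; rewrite normr_le0.
  have [->|Wi] := eqVneq (W i 0) 0; first by rewrite normr0 powR0 ?mulr0// gt_eqF.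
  have Wi0 : 0 < `|W i 0| by rewrite normr_gt0.
  rewrite -powRM ?divr_ge0 ?(ltW r0) ?(ltW B0)//.
  have -> : `|W i 0| * r / B = r / B * `|W i 0| by ring.
  rewrite /powR gt_eqF ?mulr_gt0 ?invr_gt0//=.
  by rewrite [ln _ * s]mulrC.
rewrite [X in X <= 1]mulrC -ler_pdivlMr ?powR_gt0 ?divr_gt0// mul1r.
rewrite [in RHS]mulrC -ler_pdivlMr// lp_norm_le_fin// ?divr_ge0 ?(ltW B0) ?(ltW r0)//.
congr (_ <= _); rewrite -powRN -mulN1r powRrM powR_inv1 ?divr_ge0 ?(ltW B0) ?(ltW r0)//.
by rewrite invf_div.
Qed.

End Acceptance.

(** * One round of Lovett-Meka sampling *)

Section LowerIntegral.
Context d (Y : measurableType d) (R : realType) (P : probability Y R).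

(** g may be nonmeasurable, so the exceptional null set is removed from f, and monotonicity
    everywhere applies. *)
Lemma ae_ge0_integral_mono (f g : Y -> \bar R) :
  measurable_fun setT f -> (forall y, 0 <= f y)%E -> (forall y, 0 <= g y)%E ->
  {ae P, forall y, (f y <= g y)%E} -> (\int[P]_y f y <= \int[P]_y g y)%E.
Proof.
move=> mf f0 g0 [N [mN N0 sub]].
have mfN : measurable_fun setT (f \_ (~` N)).
  by apply/(measurable_restrictT _ (measurableC mN)); exact: measurable_funS mf.
have fN0 y : (0 <= (f \_ (~` N)) y)%E by apply: erestrict_ge0.
have -> : (\int[P]_y f y = \int[P]_y (f \_ (~` N)) y)%E.
  apply: ge0_ae_eq_integral => //; exists N; split => // y /= h.
  apply: contrapT => yN; apply: h => _; rewrite patchE ifT//.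
  by rewrite inE.
apply: ge0_integral_mono => // y; rewrite patchE; case: ifPn => // yN.
apply: contrapT => h; move: yN; rewrite inE /= => yN; apply: yN.
exact: sub.
Qed.

(* f need not be measurable, hence the integral on the right is a lower integral
   and the expectation of a bound that can be negative is not available for f itself. *)
Lemma integral_lower_bound (f : Y -> \bar R) (Z : Y -> R) (beta c kappa b : R) :
  0 <= beta -> 0 <= kappa -> measurable_fun setT Z -> (forall y, 0 <= Z y) ->
  (\int[P]_y (Z y)%:E <= b%:E)%E -> (forall y, 0 <= f y)%E ->
  {ae P, forall y, ((Num.max beta (c - kappa * Z y))%:E <= f y)%E} ->
  ((Num.max beta (c - kappa * b))%:E <= \int[P]_y f y)%E.
Proof.
move=> beta0 kappa0 mZ Z0 Zb f0 fZ.
pose h y := Num.max beta (c - kappa * Z y).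
have mkZ : measurable_fun setT (fun y => kappa * Z y).
  by apply: measurable_funM => //; exact: measurable_cst.
have mh : measurable_fun setT h.
  apply: measurable_maxr; first exact: measurable_cst.
  by apply: measurable_funB => //; exact: measurable_cst.
have h0 y : 0 <= h y by rewrite le_max beta0.
have hf : (\int[P]_y (h y)%:E <= \int[P]_y f y)%E.
  apply: ae_ge0_integral_mono => //.
  by apply/measurable_EFinP.
have cstP (a : R) : (\int[P]_y (cst a%:E y) = a%:E)%E.
  by rewrite integral_cst//= probability_setT mule1.
have bh : (beta%:E <= \int[P]_y (h y)%:E)%E.
  rewrite -(cstP beta); apply: ge0_integral_mono => y; rewrite lee_fin//.
  by rewrite le_max lexx.
apply: le_trans hf; rewrite EFin_max ge_max bh/=.
(* For c < 0 the value c - kappa b is below beta; for c >= 0 one integrates c <= h + kappa Z, all of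
   whose terms are nonnegative. *)
have [c0|c0] := ltP c 0.
  apply: le_trans bh; rewrite lee_fin.
  have : 0 <= kappa * b.
    rewrite mulr_ge0// -lee_fin; apply: le_trans Zb.
    by apply: integral_ge0 => y _; rewrite lee_fin.
  lra.
have hc : (c%:E <= \int[P]_y (h y)%:E + kappa%:E * \int[P]_y (Z y)%:E)%E.
  rewrite -ge0_integralZl_EFin//; last 2 first.
  - by move=> y _; rewrite lee_fin.
  - by apply/measurable_EFinP.
  rewrite -ge0_integralD//; last 4 first.
  - by move=> y _; rewrite lee_fin.
  - by apply/measurable_EFinP.
  - by move=> y _; rewrite -EFinM lee_fin mulr_ge0.
  - by apply/measurable_EFinP.
  rewrite -(cstP c); apply: ge0_integral_mono => y; rewrite ?lee_fin//.
  by rewrite -lerBlDr /h le_max lexx orbT.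
have {}hc : (c%:E <= \int[P]_y (h y)%:E + (kappa * b)%:E)%E.
  apply: le_trans hc _; rewrite leeD2l// EFinM lee_wpmul2l// lee_fin//.
by rewrite EFinB leeBlDr.
Qed.

Lemma ae_imply (Q1 Q2 : Y -> Prop) : (forall y, Q1 y -> Q2 y) ->
  {ae P, forall y, Q1 y} -> {ae P, forall y, Q2 y}.
Proof.
move=> Q12 [N [mN N0 sub]]; exists N; split => // y nQ2; apply: sub => Q1y.
by apply: nQ2; exact: Q12.
Qed.

Lemma ae_conj (Q1 Q2 : Y -> Prop) :
  {ae P, forall y, Q1 y} -> {ae P, forall y, Q2 y} -> {ae P, forall y, Q1 y /\ Q2 y}.
Proof.
move=> [N [mN N0 sub]] [N' [mN' N0' sub']]; exists (N `|` N'); split.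
- exact: measurableU.
- by rewrite measureU0.
move=> y /not_andP[nQ|nQ]; [left; exact: sub|right; exact: sub'].
Qed.

End LowerIntegral.

Section LovettMekaStep.
Context {R : realType}.

Lemma lp_norm2_sq m (x : 'cV[R]_m) : lp_norm 2%:E x ^+ 2 = \sum_(i < m) x i 0 ^+ 2.
Proof.
rewrite /lp_norm -powR_mulrn ?powR_ge0// -powRrM mulVf ?pnatr_eq0// powRr1; last first.
  by apply: sumr_ge0 => i _; rewrite powR_ge0.
by apply: eq_bigr => i _; rewrite powR_mulrn// real_normK ?num_real.
Qed.

(** The infimum need not be attained; a factor 2 buys an actual s. *)
Lemma psi2_norm_witness d (Y : measurableType d) (P : probability Y R) (X : Y -> R) (b : R) :
  0 < b -> (psi2_norm P X <= b%:E)%E ->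
  exists s, [/\ 0 < s, s <= 2 * b &
    (\int[P]_w (expR (X w ^+ 2 / s ^+ 2))%:E <= 2%:E)%E].
Proof.
move=> b0 h; have : (psi2_norm P X < (2 * b)%:E)%E.
  by apply: le_lt_trans h _; rewrite lte_fin; lra.
move=> /ereal_inf_lt[_ [s [s0 hs] <-]]; rewrite lte_fin => sb.
by exists s; split => //; exact: ltW.
Qed.

(** Each summand secures one of the last three bounds of [lovett_meka_const_bounds]: two for the
    width condition, one for the moments. *)
Definition lovett_meka_const_sq (C1 C2 K : R) : R :=
  expR 2 / (2 * C1) + expR 2 / (2 * C1 * C2) + 2 * K ^+ 2 * expR 2.

Definition lovett_meka_const (C1 C2 K : R) : R :=
  Num.sqrt (lovett_meka_const_sq C1 C2 K).

Lemma lovett_meka_const_bounds (C1 C2 K : R) : 0 < C1 -> 0 < C2 -> 0 < K ->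
  let c := lovett_meka_const_sq C1 C2 K in
  [/\ 0 < c, expR 2 / (2 * C1 * c) <= 1, expR 2 / (2 * C1 * c) <= C2 &
      2 * K ^+ 2 * expR 2 / c <= 1].
Proof.
move=> C10 C20 K0 c; have e0 := expR_gt0 (2 : R).
have h1 : 0 < expR 2 / (2 * C1) by rewrite divr_gt0 ?mulr_gt0.
have h2 : 0 < expR 2 / (2 * C1 * C2) by rewrite divr_gt0 ?mulr_gt0.
have h3 : 0 < 2 * K ^+ 2 * expR 2 by rewrite !mulr_gt0 ?exprn_gt0.
have c0 : 0 < c by rewrite !addr_gt0.
have cE : c = expR 2 / (2 * C1) + expR 2 / (2 * C1 * C2) + 2 * K ^+ 2 * expR 2 by [].
move: c c0 cE => c c0 cE; split => //.
- have -> : expR 2 / (2 * C1 * c) = expR 2 / (2 * C1) / c by field; rewrite !gt_eqF.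
  by rewrite ler_pdivrMr// mul1r; lra.
- have -> : expR 2 / (2 * C1 * c) = C2 * (expR 2 / (2 * C1 * C2) / c).
    by field; rewrite !gt_eqF.
  rewrite -[leRHS]mulr1 ler_pM2l// ler_pdivrMr// mul1r; lra.
- by rewrite ler_pdivrMr// mul1r; lra.
Qed.

Lemma sum_powR_scaled (I : finType) (S : I -> R) (g l h t : R) : 1 <= g -> 0 < h -> 0 < l ->
  (forall i, 0 <= S i) ->
  \sum_i S i `^ g <= l * h `^ g -> 0 < t * h <= 1 -> 
  \sum_i (t * S i) `^ g <= l * (t * h).
Proof.
move=> g1 h0 l0 S0 hS th; have /andP[th0 th1] := th.
have t0 : 0 < t by rewrite -(pmulr_lgt0 _ h0).
have -> : \sum_i (t * S i) `^ g = t `^ g * \sum_i S i `^ g.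
  by rewrite mulr_sumr; apply: eq_bigr => i _; rewrite powRM ?(ltW t0).
apply: le_trans (ler_wpM2l (powR_ge0 _ _) hS) _.
rewrite mulrCA -powRM ?(ltW t0) ?(ltW h0)// ler_pM2l//.
by rewrite ge1r_powR.
Qed.

Variables (C1 C2 K : R).
Hypotheses (C10 : 0 < C1) (C20 : 0 < C2) (K0 : 0 < K).

Definition stage_width (p : \bar R) m l : R :=
  lovett_meka_const C1 C2 K * Num.sqrt (moment p m l) * l%:R `^ (2^-1 - fine p^-1%E).

Lemma stage_width_sq (p : \bar R) m l : (2%:E <= p)%E -> (0 < l)%N ->
  stage_width p m l ^+ 2 = lovett_meka_const_sq C1 C2 K * moment p m l *
    (l%:R `^ (2^-1 - fine p^-1%E)) ^+ 2 /\ 0 < stage_width p m l.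
Proof.
move=> p2 l0; have [c0 _ _ _] := lovett_meka_const_bounds C10 C20 K0.
have r0 : 0 < moment p m l by apply: lt_le_trans (moment_ge2 m p2 l).
rewrite /stage_width !exprMn !sqr_sqrtr ?(ltW c0) ?(ltW r0)//; split => //.
by rewrite !mulr_gt0 ?sqrtr_gt0 ?powR_gt0 ?ltr0n.
Qed.

Lemma stage_width_ok (p : \bar R) m l (A : 'M[R]_(m, l)) : (2%:E <= p)%E ->
  (0 < l <= m)%N -> (forall j, lp_ball p (col j A)) ->
  lm_width C1 C2 A (stage_width p m l).
Proof.
move=> p2 lm AP; have /andP[l0 _] := lm.
have [D2 D0] := stage_width_sq m p2 l0; split; first exact: ltW.
have [c0 th1 thC _] := lovett_meka_const_bounds C10 C20 K0.
have r2 := moment_ge2 m p2 l.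
have l0' : 0 < l%:R :> R by rewrite ltr0n.
have hS : \sum_(i < m) (\sum_(j < l) A i j ^+ 2) `^ (moment p m l / 2) <=
    l%:R * (expR 2 * (l%:R `^ (2^-1 - fine p^-1%E)) ^+ 2) `^ (moment p m l / 2).
  have := @sum_row_norms R p m 'I_l (fun i j => A i j) p2.
  rewrite card_ord => /(_ lm); apply => j.
  by have -> : \col_i A i j = col j A by apply/matrixP => i k; rewrite !mxE.
move: (moment p m l) r2 D2 hS => r r2 D2 hS.
have h0 : 0 < (l%:R `^ (2^-1 - fine p^-1%E) : R) ^+ 2 by rewrite exprn_gt0// powR_gt0.
move: (_ ^+ 2) h0 D2 hS => rho h0 D2 hS.
move: (lovett_meka_const_sq C1 C2 K) c0 th1 thC D2 => c c0 th1 thC D2.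
have t0 : 0 < (2 * C1 * c * rho)^-1 by rewrite invr_gt0 !mulr_gt0.
have := @sum_powR_scaled 'I_m (fun i => \sum_(j < l) A i j ^+ 2) (r / 2) l%:R
  (expR 2 * rho) (2 * C1 * c * rho)^-1.
have -> : (2 * C1 * c * rho)^-1 * (expR 2 * rho) = expR 2 / (2 * C1 * c).
  by field; rewrite !gt_eqF.
have r1 : 1 <= r / 2 by lra.
move=> /(_ r1); rewrite mulr_gt0 ?expR_gt0// => /(_ isT l0').
move=> /(_ (fun i => sumr_ge0 _ (fun j _ => sqr_ge0 _)) hS).
rewrite th1 divr_gt0 ?expR_gt0 ?mulr_gt0// => /(_ isT) hsum.
apply: (@le_trans _ _ (l%:R * (expR 2 / (2 * C1 * c)))); last first.
  by rewrite mulrC ler_pM2r.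
apply: le_trans hsum; rewrite big_mkcond/=; apply: ler_sum => i _.
case: ifPn => [Ai|_]; last exact: powR_ge0.
rewrite lp_norm2_sq D2.
have -> : \sum_(j < l) (row i A)^T j 0 ^+ 2 = \sum_(j < l) A i j ^+ 2.
  by apply: eq_bigr => j _; rewrite !mxE.
have S0 : 0 < \sum_(j < l) A i j ^+ 2.
  rewrite lt0r sumr_ge0 ?andbT => [|j _]; last exact: sqr_ge0.
  rewrite psumr_eq0 => [|j _]; last exact: sqr_ge0.
  apply: contra Ai => /allP h; apply/eqP/rowP => j; rewrite !mxE.
  by have := h j (mem_index_enum _); rewrite sqrf_eq0 => /eqP.
move: (\sum_(j < l) _) S0 => S S0.
have u0 : 0 < C1 * (c * r * rho) / S by rewrite divr_gt0 ?mulr_gt0//; lra.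
(* With u = C1 Delta^2/|A_i|^2 this gives exp(- u) <= (r/2)^(r/2) u^(-r/2); as Delta^2 is
   proportional to r, the factor r cancels and powers of row norms remain. *)
have := @powR_le_expR R _ (r / 2) (ltW u0) ltac:(lra).
rewrite expRN -[X in X <= _ -> _]invrK -powRN.
have -> : (C1 * (c * r * rho) / S) `^ (- (r / 2)) =
    ((2 * C1 * c * rho)^-1 * S) `^ (r / 2) * (r / 2)^-1 `^ (r / 2).
  have -> : (C1 * (c * r * rho) / S) `^ (- (r / 2)) =
      (C1 * (c * r * rho) / S)^-1 `^ (r / 2).
    by rewrite -[in RHS]powR_inv1 ?(ltW u0)// -powRrM mulN1r.
  rewrite -powRM ?mulr_ge0 ?(ltW t0) ?(ltW S0) ?invr_ge0//; last lra.
  by congr (_ `^ _); field; rewrite !gt_eqF//; lra.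
have g0 : 0 < r / 2 by lra.
have -> : (r / 2)^-1 `^ (r / 2) = ((r / 2) `^ (r / 2))^-1.
  by rewrite -powR_inv1 ?(ltW g0)// -powRrM mulN1r powRN.
have gg0 : 0 < (r / 2) `^ (r / 2) by rewrite powR_gt0.
set E := expR _; have E0 : 0 < E by rewrite expR_gt0.
set X := (_ * S) `^ _; have X0 : 0 < X by rewrite powR_gt0// mulr_gt0.
rewrite invfM invrK mulrC ler_pM2l// => h.
by rewrite -[X in _ <= X]invrK lef_pV2 ?posrE ?invr_gt0.
Qed.

End LovettMekaStep.

Section LovettMekaStep.
Context {R : realType}.

Lemma measurable_mulmx_tuple m l (A : 'M[R]_(m, l)) (x0 : 'cV[R]_l) (i : 'I_m) :
  measurable_fun setT
    (fun y : l.-tuple (measurableTypeR R) => (A *m (col_of_tuple y - x0)) i 0).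
Proof.
have -> : (fun y : l.-tuple (measurableTypeR R) => (A *m (col_of_tuple y - x0)) i 0) =
    (fun y => \sum_(j < l) A i j * (tnth y j - x0 j 0)).
  by apply/funext => y; rewrite mxE; apply: eq_bigr => j _; rewrite !mxE.
apply: measurable_sum => j; apply: measurable_funM; first exact: measurable_cst.
apply: measurable_funB; last exact: measurable_cst.
exact: measurable_tnth.
Qed.

(** Z is Delta l^(1/q) (1 + W), where W averages the exp(Y_i^2/s_i^2) with total weight at most 1.
    Its mean is at most 2 by subgaussianity, whence the 3. *)
Lemma lovett_meka_step (C1 C2 K : R) (p q : \bar R) m l (A : 'M[R]_(m, l))
    (x0 : 'cV[R]_l) (mu : law R l) : 0 < C1 -> 0 < C2 -> 0 < K ->
  (2%:E <= p)%E -> (p <= q)%E -> (0 < l <= m)%N -> (forall j, lp_ball p (col j A)) ->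
  lovett_meka C1 C2 K A x0 mu ->
  exists Z : l.-tuple (measurableTypeR R) -> R,
    [/\ measurable_fun setT Z, forall y, 0 <= Z y,
     (\int[mu]_y (Z y)%:E <=
        (3 * (stage_width C1 C2 K p m l * l%:R `^ fine q^-1%E))%:E)%E &
     {ae mu, forall y, lp_norm q (A *m (col_of_tuple y - x0)) <= Z y}].
Proof.
move=> C10 C20 K0 p2 pq lm AP lmk; have /andP[l0 _] := lm.
have [D2 D0] := stage_width_sq C10 C20 K0 m p2 l0.
have [c0 _ _ th] := lovett_meka_const_bounds C10 C20 K0.
have disc := lm_disc lmk (stage_width_ok C10 C20 K0 p2 lm AP).
have r2 := moment_ge2 m p2 l.
have rq : ((moment p m l)%:E <= q)%E by apply: le_trans pq; exact: moment_le.
have l0' : 0 < l%:R :> R by rewrite ltr0n.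
pose S (i : 'I_m) := \sum_(j < l) A i j ^+ 2.
have hS : \sum_(i < m) S i `^ (moment p m l / 2) <=
    l%:R * (expR 2 * (l%:R `^ (2^-1 - fine p^-1%E)) ^+ 2) `^ (moment p m l / 2).
  have := @sum_row_norms R p m 'I_l (fun i j => A i j) p2.
  rewrite card_ord => /(_ lm); apply => j.
  by have -> : \col_i A i j = col j A by apply/matrixP => i k; rewrite !mxE.
move: (stage_width C1 C2 K p m l) D2 D0 disc => D D2 D0 disc.
move: (moment p m l) r2 rq D2 hS => r r2 rq D2 hS.
have h0 : 0 < (l%:R `^ (2^-1 - fine p^-1%E) : R) ^+ 2 by rewrite exprn_gt0// powR_gt0.
move: (_ ^+ 2) h0 D2 hS => rho h0 D2 hS.
move: (lovett_meka_const_sq C1 C2 K) c0 th D2 => c c0 th D2.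
have S0 i : 0 <= S i by apply: sumr_ge0 => j _; exact: sqr_ge0.
have g1 : 1 <= r / 2 by lra.
have g0 : 0 < r / 2 by lra.
have r0 : 0 < r by lra.
pose Y (i : 'I_m) (y : l.-tuple (measurableTypeR R)) := (A *m (col_of_tuple y - x0)) i 0.
have psi i : exists s, S i != 0 -> [/\ 0 < s, s ^+ 2 <= 4 * K ^+ 2 * S i &
    (\int[mu]_y (expR (Y i y ^+ 2 / s ^+ 2))%:E <= 2%:E)%E].
  have [->|Si] := eqVneq (S i) 0; first by exists 0.
  have NS : lp_norm 2%:E (row i A)^T ^+ 2 = S i.
    by rewrite lp_norm2_sq; apply: eq_bigr => j _; rewrite !mxE.
  have N0 : 0 < lp_norm 2%:E (row i A)^T.
    rewrite lt0r lp_norm_ge0 andbT; apply: contra Si => /eqP N0.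
    by rewrite -NS N0 expr0n.
  have := lm_subgaussian lmk (row i A)^T.
  move=> /(psi2_norm_witness (mulr_gt0 K0 N0))[s [s0 sK sint]].
  have YE y : ((row i A)^T^T *m (col_of_tuple y - x0)) 0 0 = Y i y.
    by rewrite /Y trmxK -row_mul mxE.
  move: sint; under eq_integral do rewrite YE.
  move=> sint; exists s => _; split; [exact: s0| |exact: sint].
  rewrite -NS; have -> : 4 * K ^+ 2 * lp_norm 2%:E (row i A)^T ^+ 2 =
    (2 * (K * lp_norm 2%:E (row i A)^T)) ^+ 2 by ring.
  by rewrite ler_sqr ?nnegrE ?(ltW s0)//; apply: le_trans sK; exact: ltW.
have {psi}[s hs] := boolp.choice psi.
pose E i y := if S i == 0 then 0 else expR (Y i y ^+ 2 / s i ^+ 2).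
have E0 i y : 0 <= E i y by rewrite /E; case: ifP => // _; exact: expR_ge0.
(* One has |Y_i|^r <= s_i^r (r/2)^(r/2) exp(Y_i^2/s_i^2) and s_i^2 <= 4 K^2 S_i; dividing by Delta^r
   leaves this weight. *)
pose w i := (2 * K ^+ 2 / (c * rho) * S i) `^ (r / 2).
have w0 i : 0 <= w i by exact: powR_ge0.
have wsum : \sum_i w i <= l%:R.
  have := @sum_powR_scaled R 'I_m S (r / 2) l%:R (expR 2 * rho) (2 * K ^+ 2 / (c * rho))
    g1 _ l0' S0 hS.
  have -> : 2 * K ^+ 2 / (c * rho) * (expR 2 * rho) = 2 * K ^+ 2 * expR 2 / c.
    by field; rewrite !gt_eqF.
  rewrite mulr_gt0 ?expR_gt0// th andbT divr_gt0 ?mulr_gt0 ?expR_gt0 ?exprn_gt0//.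
  move=> /(_ isT isT) h; apply: (le_trans h).
  by rewrite -[leRHS]mulr1 ler_pM2l.
have mE i : measurable_fun setT (E i).
  rewrite /E; case: (S i == 0); first exact: measurable_cst.
  apply: measurableT_comp => //; apply: measurable_funM; last exact: measurable_cst.
  by apply: measurable_funX; exact: measurable_mulmx_tuple.
have intE i : (\int[mu]_y (E i y)%:E <= 2%:E)%E.
  rewrite /E; have [_|Si] := eqVneq (S i) 0; last by have [] := hs i Si.
  by rewrite integral0_eq.
pose W y := l%:R^-1 * \sum_i w i * E i y.
have W0 y : 0 <= W y.
  by rewrite mulr_ge0 ?invr_ge0//; apply: sumr_ge0 => i _; rewrite mulr_ge0.
have mW : measurable_fun setT W.
  apply: measurable_funM; first exact: measurable_cst.
  by apply: measurable_sum => i; apply: measurable_funM => //; exact: measurable_cst.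
have intW : (\int[mu]_y (W y)%:E <= 2%:E)%E.
  rewrite /W; under eq_integral do rewrite EFinM.
  have mS : measurable_fun setT (fun y => \sum_i w i * E i y).
    by apply: measurable_sum => i; apply: measurable_funM => //; exact: measurable_cst.
  have sum_ge0 y : 0 <= \sum_i w i * E i y.
    by apply: sumr_ge0 => i _; rewrite mulr_ge0.
  rewrite ge0_integralZl_EFin//.
  all: try solve [by rewrite invr_ge0 | exact/measurable_EFinP | by move=> y _; rewrite lee_fin].
  under eq_integral do rewrite -sumEFin.
  rewrite ge0_integral_sum//.
  all: try solve [by move=> i y _; rewrite lee_fin mulr_ge0
    | by move=> i; apply/measurable_EFinP; apply: measurable_funM => //; exact: measurable_cst].
  apply: (@le_trans _ _ (l%:R^-1%:E * \sum_(i < m) (w i * 2)%:E)%E).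
    rewrite lee_wpmul2l ?lee_fin ?invr_ge0//; apply: lee_sum => i _.
    under eq_integral do rewrite EFinM.
    rewrite ge0_integralZl_EFin//.
    all: try solve [exact/measurable_EFinP | by move=> y _; rewrite lee_fin].
    by rewrite EFinM lee_wpmul2l// lee_fin.
  rewrite sumEFin -EFinM lee_fin -mulr_suml mulrA ler_piMl//.
  by rewrite mulrC ler_pdivrMr// mul1r.
pose Z y := D * l%:R `^ fine q^-1%E * (1 + W y).
have B0 : 0 <= D * l%:R `^ fine q^-1%E by rewrite mulr_ge0 ?powR_ge0 ?(ltW D0).
exists Z; split.
- apply: measurable_funM; first exact: measurable_cst.
  by apply: measurable_funD => //; exact: measurable_cst.
- by move=> y; rewrite mulr_ge0// addr_ge0.
- rewrite /Z; under eq_integral do rewrite EFinM.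
  rewrite ge0_integralZl_EFin//.
  all: try solve [by move=> y _; rewrite lee_fin addr_ge0
    | by apply/measurable_EFinP; apply: measurable_funD => //; exact: measurable_cst].
  rewrite (mulrC 3) [leRHS]EFinM lee_wpmul2l ?lee_fin//.
  under eq_integral do rewrite EFinD.
  rewrite ge0_integralD//.
  all: try solve [exact/measurable_EFinP | by move=> y _; rewrite lee_fin].
  have -> : (3%:E = 1%:E + 2%:E :> \bar R)%E by rewrite -EFinD; congr EFin; lra.
  rewrite leeD// integral_cst//= mul1e; exact: probability_le1.
move: disc; apply: ae_imply => y disc.
have Yr i : `|Y i y| `^ r <= D `^ r * (w i * E i y).
  rewrite /E; case: ifPn => [/eqP Si|Si].
    have -> : Y i y = 0.
      rewrite /Y mxE big1// => j _.
      have /eqP := Si; rewrite psumr_eq0 => [|k _]; last exact: sqr_ge0.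
      by move=> /allP/(_ j (mem_index_enum _)); rewrite sqrf_eq0 => /eqP ->; rewrite mul0r.
    by rewrite normr0 powR0 ?gt_eqF// !mulr0.
  have [s0 sK _] := hs i Si.
  have sq0 : 0 < s i ^+ 2 by rewrite exprn_gt0.
  have powE z : 0 <= z -> z `^ r = (z ^+ 2) `^ (r / 2).
    by move=> z0; rewrite -powR_mulrn// -powRrM; congr (_ `^ _); field.
  rewrite !powE// ?(ltW D0)// real_normK ?num_real// D2 mulrA /w.
  have c1 : 0 <= c * r * rho by rewrite !mulr_ge0 ?(ltW c0) ?(ltW r0) ?(ltW h0).
  have c2 : 0 <= 2 * K ^+ 2 / (c * rho) * S i.
    rewrite mulr_ge0// divr_ge0//; first by rewrite mulr_ge0 ?sqr_ge0.
    by rewrite mulr_ge0 ?(ltW c0) ?(ltW h0).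
  have c3 : 0 <= 4 * K ^+ 2 * S i by rewrite mulr_ge0// mulr_ge0 ?sqr_ge0.
  rewrite -powRM//.
  have -> : c * r * rho * (2 * K ^+ 2 / (c * rho) * S i) = 4 * K ^+ 2 * S i * (r / 2).
    by field; rewrite !gt_eqF.
  rewrite [in leLHS](_ : Y i y ^+ 2 = s i ^+ 2 * (Y i y ^+ 2 / s i ^+ 2)); last first.
    by rewrite mulrC divfK ?gt_eqF.
  have u0 : 0 <= Y i y ^+ 2 / s i ^+ 2 by rewrite divr_ge0 ?sqr_ge0.
  rewrite [leLHS]powRM ?sqr_ge0// [(4 * _ * _ * _) `^ _]powRM ?(ltW g0)//.
  rewrite -mulrA ler_pM ?powR_ge0//; last first.
    exact: (powR_le_expR u0 g0).
  by rewrite ge0_ler_powR ?nnegrE ?sqr_ge0 ?(ltW g0).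
rewrite /Z; apply: (lp_norm_interpolation rq _ (ltW D0) l0' (W0 y)).
- by lra.
- by move: disc => /lp_norm_le_y; apply; exact: ltW.
rewrite /W (mulrA l%:R) mulfV ?gt_eqF// mul1r mulr_sumr.
by apply: ler_sum => i _; exact: Yr.
Qed.

End LovettMekaStep.

Lemma halving_le (l l' : nat) : (2 * l' <= l)%N -> (16 * l' <= 15 * l)%N.
Proof. lia. Qed.

(** * Analysis of the program *)

Section Merge.
Context {R : realType}.
Implicit Types (x y : nat -> R) (m n : nat) (A : nat -> nat -> R).

Lemma rank_sum (P : pred nat) n : (rank P n)%:R = \sum_(0 <= j < n | P j) 1 :> R.
Proof. by rewrite -(big_rank P n (fun=> 1 : R)) big_mkord sumr_const card_ord. Qed.

Lemma row_sum_merged n A x y i :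
  row_sum n A (merged x y) i - row_sum n A x i =
  \sum_(0 <= j < n | active (x j)) (y (rank (active \o x) j) - x j) * A i j.
Proof.
rewrite /row_sum -sumrB [RHS]big_mkcond/=; apply: eq_bigr => j _.
by rewrite -mulrBl /merged; case: ifP => // _; rewrite subrr mul0r.
Qed.

Lemma row_sum_gathered m n A x y s i l : gathered m n A x s -> (i < m)%N ->
  l = rank (active \o x) n ->
  row_sum n A (merged x y) i - row_sum n A x i =
  \sum_(0 <= t < l) (y t - arr s 4 0 t) * arr s 3 i t.
Proof.
move=> gs im ->; rewrite row_sum_merged.
rewrite (big_rank _ _ (fun t => (y t - arr s 4 0 t) * arr s 3 i t)).
rewrite big_mkcond [RHS]big_mkcond/=; apply: eq_big_nat => j /andP[_ jn].
by case: ifP => // xj; have [-> g2] := gs j jn xj; rewrite g2.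
Qed.

Lemma rank_merged n x y :
  (2 * \sum_(0 <= t < rank (active \o x) n) active (y t) <= rank (active \o x) n)%N ->
  (2 * rank (active \o merged x y) n <= rank (active \o x) n)%N.
Proof.
apply: leq_trans; rewrite leq_mul2l/=; rewrite -(ler_nat R) natr_sum rank_sum.
rewrite (big_rank (active \o x) n (fun t => (active (y t))%:R : R)).
rewrite [leLHS]big_mkcond [leRHS]big_mkcond/=; apply: ler_sum => j _.
rewrite /merged; have [xj|xj] := boolP (active (x j)); first by case: (active (y _)).
by rewrite (negbTE xj).
Qed.

Lemma rank0_signs n x : rank (active \o x) n = 0%N ->
  (forall j, (j < n)%N -> -1 <= x j <= 1) -> forall j, (j < n)%N -> x j = 1 \/ x j = -1.
Proof.
move=> r0 x1 j jn; have /andP[h1 h2] := x1 j jn.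
have : ~~ active (x j).
  apply/negP => xj; have : (rank (active \o x) j < rank (active \o x) n)%N by apply: rank_lt.
  by rewrite r0.
rewrite /active negb_and !negbK => /orP[h|h]; [left|right]; apply/le_anti/andP; split => //.
Qed.

Lemma active_half l (y : l.-tuple R) :
  (l <= 2 * #|[set j : 'I_l | ((tnth y j == 1) || (tnth y j == -1))%R]%SET|)%N ->
  (2 * \sum_(0 <= t < l) active (nth 0%R y t) <= l)%N.
Proof.
set F := [set j | _]%SET => lF.
have : (\sum_(0 <= t < l) active (nth 0%R y t) + #|F| <= l)%N.
  rewrite big_mkord -sum1_card [X in (_ + X)%N]big_mkcond/= -big_split/=.
  rewrite -[leqRHS]card_ord -sum1_card; apply: leq_sum => j _.
  rewrite inE (tnth_nth 0%R) /active; case: eqVneq => [->|_].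
    by rewrite lexx.
  by case: eqVneq => [->|_]; rewrite ?lexx ?andbF//=; case: (_ && _).
lia.
Qed.

End Merge.

Section Rounds.
Context {R : realType}.
Variables (D : sampler R) (T : nat -> nat -> nat) (C1 C2 K : R).
Hypotheses (C10 : 0 < C1) (C20 : 0 < C2) (K0 : 0 < K).
Hypotheses (lmD : lovett_meka_sampler C1 C2 K D) (timeT : sampling_time T).
Variables (m n : nat) (p q : \bar R) (v : 'I_n -> 'cV[R]_m).
Hypotheses (n0 : (0 < n)%N) (nm : (n <= m)%N) (p2 : (2%:E <= p)%E) (pq : (p <= q)%E).
Variables (A : nat -> nat -> R) (e : nat -> R).
Hypothesis (Av : forall (i : 'I_m) (j : 'I_n), A i j = v j i 0).
Hypothesis (vP : forall j, lp_ball p (v j)).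

(** The factor e keeps the comparison with the bound meaningful at e = 0. *)
Definition imbalance x : R :=
  rate_exponent p q * lp_norm q (\col_(i < m) row_sum n A x i).

(* The geometric series of the bounds for the remaining rounds, in closed form. *)
Definition potential (l : nat) : R :=
  32 * (6 * lovett_meka_const C1 C2 K) * top_scale p q m n *
    l%:R `^ (rate_exponent p q / 2).

Lemma imbalance_ge0 x : 0 <= imbalance x.
Proof.
have [_ /andP[e0 _]] := rate_exponent_bounds p2 pq.
by rewrite mulr_ge0 ?lp_norm_ge0.
Qed.

(** The 6 in [potential] is the 3 of [lovett_meka_step] times the 2 of [stage_le]. *)
Lemma potential_stage l l' : (0 < l <= n)%N -> (2 * l' <= l)%N ->
  rate_exponent p q * (3 * (stage_width C1 C2 K p m l * l%:R `^ fine q^-1%E)) +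
    potential l' <= potential l.
Proof.
move=> ln l'l; have [_ e01] := rate_exponent_bounds p2 pq.
have /andP[e0 _] := e01; have /andP[l0 _] := ln.
have l0' : 0 < l%:R :> R by rewrite ltr0n.
have X0 := top_scale_ge0 p q m n.
have c0 : 0 <= lovett_meka_const C1 C2 K by exact: sqrtr_ge0.
have hs := stage_le p2 pq ln nm.
have := @potential_step R (rate_exponent p q) (6 * lovett_meka_const C1 C2 K)
  (top_scale p q m n) l l' e01 _ _.
rewrite !mulr_ge0// => /(_ isT).
have -> : 16 * l'%:R <= 15 * l%:R :> R.
  by rewrite -!natrM ler_nat halving_le.
move=> /(_ isT); apply: le_trans.
rewrite /potential lerD2r ler_wpM2l//.
have -> : stage_width C1 C2 K p m l * l%:R `^ fine q^-1%E =
    lovett_meka_const C1 C2 K * (Num.sqrt (moment p m l) * l%:R `^ rate_exponent p q).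
  rewrite /stage_width /rate_exponent (@powRD _ _ _ (fine q^-1%E)) ?(gt_eqF l0') ?implybT//.
  ring.
have := ler_wpM2l c0 hs; lra.
Qed.

(* One round in expectation: the increase of the imbalance is paid for by the drop
   of the potential, since the number of active columns is at least halved. *)
Lemma round_integral k l x s (F : state R -> \bar R) (beta alpha kappa : R) :
  k = m -> l = rank (active \o x) n -> (0 < l)%N ->
  frame m n A e s -> colored n x s -> gathered m n A x s ->
  (forall j, (j < n)%N -> -1 <= x j <= 1) ->
  0 <= beta -> 0 <= kappa -> (forall s', (0 <= F s')%E) ->
  (forall y : l.-tuple R,
     (forall j, (j < n)%N -> -1 <= merged x (nth 0%R y) j <= 1) ->
     (2 * rank (active \o merged x (nth 0%R y)) n <= l)%N ->
     ((Num.max beta (alpha - kappa * (imbalance (merged x (nth 0%R y)) +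
        potential (rank (active \o merged x (nth 0%R y)) n))))%:E <= F (set_row s 5 y))%E) ->
  ((Num.max beta (alpha - kappa * (imbalance x + potential l)))%:E <=
    \int[D (\matrix_(i < k, j < l) arr s 3 i j) (\col_(j < l) arr s 4 0 j)]_y
      F (set_row s 5 y))%E.
Proof.
move=> -> {k} lE l0 fs xs gs x1 beta0 kappa0 F0 FF.
have [_ /andP[e0 _]] := rate_exponent_bounds p2 pq.
have m0 : (0 < m)%N by apply: leq_trans nm.
have ln : (l <= n)%N.
  rewrite lE -(ler_nat R) rank_sum big_mkcond big_mkord.
  rewrite -[in leRHS](card_ord n) -sum1_card natr_sum; apply: ler_sum => i _.
  by case: ifP => //; rewrite ler01.
have surj t : (t < l)%N -> exists2 j, (j < n)%N && active (x j) & rank (active \o x) j = t.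
  by rewrite lE => /rank_surj.
set M := \matrix_(i, j) _; set x0 := \col_j _.
have MP j : lp_ball p (col j M).
  have [j' /andP[j'n xj'] j'E] := surj j (ltn_ord j).
  have -> : col j M = v (Ordinal j'n); last exact: vP.
  apply/matrixP => i i'; rewrite (ord1 i') !mxE -j'E.
  by have [_ ->] := gs j' j'n xj'; rewrite // -Av.
have x01 j : -1 <= x0 j 0 <= 1.
  have [j' /andP[j'n xj'] j'E] := surj j (ltn_ord j).
  by rewrite mxE -j'E; have [-> _] := gs j' j'n xj'; exact: x1.
have lmk := lmD M m0 l0 x01.
have lm : (0 < l <= m)%N by rewrite l0 (leq_trans ln).
have [Z [mZ Z0 intZ MZ]] := lovett_meka_step C10 C20 K0 p2 pq lm MP lmk.
set bZ := 3 * _ in intZ.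
have ekappa : 0 <= kappa * rate_exponent p q by rewrite mulr_ge0.
(* The constant anticipates the mean: subtracting kappa e bZ from it gives the claim, and pointwise
   the drop of the potential supplies e bZ. *)
apply: le_trans (integral_lower_bound (beta := beta) (b := bZ)
  (c := alpha - kappa * (imbalance x + (potential l - rate_exponent p q * bZ)))
  beta0 ekappa mZ Z0 intZ _ _) => //.
  rewrite lee_fin; rewrite le_eqVlt; apply/orP; left; apply/eqP; congr (Num.max _ _).
  ring.
have := ae_conj (ae_conj (lm_cube lmk) (lm_half lmk)) MZ.
apply: ae_imply => y [[cube half] yZ].
have merged1 j : (j < n)%N -> -1 <= merged x (nth 0%R y) j <= 1.
  move=> jn; rewrite /merged; case: ifP => [xj|_]; last exact: x1.
  have rj : (rank (active \o x) j < l)%N by rewrite lE; apply: rank_lt.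
  by have := cube (Ordinal rj); rewrite (tnth_nth 0).
have rank_half : (2 * rank (active \o merged x (nth 0%R y)) n <= l)%N.
  rewrite [leqRHS]lE; apply: rank_merged; rewrite -lE.
  exact: active_half.
apply: le_trans (FF y merged1 rank_half); rewrite lee_fin.
rewrite ge_max le_max lexx/= le_max; apply/orP; right.
rewrite lerBrDr -lerBrDl.
have Phi : potential (rank (active \o merged x (nth 0%R y)) n) <=
    potential l - rate_exponent p q * bZ.
  by rewrite lerBrDl; apply: potential_stage rank_half; rewrite l0.
have imb : imbalance (merged x (nth 0%R y)) <= imbalance x + rate_exponent p q * Z y.
  rewrite /imbalance -mulrDr ler_wpM2l//.
  have -> : \col_(i < m) row_sum n A (merged x (nth 0%R y)) i =
      \col_(i < m) row_sum n A x i + M *m (col_of_tuple y - x0).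
    apply/matrixP => i j; rewrite !mxE.
    apply/eqP; rewrite addrC -subr_eq; apply/eqP.
    rewrite (row_sum_gathered _ gs (ltn_ord i) lE).
    rewrite big_mkord; apply: eq_bigr => t _.
    by rewrite !mxE (tnth_nth 0%R) mulrC.
  apply: le_trans (lp_norm_triangle _ _ _) _; last by rewrite lerD2l.
  by apply: le_trans (le_trans p2 pq); rewrite lee_fin; lra.
have := ler_wpM2l kappa0 (lerD imb Phi); lra.
Qed.

End Rounds.

Section Balance.
Context {R : realType}.
Variables (D : sampler R) (T : nat -> nat -> nat) (C1 C2 K : R).
Hypotheses (C10 : 0 < C1) (C20 : 0 < C2) (K0 : 0 < K).
Hypotheses (lmD : lovett_meka_sampler C1 C2 K D) (timeT : sampling_time T).
Variables (m n : nat) (p q : \bar R) (v : 'I_n -> 'cV[R]_m).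
Hypotheses (n0 : (0 < n)%N) (nm : (n <= m)%N) (p2 : (2%:E <= p)%E) (pq : (p <= q)%E).
Variables (A : nat -> nat -> R) (e : nat -> R).
Hypothesis (Av : forall (i : 'I_m) (j : 'I_n), A i j = v j i 0).
Hypothesis (vP : forall j, lp_ball p (v j)).
Hypotheses (e0E : e 0%N = fine p^-1%E) (e1E : e 1%N = fine q^-1%E).

Local Notation imb := (imbalance m n p q A).
Local Notation pot := (potential C1 C2 K m n p q).

Lemma potential_ge0 l : 0 <= potential C1 C2 K m n p q l.
Proof. by rewrite !mulr_ge0 ?powR_ge0 ?sqrtr_ge0. Qed.

Definition round_time : nat :=
  (1 + ((1 + (n * (m * 3 + 7) + 2)) + ((T m n).+1 + (2 + (n * 7 + 2)))))%N.

(** A supermartingale argument run backwards: the imbalance plus the potential does not increase in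
    mean, and beta is guaranteed in any case. Halving bounds the number of rounds by k; the extra
    unit pays for the failing guard. *)
Lemma rounds_lower k x s b b0 (f : continuation R) (beta alpha kappa : R) :
  frame m n A e s -> colored n x s -> var s 6 = rank (active \o x) n ->
  (forall j, (j < n)%N -> -1 <= x j <= 1) ->
  (rank (active \o x) n < 2 ^ k)%N ->
  0 <= beta -> 0 <= kappa -> (forall b' s', (0 <= f b' s')%E) ->
  (forall b' s' x', (b0 <= b')%N -> frame m n A e s' -> colored n x' s' ->
     (forall j, (j < n)%N -> x' j = 1 \/ x' j = -1) ->
     ((Num.max beta (alpha - kappa * imb x'))%:E <= f b' s')%E) ->
  (b0 + 1 + k * round_time <= b)%N ->
  ((Num.max beta (alpha - kappa * (imb x + pot (rank (active \o x) n))))%:E <=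
    run D T rounds_prog f b s)%E.
Proof.
move=> fs xs s6 x1 rk beta0 kappa0 f0 ff.
have done_case x' s' b' : frame m n A e s' -> colored n x' s' ->
    var s' 6 = rank (active \o x') n -> (forall j, (j < n)%N -> -1 <= x' j <= 1) ->
    rank (active \o x') n = 0%N -> (b0 <= b')%N ->
    ((Num.max beta (alpha - kappa * (imb x' + pot (rank (active \o x') n))))%:E <=
    run D T rounds_prog f b'.+1 s')%E.
  move=> fs' xs' s6' x1' r0 bb.
  rewrite run_while_false; last by rewrite /= s6' r0.
  apply: le_trans (ff b' s' x' bb fs' xs' (rank0_signs r0 x1')).
  rewrite lee_fin ge_max le_max lexx/= le_max; apply/orP; right.
  by rewrite lerD2l lerN2 ler_wpM2l// lerDl potential_ge0.
elim: k x s b fs xs s6 x1 rk => [|k IH] x s b fs xs s6 x1 rk bb.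
  case: b bb => [|b bb]; first by rewrite addn1.
  apply: done_case => //; first by apply/eqP; rewrite -leqn0 -ltnS.
  by move: bb; rewrite mul0n addn0 addn1.
case: b bb => [|b bb]; first by rewrite addn1.
have bb' : (b0 + k.+1 * round_time <= b)%N by move: bb; rewrite addn1.
have [r0|r0] := posnP (rank (active \o x) n).
  by apply: done_case => //; apply: leq_trans bb'; exact: leq_addr.
rewrite run_while_true; last by rewrite /= s6.
set g := run D T _ f.
have [s1 [k1 [k1t [fs1 xs1 s15 gs1] h1]]] := gather_spec D T fs xs.
have bt : (b0 + 1 + k * round_time + k1 + ((T m n).+1 + (2 + (n * 7 + 2))) <= b)%N.
  apply: leq_trans bb'; rewrite mulSn; move: k1t; rewrite {2}/round_time.
  move: (k * round_time)%N (T m n) (n * 7)%N (n * (m * 3 + 7))%N; clear; lia.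
have -> : run D T round_prog g b s = run D T gather_prog
  (run D T (Seq (Sample 3 4 5 (NVar 0) (NVar 5)) scatter_prog) g) b s by [].
have bE : b = (k1 + (b - k1))%N.
  by rewrite subnKC//; apply: leq_trans bt; rewrite -addnA addnC -addnA leq_addr.
rewrite bE h1.
have rn : (rank (active \o x) n <= n)%N.
  rewrite -(ler_nat R) rank_sum big_mkcond big_mkord.
  rewrite -[in leRHS](card_ord n) -sum1_card natr_sum; apply: ler_sum => i _.
  by case: ifP => //; rewrite ler01.
have [Tmono _] := timeT.
have Tle : (T (var s1 0) (var s1 5) <= T m n)%N.
  by rewrite (frame_m fs1) s15; apply: Tmono; rewrite ?r0 ?rn ?leqnn ?(leq_trans n0 nm).
have Tb : (T (var s1 0) (var s1 5) < b - k1)%N.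
  move: bt Tle; move: (T _ _) (T m n) (k * _)%N (n * 7)%N; clear; lia.
have -> : run D T (Seq (Sample 3 4 5 (NVar 0) (NVar 5)) scatter_prog) g (b - k1) s1 =
  run D T (Sample 3 4 5 (NVar 0) (NVar 5)) (run D T scatter_prog g) (b - k1) s1 by [].
rewrite (@run_sample _ D T 3 4 5 (NVar 0) (NVar 5) _ _ s1 Tb).
set b1 := (b - k1 - _)%N.
have b1t : (b0 + 1 + k * round_time + (2 + (n * 7 + 2)) <= b1)%N.
  rewrite /b1 /=; move: bt Tle; move: (T _ _) (T m n) (k * _)%N (n * 7)%N; clear; lia.
rewrite -s15.
apply: (round_integral C10 C20 K0 lmD n0 nm p2 pq Av vP (F := run D T scatter_prog g b1)
  (frame_m fs1) s15 _ fs1 xs1 gs1 x1 beta0 kappa0) => //.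
- by rewrite /= s15.
- by move=> s'; apply: run_ge0 => *; apply: run_ge0.
move=> y y1 yh.
have fs2 : frame m n A e (set_row s1 5 y) by exact: frame_set_row.
have [|s2 [k2 [k2t [fs3 xs3 s36] h2]]] := @scatter_spec _ D T m n A e
  (set_row s1 5 y) x (nth 0%R y) fs2 xs1.
  by move=> t; rewrite -s15 /= => ->.
have b2E : b1 = (k2 + (b1 - k2))%N.
  by rewrite subnKC//; apply: leq_trans k2t _; apply: leq_trans b1t; exact: leq_addl.
rewrite [in X in (_ <= X)%E]b2E h2; apply: IH => //.
- move: (leq_trans yh (eq_leq s15)) rk; rewrite expnS.
  by move: (rank _ n) (rank _ n) (2 ^ k)%N; clear; lia.
- by move: b1t k2t; move: (k * _)%N (n * 7)%N; clear; lia.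
Qed.

End Balance.

(** Blocks of tau equal terms, each block half the preceding one. *)
Lemma sum_halves_le (R : realFieldType) tau N : (0 < tau)%N ->
  \sum_(0 <= t < N) (2^-1 ^+ (t %/ tau) : R) <= (2 * tau)%:R.
Proof.
move=> tau0.
have h0 (t : nat) : 0 <= 2^-1 ^+ (t %/ tau) :> R by rewrite exprn_ge0.
have geo M : \sum_(0 <= t < M * tau) (2^-1 ^+ (t %/ tau) : R) =
    tau%:R * (2 - 2 * 2^-1 ^+ M).
  elim: M => [|M IH]; first by rewrite mul0n big_nil expr0; ring.
  rewrite mulSn addnC (big_cat_nat (leq0n _) (leq_addr _ _))/= IH.
  have -> : \sum_(M * tau <= t < M * tau + tau) (2^-1 ^+ (t %/ tau) : R) =
      tau%:R * 2^-1 ^+ M.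
    transitivity (\sum_(M * tau <= t < M * tau + tau) (2^-1 ^+ M : R)).
      apply: eq_big_nat => t /andP[t1 t2]; congr (_ ^+ _).
      have -> : t = (M * tau + (t - M * tau))%N by rewrite subnKC.
      by rewrite divnMDl// divn_small ?addn0// ltn_subLR.
    by rewrite sumr_const_nat addKn mulr_natl.
  by rewrite exprS; field.
apply: (@le_trans _ _ (\sum_(0 <= t < N * tau) (2^-1 ^+ (t %/ tau) : R))).
  rewrite [leRHS](@big_cat_nat _ _ _ N)//= ?leq_pmulr// lerDl.
  by apply: sumr_ge0 => t _; exact: h0.
rewrite geo natrM mulrC ler_pM2r ?ltr0n// gerBl.
by rewrite mulr_ge0// exprn_ge0.
Qed.

(** * Attempts, restarts and the expected time *)

Section Balance.
Context {R : realType}.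
Variables (D : sampler R) (T : nat -> nat -> nat) (C1 C2 K : R).
Hypotheses (C10 : 0 < C1) (C20 : 0 < C2) (K0 : 0 < K).
Hypotheses (lmD : lovett_meka_sampler C1 C2 K D) (timeT : sampling_time T).
Variables (m n : nat) (p q : \bar R) (v : 'I_n -> 'cV[R]_m).
Hypotheses (n0 : (0 < n)%N) (nm : (n <= m)%N) (p2 : (2%:E <= p)%E) (pq : (p <= q)%E).
Variables (A : nat -> nat -> R) (e : nat -> R).
Hypothesis (Av : forall (i : 'I_m) (j : 'I_n), A i j = v j i 0).
Hypothesis (vP : forall j, lp_ball p (v j)).
Hypotheses (e0E : e 0%N = fine p^-1%E) (e1E : e 1%N = fine q^-1%E).
Variables (c : nat) (C : R).
Hypotheses (cC : c%:R <= C) (c0 : 64 * (12 * lovett_meka_const C1 C2 K) <= c%:R) (cgt0 : (0 < c)%N).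

Local Notation imb := (imbalance m n p q A).
Local Notation good := [set s | good_coloring C p q v (output n s)].

Let bound : R :=
  c%:R * Num.sqrt (fine (Order.min p (log_ratio m n)%:E)) * n%:R `^ rate_exponent p q.

Let nm' : (0 < n <= m)%N. Proof. by rewrite n0. Qed.

Lemma bound_gt0 : 0 < bound.
Proof.
have [min0 _] := moment_le_rate p2 nm'.
by rewrite /bound !mulr_gt0 ?sqrtr_gt0 ?powR_gt0 ?ltr0n.
Qed.

(** The margin for Markov's inequality. The constant 64 times 12 is 2 for the margin, 32 times 6
    from [potential] and 2 from [top_scale_le_rate]. *)
Lemma potential_le_bound : 2 * potential C1 C2 K m n p q n <= bound.
Proof.
have h := top_scale_le_rate q p2 nm'.
have L0 : 0 <= 64 * (6 * lovett_meka_const C1 C2 K) by rewrite !mulr_ge0 ?sqrtr_ge0.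
apply: le_trans (_ : 64 * (6 * lovett_meka_const C1 C2 K) * (top_scale p q m n *
  n%:R `^ (rate_exponent p q / 2)) <= _).
  by rewrite le_eqVlt; apply/orP; left; apply/eqP; rewrite /potential; ring.
apply: le_trans (ler_wpM2l L0 h) _; rewrite /bound.
have S0 := sqrtr_ge0 (fine (Order.min p (log_ratio m n)%:E)).
move: (Num.sqrt _) S0 => S S0.
have N0 : 0 <= n%:R `^ rate_exponent p q :> R by exact: powR_ge0.
move: (_ `^ rate_exponent p q) N0 => N N0.
have -> : 64 * (6 * lovett_meka_const C1 C2 K) * (2 * S * N) =
  64 * (12 * lovett_meka_const C1 C2 K) * (S * N) by ring.
by rewrite -[leRHS]mulrA ler_wpM2r// mulr_ge0.
Qed.

Lemma good_of_accepted x s : colored n x s ->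
  (forall j, (j < n)%N -> x j = 1 \/ x j = -1) -> imb x <= bound -> good s.
Proof.
move=> xs x1 hx; split.
  by move=> j; rewrite mxE xs//; exact: x1.
apply: vb_rate_bound => //; first by apply: lt_le_trans cC; rewrite ltr0n.
have -> : signed_sum v (output n s) = \col_(i < m) row_sum n A x i.
  apply/matrixP => i j; rewrite (ord1 j) !mxE summxE /row_sum big_mkord.
  by apply: eq_bigr => k _; rewrite !mxE xs// Av.
apply: (le_trans hx); rewrite /bound -!mulrA ler_wpM2r//.
Qed.

Definition attempt_time (k : nat) : nat :=
  ((n * 3 + 3) + (1 + k * round_time T m n) + (m * (n * 3 + 10) + 10))%N.

(** alpha is the value of an acceptance, beta that of a rejection. For kappa = (alpha - beta)/bound,
    alpha - kappa imb is at most alpha always and at most beta on rejection; at the start, where the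
    imbalance is 0 and the potential at most bound/2, the estimate is at least (alpha + beta)/2. *)
Lemma attempt_lower k s b b0 (f : continuation R) (beta alpha : R) :
  (n < 2 ^ k)%N -> frame m n A e s ->
  0 <= beta -> beta <= alpha -> (forall b' s', (0 <= f b' s')%E) ->
  (forall b' s', (b0 <= b')%N -> var s' 2 = 1%N -> good s' -> (alpha%:E <= f b' s')%E) ->
  (forall b' s', (b0 <= b')%N -> frame m n A e s' -> (beta%:E <= f b' s')%E) ->
  (b0 + attempt_time k <= b)%N ->
  (((alpha + beta) / 2)%:E <=
    run D T (Seq init_prog (Seq rounds_prog (test_prog c))) f b s)%E.
Proof.
move=> nk fs beta0 ba f0 fgood fbad bb.
have B0 := bound_gt0.
have [s1 [k1 [k1t [fs1 xs1 s16] h1]]] := init_spec D T fs.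
have -> : run D T (Seq init_prog (Seq rounds_prog (test_prog c))) f b s =
  run D T init_prog (run D T (Seq rounds_prog (test_prog c)) f) b s by [].
have bE : b = (k1 + (b - k1))%N.
  rewrite subnKC//; apply: leq_trans bb; rewrite /attempt_time addnC -!addnA.
  by apply: leq_trans k1t _; rewrite addnA leq_addr.
rewrite bE h1.
have -> : run D T (Seq rounds_prog (test_prog c)) f (b - k1) s1 =
  run D T rounds_prog (run D T (test_prog c) f) (b - k1) s1 by [].
have act0 j : (active \o (fun=> 0 : R)) j.
  by rewrite /active /= -!ltNge oppr_lt0 ltr01.
have rn : rank (active \o (fun=> 0 : R)) n = n.
  exact: rank_all.
have kappa0 : 0 <= (alpha - beta) / bound by rewrite divr_ge0 ?subr_ge0// ltW.
have := @rounds_lower R D T C1 C2 K C10 C20 K0 lmD timeT m n p q v n0 nm p2 pq A e Av vP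
  k (fun=> 0) s1 (b - k1) (b0 + (m * (n * 3 + 10) + 10)) (run D T (test_prog c) f)
  beta alpha ((alpha - beta) / bound) fs1 xs1.
rewrite rn => /(_ s16).
have x1 j : (j < n)%N -> -1 <= (0 : R) <= 1 by rewrite lerN10 ler01.
move=> /(_ x1 nk beta0 kappa0).
have tf0 b' s' : (0 <= run D T (test_prog c) f b' s')%E by exact: run_ge0.
move=> /(_ tf0) lower; apply: le_trans (lower _ _).
- rewrite lee_fin le_max; apply/orP; right.
  have -> : imb (fun=> 0) = 0.
    rewrite /imbalance.
    have -> : \col_(i < m) row_sum n A (fun=> 0) i = 0.
      by apply/matrixP => i j; rewrite !mxE /row_sum big1// => k' _; rewrite mul0r.
    by rewrite lp_norm0 ?mulr0//; apply: lt_le_trans (le_trans p2 pq); rewrite lte_fin.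
  have h2 : potential C1 C2 K m n p q n / bound <= 2^-1.
    by rewrite ler_pdivrMr//; have := potential_le_bound; lra.
  have ab : 0 <= alpha - beta by lra.
  have := ler_wpM2l ab h2; rewrite add0r; set Phi := potential _ _ _ _ _ _ _ _.
  rewrite mulrA [(alpha - beta) / bound * Phi]mulrAC; lra.
- move=> b' s' x' bb' fs' xs' x'1.
  have [s2 [k2 [k2t [xs2 acc] h2]]] := test_spec D T c fs' xs'.
  have b'E : b' = (k2 + (b' - k2))%N.
    by rewrite subnKC//; apply: leq_trans k2t _; apply: leq_trans bb'; exact: leq_addl.
  rewrite b'E h2.
  have b2 : (b0 <= b' - k2)%N by move: bb' k2t; move: (m * _)%N; clear; lia.
  have imb0 : 0 <= imb x' by exact: imbalance_ge0.
  move: acc; rewrite (acceptedP _ _ p2 pq nm' cgt0 e0E e1E).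
  have -> : (rate_exponent p q * lp_norm q (\col_(i < m) row_sum n A x' i) <=
     c%:R * Num.sqrt (fine (Order.min p (log_ratio m n)%:E)) * n%:R `^ rate_exponent p q) =
     (imb x' <= bound) by [].
  case: ifPn => [le s22|nle fs2].
    apply: le_trans (fgood _ s2 b2 s22 (good_of_accepted xs2 x'1 le)).
    by rewrite lee_fin ge_max ba/= gerBl mulr_ge0.
  apply: le_trans (fbad _ s2 b2 fs2).
  rewrite lee_fin ge_max lexx/=.
  have h3 : 1 <= imb x' / bound by rewrite ler_pdivlMr// mul1r ltW// ltNge.
  have ab : 0 <= alpha - beta by lra.
  have := ler_wpM2l ab h3; rewrite mulr1 mulrA [(alpha - beta) / bound * imb x']mulrAC; lra.
- move: bb k1t; rewrite /attempt_time.
  by move: (k * _)%N (m * _)%N; clear; lia.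
Qed.

(** Each restart halves the probability of failure: [attempt_lower] with alpha = 1 and beta the
    bound for the remaining attempts. *)
Lemma balance_lower k j s b : (n < 2 ^ k)%N -> frame m n A e s ->
  (j * (attempt_time k).+1 + 1 <= b)%N ->
  ((1 - 2^-1 ^+ j)%:E <= run D T (balance_prog c) (fun _ s' => (\1_good s')%:E) b s)%E.
Proof.
move=> nk; elim: j s b => [|j IH] s b fs bb.
  rewrite expr0 subrr; apply: run_ge0 => b' s'.
  by rewrite lee_fin.
case: b bb => [|b bb]; first by rewrite addn1.
rewrite run_while_true; last by rewrite /= (frame_flag fs).
have -> : 1 - 2^-1 ^+ j.+1 = (1 + (1 - 2^-1 ^+ j)) / 2 :> R by rewrite exprS; field.
have p1 : 2^-1 ^+ j <= 1 :> R by rewrite exprn_ile1//; lra.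
have p0 : 0 <= 2^-1 ^+ j :> R by rewrite exprn_ge0.
apply: (@attempt_lower k s b (j * (attempt_time k).+1 + 1)) => //.
- by rewrite subr_ge0.
- by move=> b' s'; apply: run_ge0 => b'' s''; rewrite lee_fin.
- move=> [|b'] s' bb' s'2 gs'; first by rewrite addn1 in bb'.
  rewrite run_while_false; last by rewrite /= s'2.
  by rewrite indicE mem_set.
- by move=> b' s' bb' fs'; exact: IH.
- by move: bb; rewrite mulSn; move: (attempt_time k) => a; move: (j * a.+1)%N; clear; lia.
Qed.

Lemma expected_time_le k s : (n < 2 ^ k)%N -> frame m n A e s ->
  (expected_time D T (balance_prog c) s good <= (2 * (attempt_time k).+2)%:R%:E)%E.
Proof.
(* One unit more than an attempt with its guard, so that for j > 0 a budget of j tau also covers the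
   final guard. *)
move=> nk fs; set tau := (attempt_time k).+2.
rewrite /expected_time.
have succ1 t : (success_probability D T (balance_prog c) s good t <= 1)%E.
  apply: run_le1 => b' s'; rewrite !lee_fin indicE.
  by case: (_ \in _); rewrite ?lexx ?ler01.
have succ0 t : (0 <= success_probability D T (balance_prog c) s good t)%E.
  by apply: run_ge0 => b' s'; rewrite lee_fin.
have term t : (1 - success_probability D T (balance_prog c) s good t <=
    (2^-1 ^+ (t %/ tau))%:E)%E.
  rewrite leeBlDr//; last by rewrite fin_numE; apply/andP; split;
    apply/eqP => h; have := succ1 t; have := succ0 t; rewrite h.
  have [j0|j0] := posnP (t %/ tau)%N.
    by rewrite j0 expr0 leeDl.
  have h : ((t %/ tau) * (attempt_time k).+1 + 1 <= t)%N.
    apply: (@leq_trans ((t %/ tau) * (attempt_time k).+2)%N); last exact: leq_divM.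
    by rewrite [leqRHS]mulnS addnC leq_add2r.
  have := balance_lower nk fs h; rewrite EFinB leeBlDr// => h1.
  by rewrite addeC.
apply: lime_le.
  apply: is_cvg_nneseries => t _ _; rewrite leeBrDr ?add0e//.
  rewrite fin_numE; apply/andP; split; apply/eqP => h.
    by have := succ0 t; rewrite h.
  by have := succ1 t; rewrite h.
apply: nearW => N /=.
apply: (@le_trans _ _ (\sum_(0 <= t < N) (2^-1 ^+ (t %/ tau) : R)%:E)%E).
  by apply: lee_sum => t _.
rewrite sumEFin lee_fin.
exact: sum_halves_le.
Qed.

End Balance.

(** As mn <= T(m, n), the bookkeeping is dominated by T as well: 27 T for each round and 32 T for
    the rest. *)
Lemma attempt_time_le (T : nat -> nat -> nat) m n k : (0 < n)%N -> (n <= m)%N ->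
  (m * n <= T m n)%N -> (0 < k)%N ->
  ((attempt_time T m n k).+2 <= 59 * (k * T m n))%N.
Proof.
move=> n0 nm mnT k0; rewrite /attempt_time /round_time.
have m0 : (0 < m)%N by apply: leq_trans nm.
have mT : (m <= T m n)%N by apply: leq_trans mnT; rewrite leq_pmulr.
move: (T m n) mnT mT => t mnt mt.
have mn3 : (m * (n * 3 + 10) = 3 * (m * n) + 10 * m)%N by ring.
have nm3 : (n * (m * 3 + 7) = 3 * (m * n) + 7 * n)%N by ring.
rewrite mn3 nm3; move: (m * n)%N mnt {mn3 nm3} => a at_.
have r : (1 + (1 + (3 * a + 7 * n) + 2 + (t.+1 + (2 + (n * 7 + 2)))) <= 27 * t)%N by lia.
have kr := leq_mul (leqnn k) r.
have kt : (t <= k * t)%N by rewrite leq_pmull.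
have kE : (k * (27 * t) = 27 * (k * t))%N by ring.
rewrite kE in kr; move: (k * t)%N (k * _)%N kr kt {kE r} => b c cb tb; lia.
Qed.

(** The summand 1 accounts for n = 1, where one round is still made although ln n = 0. *)
Lemma trunc_log_le_ln (R : realType) n : (0 < n)%N ->
  ((trunc_log 2 n).+1)%:R <= 2 * (1 + ln n%:R) :> R.
Proof.
move=> n0; have n0' : 0 < n%:R :> R by rewrite ltr0n.
have h : (2 ^ trunc_log 2 n <= n)%N by exact: trunc_logP.
have ln2 : 2^-1 <= ln 2 :> R.
  have := @log_ratio_ge R 1 1; rewrite /log_ratio divr1 mulr1; exact.
have {}h : (trunc_log 2 n)%:R * ln 2 <= ln n%:R :> R.
  by rewrite mulr_natl -lnXn// ler_ln ?posrE ?exprn_gt0// -natrX ler_nat.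
have := ler0n R (trunc_log 2 n); rewrite -natr1.
move: (trunc_log 2 n)%:R h => k h k0; nra.
Qed.

Theorem theorem3 (R : realType) :
  (exists C : R, 0 < C /\
     forall (m n : nat) (p q : \bar R),
       (0 < n)%N -> (n <= m)%N -> (2%:E <= p)%E -> (p <= q)%E ->
       (vb n (@lp_ball R m p) (@lp_ball R m q) <= C%:E * vb_rate m n p q)%E)
  /\
  (forall C1 C2 K : R, 0 < C1 -> 0 < C2 -> 0 < K ->
   exists (C : R) (prog : cmd), 0 < C /\
     forall (D : sampler R) (T : nat -> nat -> nat),
       lovett_meka_sampler C1 C2 K D -> sampling_time T ->
     forall (m n : nat) (p q : \bar R) (v : 'I_n -> 'cV[R]_m),
       (0 < n)%N -> (n <= m)%N -> (2%:E <= p)%E -> (p <= q)%E ->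
       (forall j, @lp_ball R m p (v j)) ->
       (expected_time D T prog (input_state p q v)
          [set s | good_coloring C p q v (output n s)]
        <= (C * (1 + ln n%:R) * (T m n)%:R)%:E)%E).
Proof.
split; first exact: vb_upper_bound.
move=> C1 C2 K C10 C20 K0.
(* Programs contain only natural constants, hence the rounding up; c depends on C1, C2 and K
   alone. *)
pose c := (Num.truncn (64 * (12 * lovett_meka_const C1 C2 K))).+1.
have c1 : 64 * (12 * lovett_meka_const C1 C2 K) <= c%:R by rewrite ltW// truncnS_gt.
(* c serves the coloring and 4 times 59 the time: 59 from [attempt_time_le], 2 from the restarts and
   2 from [trunc_log_le_ln]. *)
exists (c%:R + 4 * 59), (balance_prog c); split; first by rewrite ltr_pwDr// mulr_gt0.
move=> D T lmD timeT m n p q v n0 nm p2 pq vP.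
set s := input_state p q v; set k := (trunc_log 2 n).+1.
have cC : c%:R <= c%:R + 4 * 59 :> R by rewrite lerDl mulr_ge0.
have Av (i : 'I_m) (j : 'I_n) : arr s 0 i j = v j i 0 by rewrite /= !valK.
have fs : frame m n (arr s 0) (arr s 1 0) s by split.
have nk : (n < 2 ^ k)%N by exact: trunc_log_ltn.
apply: le_trans (expected_time_le C10 C20 K0 lmD timeT n0 nm p2 pq Av vP erefl erefl
  cC c1 (ltn0Sn _) nk fs) _.
rewrite lee_fin.
have [_ mnT] := timeT.
have := attempt_time_le n0 nm (mnT _ _ (leq_trans n0 nm) n0) (ltn0Sn (trunc_log 2 n)).
rewrite -(ler_nat R) -/k => h1; rewrite natrM.
apply: (@le_trans _ _ (2 * (59 * (k%:R * (T m n)%:R)))).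
  by rewrite ler_pM2l// -!natrM.
have ln0 : 0 <= 1 + ln n%:R :> R by rewrite addr_ge0// ln_ge0// ler1n.
have T0 : 0 <= (T m n)%:R :> R by [].
apply: (@le_trans _ _ (2 * (59 * (2 * (1 + ln n%:R) * (T m n)%:R)))).
  by rewrite ler_pM2l// ler_pM2l// ler_wpM2r// trunc_log_le_ln.
have -> : 2 * (59 * (2 * (1 + ln n%:R) * (T m n)%:R)) =
  4 * 59 * (1 + ln n%:R) * (T m n)%:R :> R by ring.
by rewrite ler_wpM2r// ler_wpM2r// lerDr.
Qed.
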